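(* The theory $\mathrm{CT}^-_t$ extended with the induction scheme for all $\Delta_0$ formulae of the full language $\mathcal{L}_{\mathrm{PA}}\cup\{T\}$ and with the regularity principle $$\forall\phi(v)\,\forall t,s\,\bigl(s^{\circ}=t^{\circ}\rightarrow(T\phi(t)\leftrightarrow T\phi(s))\bigr)$$ is not conservative over $\mathrm{PA}$, i.e. it proves some arithmetical sentence not provable in $\mathrm{PA}$.
   Context: $\mathcal{L}_{\mathrm{PA}}$ is the language of Peano Arithmetic with function symbols $0,S,+,\times$ and equality as the only predicate symbol; formulae are built from atomic formulae $s=t$ by $\neg,\wedge,\vee,\exists,\forall$. Fix a Gödel coding; syntactic objects are identified with their codes and syntactic notions are expressed by natural arithmetical formulae. $t^{\circ}$ is the value of a closed term $t$. Inside the theories, $\phi,\psi$ range over codes of $\mathcal{L}_{\mathrm{PA}}$-sentences, $\phi(v)$ over codes of $\mathcal{L}_{\mathrm{PA}}$-formulae with at most the free variable $v$, $s,t$ over codes of closed terms, $v$ over codes of variables; $\phi(t)$ is the result of substituting $t$ for the free occurrences of $v$ in $\phi(v)$. $\mathrm{CT}^-_t$ is the theory in $\mathcal{L}_{\mathrm{PA}}\cup\{T\}$ ($T$ a unary predicate) with the axioms of $\mathrm{PA}$ (induction only for arithmetical formulae) and, for $\otimes\in\{\wedge,\vee\}$, $Q\in\{\forall,\exists\}$: (1) $\forall s,t\,(T(s=t)\leftrightarrow s^{\circ}=t^{\circ})$; (2) $\forall\phi,\psi\,(T(\phi\otimes\psi)\leftrightarrow T\phi\otimes T\psi)$; (3)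 $\forall\phi\,(T(\neg\phi)\leftrightarrow\neg T\phi)$; (4) $\forall v,\phi(v)\,(T(Qv\,\phi(v))\leftrightarrow Qt\,T(\phi(t)))$, where $t$ ranges over all closed terms. A $\Delta_0$ formula is one in which all quantifiers are bounded. *)

(* Defs.v *)
From Stdlib Require List.
From mathcomp Require Import all_boot.

Set Implicit Arguments.
Unset Strict Implicit.
Unset Printing Implicit Defensive.

(* Formulae of L_PA + {T}, with named variables; [Tr t] is T(t). *)

Inductive term : Type :=
| Var of nat
| Zero
| Succ of term
| Add of term & term
| Mul of term & term.

Inductive form : Type :=
| Eq of term & term
| Tr of term
| Neg of form
| And of form & form
| Or of form & form
| Ex of nat & form
| All of nat & form.

Definition Imp (p q : form) : form := Or (Neg p) q.
Definition Iff (p q : form) : form := And (Imp p q) (Imp q p).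

Declare Scope form_scope.
Delimit Scope form_scope with form.
Bind Scope form_scope with form.
Notation "s =' t" := (Eq s t) (at level 70, no associativity) : form_scope.
Notation "~' p" := (Neg p) (at level 35, right associativity) : form_scope.
Notation "p /\' q" := (And p q) (at level 80, right associativity) : form_scope.
Notation "p \/' q" := (Or p q) (at level 85, right associativity) : form_scope.
Notation "p ->' q" := (Imp p q) (at level 90, right associativity) : form_scope.
Notation "p <->' q" := (Iff p q) (at level 95, no associativity) : form_scope.
Local Open Scope form_scope.

Fixpoint tvars (t : term) : seq nat :=
  match t with
  | Var x => [:: x]
  | Zero => [::]
  | Succ s => tvars s
  | Add s u | Mul s u => tvars s ++ tvars u
  end.

Fixpoint fv (p : form) : seq nat :=
  match p with
  | Eq s t => tvars s ++ tvars t
  | Tr t => tvars t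
  | Neg q => fv q
  | And q r | Or q r => fv q ++ fv r
  | Ex x q | All x q => [seq y <- fv q | y != x]
  end.

Definition sentence (p : form) : bool := nilp (fv p).

Fixpoint arithmetical (p : form) : bool :=
  match p with
  | Eq _ _ => true
  | Tr _ => false
  | Neg q | Ex _ q | All _ q => arithmetical q
  | And q r | Or q r => arithmetical q && arithmetical r
  end.

Fixpoint tsubst (x : nat) (u t : term) : term :=
  match t with
  | Var y => if y == x then u else Var y
  | Zero => Zero
  | Succ s => Succ (tsubst x u s)
  | Add s r => Add (tsubst x u s) (tsubst x u r)
  | Mul s r => Mul (tsubst x u s) (tsubst x u r)
  end.

(* Plain replacement of the free occurrences of x by u; bound variables are
   not renamed, so it is meaningful only when [freefor u x p] holds. *)
Fixpoint subst (x : nat) (u : term) (p : form) : form :=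
  match p with
  | Eq s t => Eq (tsubst x u s) (tsubst x u t)
  | Tr t => Tr (tsubst x u t)
  | Neg q => Neg (subst x u q)
  | And q r => And (subst x u q) (subst x u r)
  | Or q r => Or (subst x u q) (subst x u r)
  | Ex y q => if y == x then p else Ex y (subst x u q)
  | All y q => if y == x then p else All y (subst x u q)
  end.

Fixpoint freefor (u : term) (x : nat) (p : form) : bool :=
  match p with
  | Eq _ _ | Tr _ => true
  | Neg q => freefor u x q
  | And q r | Or q r => freefor u x q && freefor u x r
  | Ex y q | All y q =>
      (x \notin fv p) || ((y \notin tvars u) && freefor u x q)
  end.

Definition closure (p : form) : form := foldr All p (undup (fv p)).

Inductive prv (A : form -> Prop) : seq form -> form -> Prop :=
| prv_ax G p : A p -> prv A G p
| prv_hyp G p : List.In p G -> prv A G p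
| prv_weak G H p : List.incl G H -> prv A G p -> prv A H p
| prv_negI G p q : prv A (p :: G) q -> prv A (p :: G) (~' q) -> prv A G (~' p)
| prv_raa G p q : prv A (~' p :: G) q -> prv A (~' p :: G) (~' q) -> prv A G p
| prv_andI G p q : prv A G p -> prv A G q -> prv A G (p /\' q)
| prv_andEl G p q : prv A G (p /\' q) -> prv A G p
| prv_andEr G p q : prv A G (p /\' q) -> prv A G q
| prv_orIl G p q : prv A G p -> prv A G (p \/' q)
| prv_orIr G p q : prv A G q -> prv A G (p \/' q)
| prv_orE G p q r :
    prv A G (p \/' q) -> prv A (p :: G) r -> prv A (q :: G) r -> prv A G r
| prv_allI G x p :
    all (fun q => x \notin fv q) G -> prv A G p -> prv A G (All x p)
| prv_allE G x t p :
    freefor t x p -> prv A G (All x p) -> prv A G (subst x t p)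
| prv_exI G x t p :
    freefor t x p -> prv A G (subst x t p) -> prv A G (Ex x p)
| prv_exE G x p r :
    all (fun q => x \notin fv q) (r :: G) ->
    prv A G (Ex x p) -> prv A (p :: G) r -> prv A G r
| prv_eqI G t : prv A G (t =' t)
| prv_eqE G x s t p :
    freefor s x p -> freefor t x p ->
    prv A G (s =' t) -> prv A G (subst x s p) -> prv A G (subst x t p).

(* Axioms are meant to be sentences. *)
Definition theory := form -> Prop.

Definition proves (A : theory) (p : form) : Prop := prv A [::] p.

Definition induction (x : nat) (p : form) : form :=
  closure
    (subst x Zero p /\' All x (p ->' subst x (Succ (Var x)) p) ->' All x p).

Inductive PA : theory :=
| PA_succ0 : PA (All 0 (~' (Succ (Var 0) =' Zero)))
| PA_succI :
    PA (All 0 (All 1 (Succ (Var 0) =' Succ (Var 1) ->' Var 0 =' Var 1)))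
| PA_add0 : PA (All 0 (Add (Var 0) Zero =' Var 0))
| PA_addS :
    PA (All 0 (All 1
      (Add (Var 0) (Succ (Var 1)) =' Succ (Add (Var 0) (Var 1)))))
| PA_mul0 : PA (All 0 (Mul (Var 0) Zero =' Zero))
| PA_mulS :
    PA (All 0 (All 1
      (Mul (Var 0) (Succ (Var 1)) =' Add (Mul (Var 0) (Var 1)) (Var 0))))
| PA_induction x p : arithmetical p -> PA (induction x p).

(* s <= t, where the variable k must not occur in s and t. *)
Definition le_f (k : nat) (s t : term) : form := Ex k (Add (Var k) s =' t).

Inductive Delta0 : form -> Prop :=
| Delta0_eq s t : Delta0 (s =' t)
| Delta0_tr t : Delta0 (Tr t)
| Delta0_neg p : Delta0 p -> Delta0 (~' p)
| Delta0_and p q : Delta0 p -> Delta0 q -> Delta0 (p /\' q)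
| Delta0_or p q : Delta0 p -> Delta0 q -> Delta0 (p \/' q)
| Delta0_ex k x t p :
    x \notin tvars t -> k \notin x :: tvars t -> Delta0 p ->
    Delta0 (Ex x (le_f k (Var x) t /\' p))
| Delta0_all k x t p :
    x \notin tvars t -> k \notin x :: tvars t -> Delta0 p ->
    Delta0 (All x (le_f k (Var x) t ->' p)).

Inductive Delta0_induction : theory :=
| Delta0_induction_ax x p : Delta0 p -> Delta0_induction (induction x p).

(* Arithmetized syntax of L_PA. Every formula below is a function of a number k
   and of argument terms. The variables of the arguments must be < k; the bound
   variables are taken among k, k+1, ..., so that no capture occurs. *)

Definition ex1 (k : nat) (F : nat -> term -> form) : form :=
  Ex k (F k.+1 (Var k)).
Definition all1 (k : nat) (F : nat -> term -> form) : form :=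
  All k (F k.+1 (Var k)).
Definition ex2 (k : nat) (F : nat -> term -> term -> form) : form :=
  ex1 k (fun k a => ex1 k (fun k b => F k a b)).

(* <a, b> = (a + b)^2 + a is injective since (a + b)^2 + a < (a + b + 1)^2, and
   it is a term of L_PA. It satisfies a, b <= <a, b>, and b < <a, b> if a > 0. *)
Definition pair_t (a b : term) : term := Add (Mul (Add a b) (Add a b)) a.

Definition num (n : nat) : term := iter n Succ Zero.

(* The Goedel coding: given terms denoting the codes of the immediate
   constituents, the terms denoting the code of the compound expression, where
   [c_var n] is the code of the n-th variable. In [c_ex v p] and [c_all v p], v
   is the code of a variable. *)
Definition c_var (n : term) := pair_t (num 1) n.
Definition c_zero := pair_t (num 2) Zero.
Definition c_succ (s : term) := pair_t (num 3) s.
Definition c_add (s t : term) := pair_t (num 4) (pair_t s t).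
Definition c_mul (s t : term) := pair_t (num 5) (pair_t s t).
Definition c_eq (s t : term) := pair_t (num 6) (pair_t s t).
Definition c_neg (p : term) := pair_t (num 7) p.
Definition c_and (p q : term) := pair_t (num 8) (pair_t p q).
Definition c_or (p q : term) := pair_t (num 9) (pair_t p q).
Definition c_ex (v p : term) := pair_t (num 10) (pair_t v p).
Definition c_all (v p : term) := pair_t (num 11) (pair_t v p).

(* y belongs to the finite set coded by (b, c, d):
   y <= b and 1 + (y + 1) d divides c. If d is a multiple of (b + 1)!, these
   divisors are pairwise coprime for y <= b, so every subset of {0, ..., b} has
   a code. *)
Definition mem_f (k : nat) (y b c d : term) : form :=
  le_f k y b /\' ex1 k (fun k q => Mul q (Succ (Mul (Succ y) d)) =' c).

(* x belongs to a finite set each of whose elements y satisfies [step], i.e., is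
   obtained by a clause of an inductive definition from elements of the set; the
   last argument of [step] is membership in the set. In all uses the elements
   are codes of expressions, or pairs with such a code as first component, and
   the clauses derive them from immediate constituents, which have smaller
   codes; hence this defines the least relation closed under the clauses. *)
Definition generated
    (step : nat -> term -> (nat -> term -> form) -> form)
    (k : nat) (x : term) : form :=
  ex1 k (fun k b => ex1 k (fun k c => ex1 k (fun k d =>
    let m := fun k y => mem_f k y b c d in
    m k x /\' all1 k (fun k y => m k y ->' step k y m)))).

Definition is_var (k : nat) (x : term) : form :=
  ex1 k (fun k n => x =' c_var n).

Definition cterm_step (k : nat) (y : term) (m : nat -> term -> form) : form :=
  y =' c_zero
  \/' ex1 k (fun k a => y =' c_succ a /\' m k a)
  \/' ex2 k (fun k a b => (y =' c_add a b \/' y =' c_mul a b) /\' m k a /\' m k b).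

Definition is_cterm := generated cterm_step.

Definition is_term :=
  generated (fun k y m => is_var k y \/' cterm_step k y m).

Definition is_form :=
  generated (fun k y m =>
    ex2 k (fun k a b => y =' c_eq a b /\' is_term k a /\' is_term k b)
    \/' ex1 k (fun k a => y =' c_neg a /\' m k a)
    \/' ex2 k (fun k a b => (y =' c_and a b \/' y =' c_or a b) /\' m k a /\' m k b)
    \/' ex2 k (fun k v a => (y =' c_ex v a \/' y =' c_all v a) /\' is_var k v /\' m k a)).

Definition occurs (k : nat) (v x : term) : form :=
  generated (fun k y m =>
    y =' v
    \/' ex1 k (fun k a => y =' c_succ a /\' m k a)
    \/' ex2 k (fun k a b => (y =' c_add a b \/' y =' c_mul a b) /\' (m k a \/' m k b)))
  k x.

Definition occurs_free (k : nat) (v x : term) : form :=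
  generated (fun k y m =>
    ex2 k (fun k a b => y =' c_eq a b /\' (occurs k v a \/' occurs k v b))
    \/' ex1 k (fun k a => y =' c_neg a /\' m k a)
    \/' ex2 k (fun k a b => (y =' c_and a b \/' y =' c_or a b) /\' (m k a \/' m k b))
    \/' ex2 k (fun k w a => (y =' c_ex w a \/' y =' c_all w a) /\' ~' (w =' v) /\' m k a))
  k x.

Definition is_sentence (k : nat) (x : term) : form :=
  is_form k x /\' all1 k (fun k w => is_var k w ->' ~' occurs_free k w x).

(* v is a variable and x is a formula with at most v free. *)
Definition is_form1 (k : nat) (v x : term) : form :=
  is_var k v /\' is_form k x
  /\' all1 k (fun k w => is_var k w /\' occurs_free k w x ->' w =' v).

(* x^o = y, for a closed term x. *)
Definition value (k : nat) (x y : term) : form :=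
  generated (fun k z m =>
    z =' pair_t c_zero Zero
    \/' ex2 k (fun k a i => z =' pair_t (c_succ a) (Succ i) /\' m k (pair_t a i))
    \/' ex2 k (fun k a i => ex2 k (fun k b j =>
          (z =' pair_t (c_add a b) (Add i j) \/' z =' pair_t (c_mul a b) (Mul i j))
          /\' m k (pair_t a i) /\' m k (pair_t b j))))
  k (pair_t x y).

(* x' results from the term x by replacing the variable v by t. *)
Definition term_subst (k : nat) (v t x x' : term) : form :=
  generated (fun k z m =>
    z =' pair_t v t
    \/' ex1 k (fun k w => z =' pair_t w w /\' is_var k w /\' ~' (w =' v))
    \/' z =' pair_t c_zero c_zero
    \/' ex2 k (fun k a a' => z =' pair_t (c_succ a) (c_succ a') /\' m k (pair_t a a'))
    \/' ex2 k (fun k a a' => ex2 k (fun k b b' =>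
          (z =' pair_t (c_add a b) (c_add a' b')
           \/' z =' pair_t (c_mul a b) (c_mul a' b'))
          /\' m k (pair_t a a') /\' m k (pair_t b b'))))
  k (pair_t x x').

(* x' results from the formula x by replacing the free occurrences of the
   variable v by t. *)
Definition form_subst (k : nat) (v t x x' : term) : form :=
  generated (fun k z m =>
    ex2 k (fun k a a' => ex2 k (fun k b b' =>
      z =' pair_t (c_eq a b) (c_eq a' b')
      /\' term_subst k v t a a' /\' term_subst k v t b b'))
    \/' ex2 k (fun k a a' => z =' pair_t (c_neg a) (c_neg a') /\' m k (pair_t a a'))
    \/' ex2 k (fun k a a' => ex2 k (fun k b b' =>
          (z =' pair_t (c_and a b) (c_and a' b')
           \/' z =' pair_t (c_or a b) (c_or a' b'))
          /\' m k (pair_t a a') /\' m k (pair_t b b')))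
    \/' ex1 k (fun k a => z =' pair_t (c_ex v a) (c_ex v a)
                          \/' z =' pair_t (c_all v a) (c_all v a))
    \/' ex1 k (fun k w => is_var k w /\' ~' (w =' v) /\' ex2 k (fun k a a' =>
          (z =' pair_t (c_ex w a) (c_ex w a')
           \/' z =' pair_t (c_all w a) (c_all w a'))
          /\' m k (pair_t a a'))))
  k (pair_t x x').

Definition same_value (k : nat) (s t : term) : form :=
  ex1 k (fun k y => value k s y /\' value k t y).

(* T(x(t)), where v is the variable of x that t is substituted for. *)
Definition Tr_inst (k : nat) (v x t : term) : form :=
  ex1 k (fun k y => form_subst k v t x y /\' Tr y).

Definition CT_eq : form :=
  all1 0 (fun k s => all1 k (fun k t =>
    is_cterm k s /\' is_cterm k t ->'
    (Tr (c_eq s t) <->' same_value k s t))).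

Definition CT_and : form :=
  all1 0 (fun k p => all1 k (fun k q =>
    is_sentence k p /\' is_sentence k q ->'
    (Tr (c_and p q) <->' Tr p /\' Tr q))).

Definition CT_or : form :=
  all1 0 (fun k p => all1 k (fun k q =>
    is_sentence k p /\' is_sentence k q ->'
    (Tr (c_or p q) <->' Tr p \/' Tr q))).

Definition CT_neg : form :=
  all1 0 (fun k p => is_sentence k p ->' (Tr (c_neg p) <->' ~' Tr p)).

Definition CT_ex : form :=
  all1 0 (fun k v => all1 k (fun k p =>
    is_form1 k v p ->'
    (Tr (c_ex v p) <->' ex1 k (fun k t => is_cterm k t /\' Tr_inst k v p t)))).

Definition CT_all : form :=
  all1 0 (fun k v => all1 k (fun k p =>
    is_form1 k v p ->'
    (Tr (c_all v p) <->' all1 k (fun k t => is_cterm k t ->' Tr_inst k v p t)))).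

Inductive CTminus_t : theory :=
| CTminus_t_PA p : PA p -> CTminus_t p
| CTminus_t_eq : CTminus_t CT_eq
| CTminus_t_and : CTminus_t CT_and
| CTminus_t_or : CTminus_t CT_or
| CTminus_t_neg : CTminus_t CT_neg
| CTminus_t_ex : CTminus_t CT_ex
| CTminus_t_all : CTminus_t CT_all.

Definition regularity : form :=
  all1 0 (fun k v => all1 k (fun k p => all1 k (fun k t => all1 k (fun k s =>
    is_form1 k v p /\' is_cterm k t /\' is_cterm k s ->'
    (same_value k t s ->' (Tr_inst k v p t <->' Tr_inst k v p s)))))).

Definition CT_Delta0_regular : theory := fun p =>
  [\/ CTminus_t p, Delta0_induction p | p = regularity].

(* Main.v *)
Require Import Defs.
From mathcomp Require Import all_boot.
From Stdlib Require Import Classical ClassicalEpsilon.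
From Stdlib Require Import FunctionalExtensionality PropExtensionality Ring.

(** The idea is to let a sentence G say that finite sets can imitate models of PA
    in which G is false, as well as one likes.

    Call a set E of numbers a diagram if it has the closure properties of the set
    of the pairs <x, c> such that the formula x holds of the element named c, in a
    model of PA all of whose Henkin witnesses have names. These properties are
    universal, so a diagram yields a model of PA (diagram_model), and by
    compactness (limit_set) there is a diagram if, for every N, some finite set
    has these properties for the parameters up to N (approximable). Let G say the
    latter for the diagrams that declare G false.

    PA does not prove G: if it did, G would be true, hence there would be a model
    of PA in which G is false, against soundness.

    The theory of truth proves G. By completeness, consider a model M with truth
    predicate T. If G is false in M, then M is itself a model of PA in which G is
    false, and it is enough to describe finite parts of the diagram of M inside M.
    This takes a satisfaction predicate that M can use in inductions. Inside M,
    define formulas sigma_0, sigma_1, ..., where sigma_(n+1) is Tarski's definition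
    of satisfaction for the formulas with code at most n, referring to sigma_n for
    their constituents. For nonstandard n this is a nonstandard formula, but it
    arises from sigma_n by a fixed standard context. For such contexts, finitely
    many applications of the axioms of T suffice to show that T says of the context
    filled with sigma_n what the context says of the set
    U_n = {a | T (sigma_n (a))} (truth); regularity makes U_n independent of the
    terms that denote a (says_hole).

    Induction for bounded formulas with T allows for induction on i for T (h_i),
    where the sequence of sentences h_i is arithmetically definable (truth_seq).
    As arbitrary quantifiers may occur within h_i, this is strong enough in two
    ways. First, U_n decides each formula in the same way for all n above its code
    (says_sat_class), so the sets U_n obey Tarski's clauses. Second, a context
    about i filled with sigma_n is such a sequence, so the sets U_n satisfy the
    induction axioms for all formulas (says_induction). Hence M can choose Henkin
    witnesses one after the other (names_exist) and collect the part of its diagram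
    below any bound (class_approximable).

    To avoid coding finite assignments, the formulas that occur in diagrams are
    predicates of a single element, a stack of values built by pairing (code). *)

Set Implicit Arguments.
Unset Strict Implicit.
Unset Printing Implicit Defensive.
Local Open Scope form_scope.

(** * Structures and soundness *)

(** A structure for the language of arithmetic. The extension of the truth
    predicate is a separate argument of satisfaction, since one structure is
    considered with several such predicates. *)
Record structure := Structure {
  car :> Type;
  s0 : car;
  sS : car -> car;
  sA : car -> car -> car;
  sM : car -> car -> car }.
Arguments s0 {_}.

Definition upd {X : Type} (e : nat -> X) (x : nat) (a : X) : nat -> X :=
  fun y => if y == x then a else e y.

Fixpoint eval (M : structure) (e : nat -> M) (t : term) : M :=
  match t with
  | Var x => e x
  | Zero => s0
  | Succ s => sS (eval e s)
  | Add s u => sA (eval e s) (eval e u)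
  | Mul s u => sM (eval e s) (eval e u)
  end.

Fixpoint sat (M : structure) (T : M -> Prop) (e : nat -> M) (p : form) : Prop :=
  match p with
  | Eq s t => eval e s = eval e t
  | Tr t => T (eval e t)
  | Neg q => ~ sat T e q
  | And q r => sat T e q /\ sat T e r
  | Or q r => sat T e q \/ sat T e r
  | Ex x q => exists a, sat T (upd e x a) q
  | All x q => forall a, sat T (upd e x a) q
  end.

Lemma upd_same X (e : nat -> X) x a : upd e x a x = a.
Proof. by rewrite /upd eqxx. Qed.

Lemma upd_other X (e : nat -> X) x a y : y != x -> upd e x a y = e y.
Proof. by rewrite /upd => /negbTE->. Qed.

Section Semantics.
Variables (M : structure) (T : M -> Prop).
Implicit Types (e : nat -> M) (p q : form).

Lemma eval_ext e e' t : {in tvars t, e =1 e'} -> eval e t = eval e' t.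
Proof.
elim: t => //= [x|s IH|s IHs u IHu|s IHs u IHu] h.
- by apply: h; rewrite inE.
- by rewrite IH.
- by rewrite IHs ?IHu // => x hx; apply: h; rewrite mem_cat hx ?orbT.
- by rewrite IHs ?IHu // => x hx; apply: h; rewrite mem_cat hx ?orbT.
Qed.

Lemma sat_ext e e' p : {in fv p, e =1 e'} -> (sat T e p <-> sat T e' p).
Proof.
elim: p e e' => /= [s t|t|p IH|p IHp q IHq|p IHp q IHq|x p IH|x p IH] e e' h.
- have -> : eval e s = eval e' s.
    by apply: eval_ext => y hy; apply: h; rewrite mem_cat hy.
  have -> // : eval e t = eval e' t.
  by apply: eval_ext => y hy; apply: h; rewrite mem_cat hy orbT.
- by rewrite (@eval_ext e e').
- by rewrite (IH e e').
- rewrite (IHp e e') ?(IHq e e') // => y hy; apply: h; rewrite mem_cat hy ?orbT //.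
- rewrite (IHp e e') ?(IHq e e') // => y hy; apply: h; rewrite mem_cat hy ?orbT //.
- have H a : sat T (upd e x a) p <-> sat T (upd e' x a) p.
    apply: IH => y hy; rewrite /upd; case: ifP => // /negbT ne.
    by apply: h; rewrite mem_filter ne.
  by split=> -[a /H]; exists a.
- have H a : sat T (upd e x a) p <-> sat T (upd e' x a) p.
    apply: IH => y hy; rewrite /upd; case: ifP => // /negbT ne.
    by apply: h; rewrite mem_filter ne.
  by split=> h' a; apply/H.
Qed.

Lemma sat_upd_fresh e x a p : x \notin fv p -> (sat T (upd e x a) p <-> sat T e p).
Proof.
move=> nx; apply: sat_ext => y hy; rewrite upd_other //.
by apply: contraNneq nx => <-.
Qed.

Lemma eval_upd_fresh e x a t : x \notin tvars t -> eval (upd e x a) t = eval e t.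
Proof.
move=> nx; apply: eval_ext => y hy; rewrite upd_other //.
by apply: contraNneq nx => <-.
Qed.

Lemma eval_tsubst e x u t : eval e (tsubst x u t) = eval (upd e x (eval e u)) t.
Proof.
elim: t => //= [y|s ->|s -> r ->|s -> r ->] //.
by rewrite /upd; case: eqP.
Qed.

Lemma tsubst_fresh x u t : x \notin tvars t -> tsubst x u t = t.
Proof.
elim: t => //= [y|s IH|s IHs r IHr|s IHs r IHr].
- by rewrite inE eq_sym => /negbTE->.
- by move=> /IH->.
- by rewrite mem_cat negb_or => /andP[/IHs-> /IHr->].
- by rewrite mem_cat negb_or => /andP[/IHs-> /IHr->].
Qed.

Lemma subst_fresh x u p : x \notin fv p -> subst x u p = p.
Proof.
elim: p => /= [s t|t|p IH|p IHp q IHq|p IHp q IHq|y p IH|y p IH].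
- by rewrite mem_cat negb_or => /andP[h1 h2]; rewrite !tsubst_fresh.
- by move=> h; rewrite tsubst_fresh.
- by move=> /IH->.
- by rewrite mem_cat negb_or => /andP[/IHp-> /IHq->].
- by rewrite mem_cat negb_or => /andP[/IHp-> /IHq->].
- by rewrite mem_filter negb_and negbK eq_sym => /orP[->//|/IH->]; rewrite if_same.
- by rewrite mem_filter negb_and negbK eq_sym => /orP[->//|/IH->]; rewrite if_same.
Qed.

Lemma sat_subst e x u p :
  freefor u x p -> (sat T e (subst x u p) <-> sat T (upd e x (eval e u)) p).
Proof.
have key e1 y a q : y != x -> y \notin tvars u ->
    (sat T (upd (upd e1 x (eval e1 u)) y a) q <->
     sat T (upd (upd e1 y a) x (eval (upd e1 y a) u)) q).
  move=> h hy; rewrite eval_upd_fresh //; apply: sat_ext => z _.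
  rewrite /upd; case: eqP => [->|//]; by rewrite (negbTE h).
elim: p e => /= [s t|t|p IH|p IHp q IHq|p IHp q IHq|y p IH|y p IH] e.
- by rewrite !eval_tsubst.
- by rewrite !eval_tsubst.
- by move=> h; rewrite (IH e).
- by move=> /andP[h1 h2]; rewrite (IHp e) // (IHq e).
- by move=> /andP[h1 h2]; rewrite (IHp e) // (IHq e).
- move=> h; have [xf|xf] := boolP (x \in fv (Ex y p)); last first.
    have -> : (if y == x then Ex y p else Ex y (subst x u p)) = Ex y p.
      exact: (@subst_fresh x u (Ex y p)).
    by rewrite -(@sat_upd_fresh e x (eval e u) (Ex y p)).
  move: h; rewrite xf /= => /andP[hy hf].
  have ne : y != x by move: xf; rewrite mem_filter eq_sym => /andP[].
  rewrite (negbTE ne) /=.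
  have H a : sat T (upd e y a) (subst x u p) <->
             sat T (upd (upd e x (eval e u)) y a) p.
    by rewrite key // IH.
  by split=> -[a /H]; exists a.
- move=> h; have [xf|xf] := boolP (x \in fv (All y p)); last first.
    have -> : (if y == x then All y p else All y (subst x u p)) = All y p.
      exact: (@subst_fresh x u (All y p)).
    by rewrite -(@sat_upd_fresh e x (eval e u) (All y p)).
  move: h; rewrite xf /= => /andP[hy hf].
  have ne : y != x by move: xf; rewrite mem_filter eq_sym => /andP[].
  rewrite (negbTE ne) /=.
  have H a : sat T (upd e y a) (subst x u p) <->
             sat T (upd (upd e x (eval e u)) y a) p.
    by rewrite key // IH.
  by split=> h' a; apply/H.
Qed.

Lemma allP_In (P : form -> bool) G q : all P G -> List.In q G -> P q.
Proof. by elim: G => //= r G IH /andP[hr hG] [<-|/IH]; auto. Qed.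

Lemma soundness (A : theory) (G : seq form) p :
  (forall q, A q -> forall e, sat T e q) -> prv A G p ->
  forall e, (forall q, List.In q G -> sat T e q) -> sat T e p.
Proof.
move=> HA; elim=> {G p}.
- by move=> G p /HA h e _.
- by move=> G p h e; apply.
- by move=> G H p h _ IH e hH; apply: IH => q /h /hH.
- move=> G p q _ IH1 _ IH2 e h /= hp.
  have h' r : List.In r (p :: G) -> sat T e r by move=> /= [<-|/h].
  exact: IH2 h' (IH1 _ h').
- move=> G p q _ IH1 _ IH2 e h /=; apply: NNPP => hp.
  have h' r : List.In r (~' p :: G) -> sat T e r by move=> /= [<-|/h].
  exact: IH2 h' (IH1 _ h').
- by move=> G p q _ IH1 _ IH2 e h; split; [apply: IH1|apply: IH2].
- by move=> G p q _ IH e /IH [].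
- by move=> G p q _ IH e /IH [].
- by move=> G p q _ IH e /IH; left.
- by move=> G p q _ IH e /IH; right.
- move=> G p q r _ IH _ IHp _ IHq e h.
  by case: (IH e h) => hh; [apply: IHp|apply: IHq] => s /= [<-|/h].
- move=> G x p hG _ IH e h a; apply: IH => q hq.
  by apply/sat_upd_fresh; [exact: (allP_In hG hq)|exact: h].
- by move=> G x t p hf _ IH e /IH h; apply/sat_subst.
- move=> G x t p hf _ IH e /IH h; exists (eval e t).
  exact/sat_subst.
- move=> G x p r /= /andP[hr hG] _ IH1 _ IH2 e h.
  have [a ha] := IH1 e h.
  apply/(sat_upd_fresh e a hr); apply: IH2 => q /= [<-//|hq].
  by apply/sat_upd_fresh; [exact: (allP_In hG hq)|exact: h].
- by [].
- move=> G x s t p h1 h2 _ IH1 _ IH2 e h.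
  by apply/(sat_subst _ h2); rewrite -(IH1 e h); apply/(sat_subst _ h1); apply: IH2.
Qed.

Lemma sat_foldr_All e p l :
  sat T e (foldr All p l) <-> (forall e', (forall x, x \notin l -> e' x = e x) -> sat T e' p).
Proof.
elim: l e => /= [|x l IH] e.
  split=> [h e' he|]; last by apply.
  by apply/(@sat_ext e' e) => // x _; apply: he.
split=> [h e' he|h a].
  have /IH := h (e' x); apply=> y hy; rewrite /upd; case: eqP => [->//|/eqP ne].
  by apply: he; rewrite inE negb_or ne hy.
apply/IH => e' he; apply: h => y; rewrite inE negb_or => /andP[ne hy].
by rewrite he // upd_other.
Qed.

Lemma sat_closure e p : sat T e (Defs.closure p) <-> (forall e', sat T e' p).
Proof.
rewrite /Defs.closure sat_foldr_All; split=> h e'; last by move=> _; apply: h.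
pose e1 x := if x \in fv p then e' x else e x.
apply/(@sat_ext e' e1) => [x hx|]; first by rewrite /e1 hx.
by apply: h => x; rewrite mem_undup /e1 => /negbTE->.
Qed.

(** Neither of the substitutions in an induction axiom can capture a variable. *)
Lemma freefor_zero x p : freefor Zero x p.
Proof. by elim: p => //= [p -> q ->|p -> q ->|y p ->|y p ->]; rewrite ?orbT. Qed.

Lemma freefor_succ x p : freefor (Succ (Var x)) x p.
Proof.
elim: p => //= [p -> q ->|p -> q ->|y p ->|y p ->] //;
by rewrite mem_filter inE andbT eq_sym; case: (y == x); rewrite ?orbT.
Qed.

Lemma sat_Imp e p q : sat T e (p ->' q) <-> (sat T e p -> sat T e q).
Proof. by split=> /= [[]//|h]; case: (classic (sat T e p)); [right; apply: h|left]. Qed.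

Lemma sat_Iff e p q : sat T e (p <->' q) <-> (sat T e p <-> sat T e q).
Proof.
by rewrite /Iff -[sat T e _]/(sat T e (p ->' q) /\ sat T e (q ->' p)) !sat_Imp; split=> -[].
Qed.

Lemma sat_induction e x p :
  sat T e (induction x p) <->
  (forall e', sat T (upd e' x s0) p ->
    (forall a, sat T (upd e' x a) p -> sat T (upd e' x (sS a)) p) ->
    forall a, sat T (upd e' x a) p).
Proof.
have E e' a : sat T (upd e' x a) (subst x (Succ (Var x)) p) <-> sat T (upd e' x (sS a)) p.
  rewrite sat_subst ?freefor_succ //; apply: sat_ext => z _ /=.
  by rewrite /upd eqxx; case: eqP.
rewrite /induction sat_closure; split=> h e'.
  move=> h0 hs; have /sat_Imp := h e'; apply; split.
    by apply/sat_subst; rewrite ?freefor_zero.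
  by move=> a; apply/sat_Imp => /hs /E.
apply/sat_Imp => -[/sat_subst h0 hs]; apply: h; first by apply: h0; apply: freefor_zero.
by move=> a; have /sat_Imp := hs a; rewrite E.
Qed.

End Semantics.

(** * Completeness *)

(** Representatives are chosen by a choice function that depends only on the
    class, and the quotient consists of the chosen representatives. *)
Lemma quotient (X : Type) (R : X -> X -> Prop) :
  (forall x, R x x) -> (forall x y, R x y -> R y x) ->
  (forall x y z, R x y -> R y z -> R x z) ->
  exists (Q : Type) (pi : X -> Q) (rep : Q -> X),
    (forall x y, pi x = pi y <-> R x y) /\ (forall q, pi (rep q) = q).
Proof.
move=> Rr Rs Rt; pose canon x := epsilon (inhabits x) (R x).
have Rc x : R x (canon x) by apply: (epsilon_spec (inhabits x) (R x)); exists x.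
have E x y : R x y -> canon x = canon y.
  move=> h; have RE : R x = R y.
    by apply: functional_extensionality => z; apply: propositional_extensionality;
       split; apply: Rt => //; apply: Rs.
  rewrite /canon RE; apply: epsilon_inh_irrelevance; by exists y.
have I x : canon (canon x) = canon x by apply: E; apply: Rs.
exists {x | canon x = x}, (fun x => exist (fun y => canon y = y) (canon x) (I x)),
  (@proj1_sig _ _); split.
  move=> x y; split=> [[h]|/E h]; last by apply: eq_sig_hprop => // *; apply: proof_irrelevance.
  by apply: Rt (Rc x) _; rewrite h; apply: Rs.
by move=> [x hx]; apply: eq_sig_hprop => // *; apply: proof_irrelevance.
Qed.

(** Terms modulo provable equality, and the names in a diagram modulo the equality
    that the diagram asserts, only form structures up to a congruence. *)
Record congruence (X : structure) (R : X -> X -> Prop) : Prop := Congruence {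
  cg_refl : forall x, R x x;
  cg_sym : forall x y, R x y -> R y x;
  cg_trans : forall x y z, R x y -> R y z -> R x z;
  cg_S : forall x y, R x y -> R (sS x) (sS y);
  cg_A : forall x x' y y', R x x' -> R y y' -> R (sA x y) (sA x' y');
  cg_M : forall x x' y y', R x x' -> R y y' -> R (sM x y) (sM x' y') }.

Lemma quotient_str (X : structure) (R : X -> X -> Prop) : congruence R ->
  exists (M : structure) (pi : X -> M),
    [/\ forall x y, pi x = pi y <-> R x y, forall a, exists x, pi x = a,
        pi s0 = s0 /\ (forall x, pi (sS x) = sS (pi x)),
        forall x y, pi (sA x y) = sA (pi x) (pi y) &
        forall x y, pi (sM x y) = sM (pi x) (pi y)].
Proof.
move=> C; have [Q [pi [rep [E K]]]] := quotient (cg_refl C) (cg_sym C) (@cg_trans _ _ C).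
have Kr x : R (rep (pi x)) x by apply/E; rewrite K.
exists (@Structure Q (pi s0) (fun a => pi (sS (rep a))) (fun a b => pi (sA (rep a) (rep b)))
          (fun a b => pi (sM (rep a) (rep b)))), pi; split=> //=.
- by move=> a; exists (rep a).
- by split=> // x; apply/E/(cg_S C)/(cg_sym C).
- by move=> x y; apply/E; apply: (cg_A C); apply: (cg_sym C).
- by move=> x y; apply/E; apply: (cg_M C); apply: (cg_sym C).
Qed.

(** Terms and formulas embed into a countable type of trees. *)
Fixpoint term_tree (t : term) : GenTree.tree nat :=
  match t with
  | Var x => GenTree.Leaf x
  | Zero => GenTree.Node 0 [::]
  | Succ s => GenTree.Node 1 [:: term_tree s]
  | Add s u => GenTree.Node 2 [:: term_tree s; term_tree u]
  | Mul s u => GenTree.Node 3 [:: term_tree s; term_tree u]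
  end.

Fixpoint form_tree (p : form) : GenTree.tree nat :=
  match p with
  | Eq s t => GenTree.Node 0 [:: term_tree s; term_tree t]
  | Tr t => GenTree.Node 1 [:: term_tree t]
  | Neg q => GenTree.Node 2 [:: form_tree q]
  | And q r => GenTree.Node 3 [:: form_tree q; form_tree r]
  | Or q r => GenTree.Node 4 [:: form_tree q; form_tree r]
  | Ex x q => GenTree.Node 5 [:: GenTree.Leaf x; form_tree q]
  | All x q => GenTree.Node 6 [:: GenTree.Leaf x; form_tree q]
  end.

Lemma form_enumeration : exists f : nat -> form, forall p, exists n, f n = p.
Proof.
have tI : injective term_tree.
  elim=> [x|||s IHs u IHu|s IHs u IHu] => [| |s IH| |] [y||s'|s' u'|s' u'] //=;
  try by case=> ->.
  - by case=> /IH->.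
  - by case=> /IHs-> /IHu->.
  - by case=> /IHs-> /IHu->.
have fI : injective form_tree.
  elim=> [s t|t|p IH|p IHp q IHq|p IHp q IHq|x p IH|x p IH]
         [s' t'|t'|p'|p' q'|p' q'|x' p'|x' p'] //=.
  - by case=> /tI-> /tI->.
  - by case=> /tI->.
  - by case=> /IH->.
  - by case=> /IHp-> /IHq->.
  - by case=> /IHp-> /IHq->.
  - by case=> -> /IH->.
  - by case=> -> /IH->.
pose P n p := pickle (form_tree p) = n.
exists (fun n => epsilon (inhabits (Zero =' Zero)) (P n)) => p.
exists (pickle (form_tree p)); apply: fI; apply: (pcan_inj pickleK).
by apply: (epsilon_spec (inhabits _) (P _)); exists p.
Qed.

Fixpoint vars (p : form) : seq nat :=
  match p with
  | Eq s t => tvars s ++ tvars t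
  | Tr t => tvars t
  | Neg q => vars q
  | And q r | Or q r => vars q ++ vars r
  | Ex x q | All x q => x :: vars q
  end.

Lemma fv_vars p : {subset fv p <= vars p}.
Proof.
elim: p => /= [s t|t|p IH|p IHp q IHq|p IHp q IHq|y p IH|y p IH] x //.
- exact: IH.
- by rewrite !mem_cat => /orP[/IHp->|/IHq->]; rewrite ?orbT.
- by rewrite !mem_cat => /orP[/IHp->|/IHq->]; rewrite ?orbT.
- by rewrite mem_filter inE => /andP[_ /IH->]; rewrite orbT.
- by rewrite mem_filter inE => /andP[_ /IH->]; rewrite orbT.
Qed.

Lemma freefor_new y x p : y \notin vars p -> freefor (Var y) x p.
Proof.
elim: p => //= [p IHp q IHq|p IHp q IHq|z p IH|z p IH].
- by rewrite mem_cat negb_or => /andP[/IHp-> /IHq->].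
- by rewrite mem_cat negb_or => /andP[/IHp-> /IHq->].
- by rewrite !inE negb_or eq_sym => /andP[-> /IH->]; rewrite orbT.
- by rewrite !inE negb_or eq_sym => /andP[-> /IH->]; rewrite orbT.
Qed.

Lemma freefor_absent t x p : x \notin vars p -> freefor t x p.
Proof.
elim: p => //= [p IHp q IHq|p IHp q IHq|y p IH|y p IH].
- by rewrite mem_cat negb_or => /andP[/IHp-> /IHq->].
- by rewrite mem_cat negb_or => /andP[/IHp-> /IHq->].
- rewrite inE negb_or mem_filter negb_and => /andP[_ h].
  by rewrite (contra (@fv_vars p x) h) orbT.
- rewrite inE negb_or mem_filter negb_and => /andP[_ h].
  by rewrite (contra (@fv_vars p x) h) orbT.
Qed.

Lemma freefor_var x p : freefor (Var x) x p.
Proof.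
elim: p => //= [p -> q ->|p -> q ->|y p ->|y p ->] //;
by rewrite mem_filter inE andbT eq_sym; case: (y == x); rewrite ?orbT.
Qed.

Lemma subst_var x p : subst x (Var x) p = p.
Proof.
have tE t : tsubst x (Var x) t = t.
  by elim: t => //= [y|s ->|s -> u ->|s -> u ->] //; case: eqP => [->|].
by elim: p => //= [s t|t|p ->|p -> q ->|p -> q ->|y p ->|y p ->];
   rewrite ?tE // if_same.
Qed.

Lemma tsubst_back x y t : y \notin tvars t -> tsubst y (Var x) (tsubst x (Var y) t) = t.
Proof.
elim: t => //= [z|s IH|s IHs r IHr|s IHs r IHr].
- rewrite inE => h; case: eqP => [->|_] /=; first by rewrite eqxx.
  by rewrite eq_sym (negbTE h).
- by move=> /IH->.
- by rewrite mem_cat negb_or => /andP[/IHs-> /IHr->].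
- by rewrite mem_cat negb_or => /andP[/IHs-> /IHr->].
Qed.

(** With a new variable y, renaming x to y can be undone; hence an existential
    formula implies each of its renamings. *)
Lemma subst_back x y p : y \notin vars p ->
  subst y (Var x) (subst x (Var y) p) = p /\ freefor (Var x) y (subst x (Var y) p).
Proof.
have Q z p' : (z == x) = false -> y \notin z :: vars p' ->
    (y \notin vars p' -> subst y (Var x) (subst x (Var y) p') = p' /\
      freefor (Var x) y (subst x (Var y) p')) ->
    (z == y) = false /\ subst y (Var x) (subst x (Var y) p') = p' /\
      (z \notin [:: x]) && freefor (Var x) y (subst x (Var y) p').
  rewrite !inE negb_or => -> /andP[/negbTE h1 h2] /(_ h2) [h3 h4].
  by rewrite eq_sym h1 h3 h4.
elim: p => /= [s t|t|p IH|p IHp q IHq|p IHp q IHq|z p IH|z p IH].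
- by rewrite mem_cat negb_or => /andP[h1 h2]; rewrite !tsubst_back.
- by move=> h1; rewrite !tsubst_back.
- by move=> /IH[-> ->].
- by rewrite mem_cat negb_or => /andP[/IHp[-> ->] /IHq[-> ->]].
- by rewrite mem_cat negb_or => /andP[/IHp[-> ->] /IHq[-> ->]].
- case: eqP => /= [_|/eqP/negbTE ne] h.
    have hf : y \notin fv (Ex z p) by apply: contra h; apply: (@fv_vars (Ex z p)).
    by rewrite -[X in X = _]/(subst y (Var x) (Ex z p)) subst_fresh // hf.
  by have [-> [-> ->]] := Q z p ne h IH; rewrite orbT.
- case: eqP => /= [_|/eqP/negbTE ne] h.
    have hf : y \notin fv (All z p) by apply: contra h; apply: (@fv_vars (All z p)).
    by rewrite -[X in X = _]/(subst y (Var x) (All z p)) subst_fresh // hf.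
  by have [-> [-> ->]] := Q z p ne h IH; rewrite orbT.
Qed.

Lemma tvars_tsubst x u t : x \notin tvars u -> x \notin tvars (tsubst x u t).
Proof.
move=> hu; elim: t => //= [y|s IHs r IHr|s IHs r IHr]; rewrite ?mem_cat ?negb_or ?IHs //.
by case: eqP => [//|/eqP]; rewrite inE eq_sym.
Qed.

Lemma fv_subst x u p : x \notin tvars u -> x \notin fv (subst x u p).
Proof.
move=> hu; elim: p => //= [s t|t|p IHp q IHq|p IHp q IHq|y p IH|y p IH].
- by rewrite mem_cat negb_or !tvars_tsubst.
- by rewrite tvars_tsubst.
- by rewrite mem_cat negb_or IHp.
- by rewrite mem_cat negb_or IHp.
- by case: eqP => [->|_] /=; rewrite mem_filter ?eqxx // negb_and IH orbT.
- by case: eqP => [->|_] /=; rewrite mem_filter ?eqxx // negb_and IH orbT.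
Qed.

Fixpoint size_form (p : form) : nat :=
  match p with
  | Eq _ _ | Tr _ => 0
  | Neg q | Ex _ q | All _ q => (size_form q).+1
  | And q r | Or q r => (size_form q + size_form r).+1
  end.

Lemma size_subst x u p : size_form (subst x u p) = size_form p.
Proof.
by elim: p => //= [p ->|p -> q ->|p -> q ->|y p IH|y p IH] //; case: eqP => //= _; rewrite IH.
Qed.

Definition new (l : seq nat) : nat := (\max_(i <- l) i).+1.

Lemma new_notin l : new l \notin l.
Proof.
apply/negP => h; suff: new l <= \max_(i <- l) i by rewrite /new ltnn.
rewrite (big_rem _ h) /=; exact: leq_maxl.
Qed.

Section Completeness.
Variable A : theory.
Local Notation "G |- p" := (prv A G p) (at level 96).

Lemma prv_cons G p q : (G |- q) -> (p :: G |- q).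
Proof. by apply: prv_weak => r; right. Qed.

Lemma prv_hd G p : p :: G |- p.
Proof. by apply: prv_hyp; left. Qed.

Lemma prv_cut G p q : (G |- p) -> (p :: G |- q) -> (G |- q).
Proof. by move=> h h'; exact: (prv_orE (prv_orIl p h) h' h'). Qed.

Lemma prv_absurd G p q : (G |- p) -> (G |- ~' p) -> (G |- q).
Proof. by move=> h h'; apply: prv_raa; apply: prv_cons; [exact: h|exact: h']. Qed.

Definition inconsistent G := exists p, (G |- p) /\ (G |- ~' p).

Lemma prv_rename x y p : y \notin vars (Ex x p) ->
  [:: Ex x p] |- Ex y (subst x (Var y) p).
Proof.
rewrite inE negb_or => /andP[ne hy]; have [E F] := subst_back x hy.
apply: (@prv_exE A _ x p); last 2 first.
- exact: prv_hd.
- apply: (prv_exI (t := Var x)) => //; rewrite E; exact: prv_hd.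
rewrite /= !mem_filter eqxx /= andbT negb_and.
by rewrite fv_subst ?orbT // inE eq_sym.
Qed.

(** A derivation of a contradiction from the witness axiom does not depend on the
    choice of y, so the renamed existential formula refutes the rest. *)
Lemma henkin_consistent G x p y :
  y \notin flatten [seq vars q | q <- Ex x p :: G] ->
  inconsistent (subst x (Var y) p :: Ex x p :: G) -> inconsistent (Ex x p :: G).
Proof.
set E := Ex x p => hy [q [h1 h2]].
have hE : y \notin vars E by apply: contra hy => h; rewrite mem_cat h.
have h r : (subst x (Var y) p :: E :: G) |- r by apply: prv_absurd h1 h2.
have h0 : E :: G |- ~' (Zero =' Zero).
  apply: (prv_exE (x := y) (p := subst x (Var y) p)) (h _); last first.
    apply: prv_weak (prv_rename hE) => r /= [<-|//]; by left.
  rewrite [all _ _]/(true && all _ (E :: G)) /=.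
  have : all (fun q => y \notin vars q) (E :: G).
    apply/all_filterP/esym; elim: (E :: G) hy => //= r l IH.
    by rewrite mem_cat negb_or => /andP[-> /IH <-].
  have Hs : subpred (fun q => y \notin vars q) (fun q => y \notin fv q).
    by move=> r; apply: contra; apply: fv_vars.
  by move=> /(sub_all Hs).
by exists (Zero =' Zero); split => //; apply: prv_eqI.
Qed.

Variables (enum : nat -> form) (enumP : forall p, exists n, enum n = p).
Variable G0 : seq form.
Hypothesis G0_consistent : ~ inconsistent G0.

(** The step of the Henkin construction. The language has no constants; a
    variable that is new to all formulas so far, free or bound, serves as the
    witness, so it can be substituted without capture. *)
Definition extend (G : seq form) (p : form) : seq form :=
  if excluded_middle_informative (inconsistent (p :: G)) then G else
  match p with
  | Ex x q => subst x (Var (new (flatten [seq vars r | r <- p :: G]))) q :: p :: G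
  | _ => p :: G
  end.

Fixpoint stage (n : nat) : seq form :=
  if n is k.+1 then extend (stage k) (enum k) else G0.

(** The maximal consistent theory that the construction leads to. *)
Definition thm p := exists n, stage n |- p.

Lemma extend_incl G p : List.incl G (extend G p).
Proof.
rewrite /extend; move=> q hq; case: excluded_middle_informative => // h.
by case: p h => *; do ?right.
Qed.

Lemma stage_incl m n : m <= n -> List.incl (stage m) (stage n).
Proof.
elim: n => [|n IH]; first by rewrite leqn0 => /eqP->.
rewrite leq_eqVlt ltnS => /orP[/eqP->//|/IH h q /h hq] /=.
exact: extend_incl.
Qed.

Lemma stage_consistent n : ~ inconsistent (stage n).
Proof.
elim: n => //= n IH; rewrite /extend; case: excluded_middle_informative => // h.
by case: (enum n) h => // x q h /(henkin_consistent (new_notin _)).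
Qed.

Lemma thm_all ps : (forall p, List.In p ps -> thm p) ->
  exists n, forall p, List.In p ps -> stage n |- p.
Proof.
elim: ps => [|p ps IH] h; first by exists 0.
have [n hn] : exists n, forall p, List.In p ps -> stage n |- p.
  by apply: IH => q hq; apply: h; right.
have [m hm] := h p (or_introl erefl).
exists (maxn m n) => q [<-|/hn hq].
- apply: prv_weak hm; apply: stage_incl; exact: leq_maxl.
- apply: prv_weak hq; apply: stage_incl; exact: leq_maxr.
Qed.

Lemma thm_closed ps q : (forall p, List.In p ps -> thm p) -> (ps |- q) -> thm q.
Proof.
move=> /thm_all [n hn] hq; exists n.
suff H l : (forall p, List.In p l -> stage n |- p) -> (l ++ stage n |- q) -> stage n |- q.
  apply: (H ps) => //; apply: prv_weak hq => p hp; apply/List.in_or_app; by left.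
elim: l => //= p l IH hl h; apply: IH => [r hr|]; first by apply: hl; right.
apply: prv_cut h; apply: (prv_weak (G := stage n)).
  by move=> r hr; apply/List.in_or_app; right.
by apply: hl; left.
Qed.

Lemma thm1 p q : thm p -> ([:: p] |- q) -> thm q.
Proof. by move=> h; apply: thm_closed => r /= [<-|[]]. Qed.

Lemma thm2 p p' q : thm p -> thm p' -> ([:: p; p'] |- q) -> thm q.
Proof. by move=> h h'; apply: thm_closed => r /= [<-|[<-|[]]]. Qed.

Lemma thm0 q : ([::] |- q) -> thm q.
Proof. by apply: thm_closed. Qed.

Lemma thm_consistent p : thm p -> thm (~' p) -> False.
Proof.
move=> [m hm] [n hn]; apply: (@stage_consistent (maxn m n)); exists p; split.
- apply: prv_weak hm; apply: stage_incl; exact: leq_maxl.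
- apply: prv_weak hn; apply: stage_incl; exact: leq_maxr.
Qed.

Lemma thm_decided p : thm p \/ thm (~' p).
Proof.
have [n hn] := enumP p; case: (classic (inconsistent (p :: stage n))) => [[q [h1 h2]]|h].
  by right; exists n; apply: prv_negI h1 h2.
left; exists n.+1; rewrite /= /extend hn; case: excluded_middle_informative => // h' /=.
by case: p {hn h h'} => *; apply: prv_hyp; rewrite /=; auto.
Qed.

Lemma thm_neg p : thm (~' p) <-> ~ thm p.
Proof.
split; first by move=> h /thm_consistent; apply.
by case: (thm_decided p).
Qed.

Lemma thm_witness x p : thm (Ex x p) ->
  exists2 y, y \notin vars p & thm (subst x (Var y) p).
Proof.
move=> h; have [n hn] := enumP (Ex x p).
set y := new (flatten [seq vars r | r <- Ex x p :: stage n]).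
have hy : y \notin vars p.
  have: y \notin flatten [seq vars r | r <- Ex x p :: stage n] by apply: new_notin.
  by rewrite /= inE mem_cat !negb_or => /andP[_ /andP[]].
exists y => //; exists n.+1; rewrite /= /extend hn.
case: excluded_middle_informative => [[q [h1 h2]]|h']; last exact: prv_hd.
by case: (@thm_consistent (Ex x p)) => //; exists n; apply: prv_negI h1 h2.
Qed.

(** Replacement of equals in the maximal theory, from which all clauses of the
    congruence of terms follow. *)
Lemma thm_rw x s t p : freefor s x p -> freefor t x p ->
  thm (s =' t) -> thm (subst x s p) -> thm (subst x t p).
Proof.
move=> h1 h2 h3 h4; apply: thm2 h3 h4 _; apply: (prv_eqE h1 h2).
  exact: prv_hd.
by apply: prv_hyp; right; left.
Qed.

Definition term_str : structure := @Structure term Zero Succ Add Mul.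

Lemma term_congruence : congruence (fun s t : term_str => thm (s =' t)).
Proof.
pose v (l : seq term) := new (flatten [seq tvars t | t <- l]).
have vP l t : List.In t l -> v l \notin tvars t.
  move=> ht; apply: contra (new_notin (flatten [seq tvars t | t <- l])).
  rewrite -/(v l); elim: l ht (v l) => //= r l IH [->|/IH h] z hz; rewrite mem_cat ?hz //.
  by rewrite h ?orbT.
have rw x s t (u u' : term) : x \notin tvars u ->
    thm (s =' t) -> thm (u =' tsubst x s u') -> thm (u =' tsubst x t u').
  move=> hu hst h; have := @thm_rw x s t (u =' u') isT isT hst.
  by rewrite /= !(tsubst_fresh _ hu); apply.
have rf s : thm (s =' s) by apply: thm0; apply: prv_eqI.
have sym s t : thm (s =' t) -> thm (t =' s).
  move=> hst; pose x := v [:: s]; have hx : x \notin tvars s by apply: vP; left.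
  have := @thm_rw x s t (Var x =' s) isT isT hst.
  by rewrite /= eqxx !(tsubst_fresh _ hx); apply.
have trans s t u : thm (s =' t) -> thm (t =' u) -> thm (s =' u).
  move=> hst htu; pose x := v [:: s]; have hx : x \notin tvars s by apply: vP; left.
  have := rw x t u s (Var x) hx htu; rewrite /= eqxx; exact.
have ctx s t (C : term -> term) x : thm (s =' t) -> x \notin tvars (C s) ->
    (forall u, tsubst x u (C (Var x)) = C u) -> thm (C s =' C t).
  by move=> hst hx hC; have := rw x s t (C s) (C (Var x)) hx hst; rewrite !hC; apply.
split=> //= [s t h|s s' t t' h h'|s s' t t' h h'].
- by apply: (ctx s t Succ (v [:: s]) h) => [|u] /=; rewrite ?eqxx //; apply: vP; left.
- have hv u : List.In u [:: s; t; s'; t'] -> v [:: s; t; s'; t'] \notin tvars u by apply: vP.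
  apply: (trans _ (Add s' t)).
  + apply: (ctx s s' (Add^~ t) (v [:: s; t; s'; t']) h) => [|u] /=.
      by rewrite mem_cat negb_or !hv //=; auto.
    by rewrite eqxx tsubst_fresh //; apply: hv; rewrite /=; auto.
  + apply: (ctx t t' (Add s') (v [:: s; t; s'; t']) h') => [|u] /=.
      by rewrite mem_cat negb_or !hv //=; auto.
    by rewrite eqxx tsubst_fresh //; apply: hv; rewrite /=; auto.
- have hv u : List.In u [:: s; t; s'; t'] -> v [:: s; t; s'; t'] \notin tvars u by apply: vP.
  apply: (trans _ (Mul s' t)).
  + apply: (ctx s s' (Mul^~ t) (v [:: s; t; s'; t']) h) => [|u] /=.
      by rewrite mem_cat negb_or !hv //=; auto.
    by rewrite eqxx tsubst_fresh //; apply: hv; rewrite /=; auto.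
  + apply: (ctx t t' (Mul s') (v [:: s; t; s'; t']) h') => [|u] /=.
      by rewrite mem_cat negb_or !hv //=; auto.
    by rewrite eqxx tsubst_fresh //; apply: hv; rewrite /=; auto.
Qed.

(** The Henkin witness of Ex x (t = x) is new to the formula it witnesses. Adding a
    tautology about p to that formula makes the witness avoid p as well. *)
Lemma thm_name t p : exists2 y, y \notin vars p & thm (t =' Var y).
Proof.
pose x := new (tvars t ++ vars p).
have /andP[hx hp] : (x \notin tvars t) && (x \notin vars p).
  by rewrite -negb_or -mem_cat new_notin.
have hp' : x \notin fv p by apply: contra hp; apply: fv_vars.
have : thm (Ex x ((t =' Var x) /\' (p \/' ~' p))).
  apply: thm0; apply: (prv_exI (t := t)).
    by rewrite /= freefor_absent.
  rewrite /= eqxx tsubst_fresh //; apply: prv_andI; first exact: prv_eqI.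
  rewrite subst_fresh //; apply: prv_raa (prv_hd _ _).
  apply: prv_orIr; apply: (prv_negI (q := p \/' ~' p)).
    by apply: prv_orIl; apply: prv_hd.
  by apply: prv_cons; apply: prv_hd.
move=> /thm_witness[y]; rewrite /= !mem_cat !negb_or => /andP[_ /andP[hy _]] h.
exists y => //; apply: thm1 h _; rewrite eqxx tsubst_fresh //.
by apply: prv_andEl; apply: prv_hd.
Qed.

Lemma henkin_model : exists (M : structure) (T : M -> Prop) (e : nat -> M),
  forall p, sat T e p <-> thm p.
Proof.
have [M [pi [piE surj [p0 pS] pA pM]]] := quotient_str term_congruence.
(* each variable denotes its own class *)
exists M, (fun a => exists2 t, pi t = a & thm (Tr t)), (fun x => pi (Var x)).
set T := fun a => _; set e := fun x => _.
have ev t : eval e t = pi t.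
  by elim: t => //= [s ->|s -> u ->|s -> u ->].
have namep a p : exists2 y, y \notin vars p & a = e y.
  have [t <-] := surj a; have [y hy h] := thm_name t p.
  by exists y => //; apply/piE.
(* an element is instantiated by a variable that names it and avoids p; this
   changes p, but not its size *)
suff H n p : size_form p < n -> (sat T e p <-> thm p).
  by move=> p; apply: (H (size_form p).+1).
elim: n p => // n IH [s t|t|p|p q|p q|x p|x p] /=; rewrite ltnS => hs.
- by rewrite !ev piE.
- rewrite ev; split=> [[u /piE h hu]|h]; last by exists t.
  by have := @thm_rw 0 u t (Tr (Var 0)) isT isT h; apply.
- by rewrite IH // thm_neg.
- have [h1 h2] : size_form p < n /\ size_form q < n.
    by split; apply: leq_trans hs; rewrite ltnS ?leq_addr ?leq_addl.
  rewrite (IH p) // (IH q) //; split=> [[hp hq]|h].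
    apply: thm2 hp hq _; apply: prv_andI; first exact: prv_hd.
    by apply: prv_cons; apply: prv_hd.
  by split; apply: thm1 h _; [apply: (prv_andEl (q := q))|apply: (prv_andEr (p := p))];
     apply: prv_hd.
- have [h1 h2] : size_form p < n /\ size_form q < n.
    by split; apply: leq_trans hs; rewrite ltnS ?leq_addr ?leq_addl.
  rewrite (IH p) // (IH q) //; split=> [[hp|hq]|h].
  + by apply: thm1 hp _; apply: prv_orIl; apply: prv_hd.
  + by apply: thm1 hq _; apply: prv_orIr; apply: prv_hd.
  case: (thm_decided p); [by left|move=> hp; right].
  apply: thm2 h hp _; apply: prv_orE; first exact: prv_hd.
    apply: (@prv_absurd _ p); first exact: prv_hd.
    by apply: prv_hyp; rewrite /=; auto.
  exact: prv_hd.
- split=> [[a]|/thm_witness[y hy]].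
    have [y hy ->] := namep a p => h; apply: thm1 (_ : thm (subst x (Var y) p)) _.
      by apply/IH; rewrite ?size_subst //; apply/sat_subst; rewrite ?freefor_new.
    apply: (prv_exI (t := Var y)); [exact: freefor_new|exact: prv_hd].
  move=> /IH; rewrite size_subst => /(_ hs) /sat_subst.
  by rewrite freefor_new // => /(_ isT) h; exists (e y).
- split=> [h|h a]; last first.
    have [y hy ->] := namep a p; have := @sat_subst M T e x (Var y) p.
    rewrite freefor_new // => /(_ isT) <-; apply/IH; rewrite ?size_subst //.
    apply: thm1 h _; apply: prv_allE; [exact: freefor_new|exact: prv_hd].
  apply: NNPP => /thm_neg hn.
  have : thm (Ex x (~' p)).
    apply: thm1 hn _; apply: prv_raa (_ : _ |- All x p) _; last first.
      by apply: prv_cons; apply: prv_hd.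
    have hx : x \notin fv (~' Ex x (~' p)) by rewrite /= mem_filter eqxx.
    apply: prv_cut (prv_hd _ _) _; apply: (prv_weak (G := [:: ~' Ex x (~' p)])).
      by move=> r /= [<-|[]]; left.
    apply: prv_allI; first by rewrite /= andbT mem_filter eqxx.
    apply: prv_raa (_ : _ |- Ex x (~' p)) _; last by apply: prv_cons; apply: prv_hd.
    apply: (prv_exI (t := Var x)).
      exact: freefor_var.
    rewrite /= subst_var; exact: prv_hd.
  move=> /thm_witness[y hy]; rewrite /= => /thm_neg; apply.
  apply/IH; rewrite ?size_subst //; apply/sat_subst; rewrite ?freefor_new //.
Qed.

End Completeness.

(** A validates its axioms under all assignments of the term model, not just the
    canonical one, because it proves their universal closures. *)
Lemma completeness (A : theory) (p : form) :
  (forall (M : structure) (T : M -> Prop), (forall q, A q -> forall e : nat -> M, sat T e q) ->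
     forall e : nat -> M, sat T e p) -> proves A p.
Proof.
move=> H; have [enum enumP] := form_enumeration.
case: (classic (inconsistent A [:: ~' p])) => [[q [h1 h2]]|cons].
  exact: prv_raa h1 h2.
have [M [T [e eP]]] := henkin_model enumP cons.
have hA q : A q -> forall e' : nat -> M, sat T e' q.
  move=> hq; apply/(@sat_closure M T e); apply/eP; apply: (thm0 (A := A)).
  rewrite /Defs.closure; elim: (undup _) => [|x l IH] /=; first exact: prv_ax.
  exact: prv_allI.
have /= hn : sat T e (~' p) by apply: (proj2 (eP _)); exists 0; apply: prv_hd.
by case: (hn (H M T hA e)).
Qed.

(** * Definable predicates *)

Declare Scope model_scope.
Delimit Scope model_scope with M.
Notation "a + b" := (sA a b) : model_scope.
Notation "a * b" := (sM a b) : model_scope.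
Local Open Scope model_scope.

Definition nm (M : structure) (n : nat) : M := iter n (@sS M) s0.
Definition pr (M : structure) (a b : M) : M := (a + b) * (a + b) + a.
Definition le (M : structure) (a b : M) : Prop := exists k, k + a = b.
Definition lt (M : structure) (a b : M) : Prop := le (sS a) b.
Notation "a <= b" := (le a b) : model_scope.
Notation "a < b" := (lt a b) : model_scope.
Arguments nm {M} n : simpl never.
Arguments pr {M} a b : simpl never.

Section Definability.
Variables (M : structure) (T : M -> Prop).
Implicit Types (e : nat -> M) (k : nat) (a b : M) (t : term) (f : form) (P : Prop).

(** Formulas are read at a level k: the variables below k carry the values of
    parameters, and bound variables are taken from k on, which is how the
    arithmetized syntax chooses them. [ext k e k' e'] means that e' agrees with e
    on the parameters. *)
Definition ext k e k' e' : Prop := (k <= k')%N /\ forall i, (i < k)%N -> e i = e' i.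

Definition den k e t a : Prop := forall k' e', ext k e k' e' -> eval e' t = a.

(** The formula f expresses P at level k, whatever the values of the variables
    from k on are. The syntax-directed rules below either verify a given formula
    or find one. *)
Definition rp k e f P : Prop := forall k' e', ext k e k' e' -> (sat T e' f <-> P).

Lemma ext_refl k e : ext k e k e.
Proof. by split. Qed.

Lemma ext_trans k e k' e' k'' e'' :
  ext k e k' e' -> ext k' e' k'' e'' -> ext k e k'' e''.
Proof.
move=> [h1 h2] [h3 h4]; split; first exact: leq_trans h1 h3.
by move=> i hi; rewrite h2 // h4 //; apply: leq_trans h1.
Qed.

Lemma ext_up k e k' e' b : ext k e k' e' -> ext k e k'.+1 (upd e' k' b).
Proof.
move=> [h1 h2]; split; first exact: leqW.
by move=> i hi; rewrite /upd ltn_eqF ?h2 //; apply: leq_trans h1.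
Qed.

Lemma ext_upd k e k' e' b : ext k e k' e' -> ext k.+1 (upd e k b) k'.+1 (upd e' k b).
Proof.
move=> [h1 h2]; split=> // i; rewrite ltnS leq_eqVlt /upd; case: eqP => //= _.
exact: h2.
Qed.

Lemma den_lift k e k' e' t a : den k e t a -> ext k e k' e' -> den k' e' t a.
Proof. by move=> h h1 k'' e'' h2; apply: h; apply: ext_trans h1 h2. Qed.

Lemma den_up k e t a b : den k e t a -> den k.+1 (upd e k b) t a.
Proof. by move=> h; apply: den_lift h _; apply/ext_up/ext_refl. Qed.

Lemma den_var x k e a : e x = a -> (x < k)%N -> den k e (Var x) a.
Proof. by move=> h hx k' e' [_ h'] /=; rewrite -h' // h. Qed.

Lemma den_top k e b : den k.+1 (upd e k b) (Var k) b.
Proof. by apply: den_var; rewrite ?upd_same. Qed.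

Lemma den_zero k e : den k e Zero s0.
Proof. by []. Qed.

Lemma den_succ k e t a : den k e t a -> den k e (Succ t) (sS a).
Proof. by move=> h k' e' h' /=; rewrite (h _ _ h'). Qed.

Lemma den_add k e s t a b : den k e s a -> den k e t b -> den k e (Add s t) (a + b).
Proof. by move=> h1 h2 k' e' h' /=; rewrite (h1 _ _ h') (h2 _ _ h'). Qed.

Lemma den_mul k e s t a b : den k e s a -> den k e t b -> den k e (Mul s t) (a * b).
Proof. by move=> h1 h2 k' e' h' /=; rewrite (h1 _ _ h') (h2 _ _ h'). Qed.

Lemma eval_num e n : eval e (num n) = nm n.
Proof. by elim: n => //= n ->. Qed.

Lemma den_num k e n : den k e (num n) (nm n).
Proof. by move=> k' e' h'; rewrite eval_num. Qed.

Lemma den_pr k e s t a b : den k e s a -> den k e t b -> den k e (pair_t s t) (pr a b).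
Proof. by move=> h1 h2; do ?apply: den_add => //; apply: den_mul; apply: den_add. Qed.

Lemma rp_T k e t a : den k e t a -> rp k e (Tr t) (T a).
Proof. by move=> h k' e' h' /=; rewrite (h _ _ h'). Qed.

Lemma rp_eq k e s t a b : den k e s a -> den k e t b -> rp k e (Eq s t) (a = b).
Proof. by move=> h1 h2 k' e' h' /=; rewrite (h1 _ _ h') (h2 _ _ h'). Qed.

Lemma rp_neg k e f P : rp k e f P -> rp k e (Neg f) (~ P).
Proof. by move=> h k' e' h' /=; rewrite (h _ _ h'). Qed.

Lemma rp_and k e f g P Q : rp k e f P -> rp k e g Q -> rp k e (And f g) (P /\ Q).
Proof. by move=> h1 h2 k' e' h' /=; rewrite (h1 _ _ h') (h2 _ _ h'). Qed.

Lemma rp_or k e f g P Q : rp k e f P -> rp k e g Q -> rp k e (Or f g) (P \/ Q).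
Proof. by move=> h1 h2 k' e' h' /=; rewrite (h1 _ _ h') (h2 _ _ h'). Qed.

Lemma rp_imp k e f g P Q : rp k e f P -> rp k e g Q -> rp k e (Imp f g) (P -> Q).
Proof. by move=> h1 h2 k' e' h'; rewrite sat_Imp (h1 _ _ h') (h2 _ _ h'). Qed.

Lemma rp_iff k e f g P Q : rp k e f P -> rp k e g Q -> rp k e (Iff f g) (P <-> Q).
Proof. by move=> h1 h2 k' e' h'; rewrite sat_Iff (h1 _ _ h') (h2 _ _ h'). Qed.

Lemma rp_upd k e f (P : M -> Prop) : (forall a, rp k.+1 (upd e k a) f (P a)) ->
  forall k' e', ext k e k' e' -> forall a, sat T (upd e' k a) f <-> P a.
Proof. by move=> h k' e' h' a; apply: h; apply: ext_upd h'. Qed.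

Lemma rp_ex k e f (P : M -> Prop) :
  (forall a, rp k.+1 (upd e k a) f (P a)) -> rp k e (Ex k f) (exists a, P a).
Proof. by move=> h k' e' h'; split=> -[a /(rp_upd h h')]; exists a. Qed.

Lemma rp_all k e f (P : M -> Prop) :
  (forall a, rp k.+1 (upd e k a) f (P a)) -> rp k e (All k f) (forall a, P a).
Proof. by move=> h k' e' h'; split=> h'' a; apply/(rp_upd h h'). Qed.

Lemma rp_le k e s t a b : den k e s a -> den k e t b -> rp k e (le_f k s t) (a <= b).
Proof.
move=> h1 h2; apply: rp_ex => c; apply: rp_eq; last exact: den_up.
by apply: den_add; [apply: den_top|apply: den_up].
Qed.

Lemma rp_lt k e s t a b : den k e s a -> den k e t b ->
  rp k e (le_f k (Succ s) t) (a < b).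
Proof. by move=> h1 h2; apply: rp_le h2; apply: den_succ. Qed.

(** The variable 0 is the argument, and the parameters ps come next. *)
Definition definable (P : M -> Prop) : Prop :=
  exists ps f, forall a, rp (size ps).+1 (nth a (a :: ps)) f (P a).

End Definability.

Arguments den_var {M} x {k e a}.

(** [rp_solve] finds a formula for a predicate built from the operations of the
    structure (or checks a given one): quantified variables get the levels k,
    k+1, ... and parameters the levels below. *)
Ltac ext_solve := repeat first [ assumption | apply ext_refl | apply ext_up ].
Ltac var_solve i :=
  first [ apply (den_var i); [reflexivity | reflexivity]
        | lazymatch i with 15 => fail | _ => let j := eval compute in (S i) in var_solve j end ].
Ltac den_leaf :=
  first [ apply den_top
        | solve [ eapply den_lift; [ eassumption | ext_solve ] ]
        | apply den_up; den_leaf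
        | var_solve O ].
Ltac den_hook := fail.
Ltac den_solve :=
  lazymatch goal with
  | |- den _ _ _ s0 => apply den_zero
  | |- den _ _ _ (sS _) => apply den_succ; den_solve
  | |- den _ _ _ (_ + _) => apply den_add; den_solve
  | |- den _ _ _ (_ * _) => apply den_mul; den_solve
  | |- den _ _ _ (nm _) => apply den_num
  | |- den _ _ _ (pr _ _) => apply den_pr; den_solve
  | |- den _ _ _ _ => first [ den_hook | den_leaf ]
  end.
Ltac rp_hook := fail.
Ltac rp_solve :=
  lazymatch goal with
  | |- rp _ _ _ _ (_ = _) => eapply rp_eq; den_solve
  | |- rp _ _ _ _ (~ _) => eapply rp_neg; rp_solve
  | |- rp _ _ _ _ (_ /\ _) => eapply rp_and; rp_solve
  | |- rp _ _ _ _ (_ \/ _) => eapply rp_or; rp_solve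
  | |- rp _ _ _ _ (_ <-> _) => eapply rp_iff; rp_solve
  | |- rp _ _ _ _ (_ <= _) => eapply rp_le; den_solve
  | |- rp _ _ _ _ (_ < _) => eapply rp_lt; den_solve
  | |- rp _ _ _ _ (exists _, _) => eapply rp_ex; intro; rp_solve
  | |- rp _ _ _ _ (forall _ : car _, _) => eapply rp_all; intro; rp_solve
  | |- rp _ _ _ _ (_ -> _) => eapply rp_imp; rp_solve
  | |- rp _ _ _ _ _ => first [ rp_hook | eapply rp_T; den_solve ]
  end.
Ltac definable_with ps := exists ps; eexists; intro; cbn [size]; rp_solve.

(** * Arithmetic in models of PA *)

Definition full_induction (M : structure) (T : M -> Prop) : Prop :=
  forall (f : form) (x : nat) (e : nat -> M), sat T (upd e x s0) f ->
    (forall a, sat T (upd e x a) f -> sat T (upd e x (sS a)) f) ->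
    forall a, sat T (upd e x a) f.

(** A model of PA has induction for the formulas with some interpretation of the
    truth predicate, which covers the arithmetical ones. Induction with a
    particular T is the separate property [full_induction T]. *)
Class pa_model (M : structure) : Prop := PaModel {
  q_S0 : forall a : M, sS a <> s0;
  q_SI : forall a b : M, sS a = sS b -> a = b;
  q_A0 : forall a : M, a + s0 = a;
  q_AS : forall a b : M, a + sS b = sS (a + b);
  q_M0 : forall a : M, a * s0 = s0;
  q_MS : forall a b : M, a * sS b = a * b + a;
  q_ind : exists T : M -> Prop, full_induction T }.

Lemma full_ind (M : structure) (T : M -> Prop) (P : M -> Prop) : full_induction T ->
  definable T P -> P s0 -> (forall a, P a -> P (sS a)) -> forall a, P a.
Proof.
move=> HI [ps [f fP]] h0 hS a.
have E b : sat T (upd (nth s0 (s0 :: ps)) 0 b) f <-> P b.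
  apply: (fP b (size ps).+1); split=> //= i hi; rewrite /upd; case: i hi => //= i hi.
  exact: set_nth_default.
by apply/E; apply: HI; [apply/E|move=> b /E hb; apply/E; apply: hS].
Qed.

Section Arithmetic.
Context {M : structure} {HM : pa_model M}.
Implicit Types (a b c d x y z : M).

(** The predicate has to be definable from the operations alone, hence for all
    interpretations of the truth predicate. *)
Lemma arith_ind (P : M -> Prop) : (forall T : M -> Prop, definable T P) ->
  P s0 -> (forall a, P a -> P (sS a)) -> forall a, P a.
Proof. by have [T HI] := @q_ind M HM => D; apply: full_ind HI (D T). Qed.

Notation one := (@nm M 1).

(** This form of the successor, with 1 as a constant, lets the ring tactic treat
    all operations. *)
Lemma S_one a : sS a = a + one.
Proof. by rewrite q_AS // q_A0. Qed.

Lemma nmS n : nm n.+1 = sS (nm n) :> M. Proof. by []. Qed.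

Lemma add_0l a : s0 + a = a.
Proof.
move: a; apply: arith_ind; first by move=> T; definable_with (@nil M).
  exact: q_A0.
by move=> a h; rewrite q_AS // h.
Qed.

Lemma add_Sl a b : sS a + b = sS (a + b).
Proof.
move: b; apply: arith_ind; first by move=> T; definable_with ([:: a] : seq M).
  by rewrite !q_A0.
by move=> b h; rewrite !q_AS // h.
Qed.

Lemma addC a b : a + b = b + a.
Proof.
move: b; apply: arith_ind; first by move=> T; definable_with ([:: a] : seq M).
  by rewrite q_A0 // add_0l.
by move=> b h; rewrite !q_AS // add_Sl h.
Qed.

Lemma addA a b c : a + (b + c) = a + b + c.
Proof.
move: c; apply: arith_ind; first by move=> T; definable_with ([:: a; b] : seq M).
  by rewrite !q_A0.
by move=> c h; rewrite !q_AS // h.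
Qed.

Lemma mul_0l a : s0 * a = s0.
Proof.
move: a; apply: arith_ind; first by move=> T; definable_with (@nil M).
  exact: q_M0.
by move=> a h; rewrite q_MS // h q_A0.
Qed.

Lemma mul_Sl a b : sS a * b = a * b + b.
Proof.
move: b; apply: arith_ind; first by move=> T; definable_with ([:: a] : seq M).
  by rewrite !q_M0 // q_A0.
move=> b h; rewrite !q_MS // h !q_AS //; congr sS.
by rewrite -!addA (addC b).
Qed.

Lemma mulC a b : a * b = b * a.
Proof.
move: b; apply: arith_ind; first by move=> T; definable_with ([:: a] : seq M).
  by rewrite q_M0 // mul_0l.
by move=> b h; rewrite q_MS // mul_Sl h.
Qed.

Lemma mulDl a b c : (a + b) * c = a * c + b * c.
Proof.
move: c; apply: arith_ind; first by move=> T; definable_with ([:: a; b] : seq M).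
  by rewrite !q_M0 // q_A0.
move=> c h; rewrite !q_MS // h -!addA; congr (_ + _).
by rewrite !addA (addC (_ * _)).
Qed.

Lemma mulA a b c : a * (b * c) = a * b * c.
Proof.
move: c; apply: arith_ind; first by move=> T; definable_with ([:: a; b] : seq M).
  by rewrite !q_M0.
by move=> c h; rewrite !q_MS // -h (mulC _ (_ + _)) mulDl (mulC _ a) (mulC _ a).
Qed.

Lemma mul_1l a : one * a = a.
Proof. by rewrite mul_Sl mul_0l add_0l. Qed.

Lemma semi_ring : semi_ring_theory (s0 : M) one (@sA M) (@sM M) eq.
Proof.
split; [exact: add_0l|exact: addC|exact: addA|exact: mul_1l|exact: mul_0l
       |exact: mulC|exact: mulA|exact: mulDl].
Qed.
Add Ring model_ring : semi_ring.
Ltac mring := rewrite ?S_one /pr; ring.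

Lemma add_inj c a b : a + c = b + c -> a = b.
Proof.
move: c; apply: arith_ind; first by move=> T; definable_with ([:: a; b] : seq M).
  by rewrite !q_A0.
by move=> c h; rewrite !q_AS // => /q_SI.
Qed.

Lemma add_S_neq a b : a = a + sS b -> False.
Proof.
have -> : a + sS b = sS b + a by mring.
by rewrite -{1}[a]add_0l => /add_inj/esym; apply: q_S0.
Qed.

Lemma case0 a : a = s0 \/ exists b, a = sS b.
Proof.
move: a; apply: arith_ind; first by move=> T; definable_with (@nil M).
  by left.
by move=> a _; right; exists a.
Qed.

Lemma add_eq0 a b : a + b = s0 -> b = s0.
Proof. by case: (case0 b) => [//|[c ->]]; rewrite q_AS // => /q_S0. Qed.

Lemma le_refl a : a <= a.
Proof. by exists s0; mring. Qed.

Lemma le_trans a b c : a <= b -> b <= c -> a <= c.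
Proof. by move=> [k <-] [l <-]; exists (l + k); mring. Qed.

Lemma le_0 a : s0 <= a.
Proof. by exists a; mring. Qed.

Lemma le_addr a b : a <= a + b.
Proof. by exists b; mring. Qed.

Lemma le_addl a b : a <= b + a.
Proof. by exists b. Qed.

Lemma lt_le a b : a < b -> a <= b.
Proof. by move=> [k <-]; exists (sS k); mring. Qed.

Lemma lt_S a : a < sS a.
Proof. exact: le_refl. Qed.

Lemma lt_le_trans a b c : a < b -> b <= c -> a < c.
Proof. exact: le_trans. Qed.

Lemma le_lt_trans a b c : a <= b -> b < c -> a < c.
Proof. by move=> [k <-] [l <-]; exists (l + k); mring. Qed.

Lemma lt_irrefl a : ~ a < a.
Proof. by move=> [k h]; apply: (@add_S_neq a k); rewrite -{1}h; mring. Qed.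

Lemma le_antisym a b : a <= b -> b <= a -> a = b.
Proof.
move=> [k <-] [l]; case: (case0 k) => [-> _|[c -> h]]; first by mring.
by case: (@add_S_neq a (l + c)); rewrite -{1}h; mring.
Qed.

Lemma lt_S_le a b : a < sS b -> a <= b.
Proof. by move=> [k h]; exists k; apply: q_SI; rewrite -h; mring. Qed.

Lemma le_lt_S a b : a <= b -> a < sS b.
Proof. by move=> [k <-]; exists k; mring. Qed.

Lemma le_or_lt a b : a <= b \/ b < a.
Proof.
move: b; apply: arith_ind; first by move=> T; definable_with ([:: a] : seq M).
  by case: (case0 a) => [->|[c ->]]; [left; apply: le_refl|right; exists c; mring].
move=> b [h|[k <-]]; first by left; apply: le_trans h (lt_le (lt_S b)).
case: (case0 k) => [->|[l ->]]; first by left; exists s0; mring.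
by right; exists l; mring.
Qed.

Lemma lt_not_le a b : a < b -> ~ b <= a.
Proof. by move=> h h'; apply: (@lt_irrefl a); apply: lt_le_trans h h'. Qed.

Lemma le_eq_or_lt a b : a <= b -> a = b \/ a < b.
Proof.
move=> [k <-]; case: (case0 k) => [->|[l ->]]; first by left; mring.
by right; exists l; mring.
Qed.

Lemma not_lt0 a : ~ a < s0.
Proof. by move=> [k]; rewrite q_AS // => /q_S0. Qed.

Lemma le_add a b c d : a <= b -> c <= d -> a + c <= b + d.
Proof. by move=> [k <-] [l <-]; exists (k + l); mring. Qed.

Lemma le_mul a b c d : a <= b -> c <= d -> a * c <= b * d.
Proof. by move=> [k <-] [l <-]; exists (k * l + k * c + a * l); mring. Qed.

Lemma full_strong_ind (T P : M -> Prop) : full_induction T ->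
  definable T (fun a => forall b, b < a -> P b) ->
  (forall a, (forall b, b < a -> P b) -> P a) -> forall a, P a.
Proof.
move=> HI D H a; apply: (H); move: a; apply: (full_ind HI D) => [b /not_lt0//|a h b].
by move=> /lt_S_le /le_eq_or_lt [->|]; [exact: H|exact: h].
Qed.

Lemma arith_strong_ind (P : M -> Prop) :
  (forall T : M -> Prop, definable T (fun a => forall b, b < a -> P b)) ->
  (forall a, (forall b, b < a -> P b) -> P a) -> forall a, P a.
Proof. by have [T HI] := @q_ind M HM => D; apply: full_strong_ind HI (D T). Qed.

End Arithmetic.

(** * Coded sets and inductive definitions in a model *)

Definition coded (M : structure) (b c d y : M) : Prop :=
  y <= b /\ exists q, q * sS (sS y * d) = c.

(** The counterpart of [generated], with the step as an operator on predicates. *)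
Definition gen (M : structure) (step : (M -> Prop) -> M -> Prop) (x : M) : Prop :=
  exists b c d, coded b c d x /\ forall y, coded b c d y -> step (coded b c d) y.

Definition monotone (M : structure) (step : (M -> Prop) -> M -> Prop) : Prop :=
  forall (m m' : M -> Prop) y, (forall z, m z -> m' z) -> step m y -> step m' y.

Section RpGen.
Variables (M : structure) (T : M -> Prop).
Implicit Types (e : nat -> M) (k : nat) (t : term).

Lemma rp_mem k e ty tb tc td (y b c d : M) : den k e ty y -> den k e tb b ->
  den k e tc c -> den k e td d -> rp T k e (mem_f k ty tb tc td) (coded b c d y).
Proof.
move=> hy hb hc hd; apply: rp_and; first exact: rp_le.
apply: rp_ex => q; apply: rp_eq; last exact: den_up.
apply: den_mul; first exact: den_top.
by apply: den_succ; apply: den_mul; [apply: den_succ|]; apply: den_up.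
Qed.

(** If the formula of the step expresses the operator for all formulas that
    express its predicate argument, then [generated] expresses [gen]. *)
Lemma rp_gen k e F (step : (M -> Prop) -> M -> Prop) t (a : M) :
  (forall k' e' ty y mF m, ext k e k' e' -> den k' e' ty y ->
     (forall k'' e'' t' y', ext k' e' k'' e'' -> den k'' e'' t' y' ->
        rp T k'' e'' (mF k'' t') (m y')) ->
     rp T k' e' (F k' ty mF) (step m y)) ->
  den k e t a -> rp T k e (generated F k t) (gen step a).
Proof.
move=> hF ht; apply: rp_ex => b; apply: rp_ex => c; apply: rp_ex => d.
set e3 := upd _ _ d.
have [hb hc hd] : [/\ den k.+3 e3 (Var k) b, den k.+3 e3 (Var k.+1) c &
    den k.+3 e3 (Var k.+2) d].
  by split; do ?[exact: den_top|apply: den_up].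
have h3 : ext k e k.+3 e3 by do 3 apply: ext_up; apply: ext_refl.
apply: rp_and.
  by apply: rp_mem => //; apply: den_lift ht h3.
apply: rp_all => y; apply: rp_imp.
  by apply: rp_mem; [apply: den_top|apply: den_up..].
apply: hF; last 2 first.
- exact: den_top.
- move=> k'' e'' t' y' h hy'; by apply: (rp_mem hy');
  (apply: den_lift h; apply: den_up).
- by apply: ext_up.
Qed.

End RpGen.

Ltac rp_hook ::=
  lazymatch goal with
  | |- rp _ _ _ _ (coded _ _ _ _) => eapply rp_mem; den_solve
  | H : forall _ _ _ _, ext _ _ _ _ -> den _ _ _ _ -> rp _ _ _ _ (?m _) |- rp _ _ _ _ (?m _) =>
      eapply H; [ext_solve | den_solve]
  end.

(** * Pairing *)

Section Coding.
Context {M : structure} {HM : pa_model M}.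
Implicit Types (a b c d x y z : M).
Add Ring model_ring : semi_ring.
Ltac mring := rewrite ?S_one /pr; ring.

(** Since (a + b)^2 + a < (a + b + 1)^2, pairs are ordered by the sums of their
    entries first. *)
Lemma pr_lt a b a' b' : a + b < a' + b' -> pr a b < pr a' b'.
Proof.
move=> [k h]; rewrite /pr -h; exists (b + b + a + (k * k + k + k + (k + k) * (a + b)) + a').
by mring.
Qed.

Lemma pr_inj a b a' b' : pr a b = pr a' b' -> a = a' /\ b = b'.
Proof.
have L := @lt_irrefl M HM.
move=> E; have E' : a + b = a' + b'.
  case: (le_or_lt (a + b) (a' + b')) => [/(le_eq_or_lt)[//|/pr_lt]|/pr_lt].
    by rewrite E => /L.
  by rewrite E => /L.
move: E; rewrite /pr E' => E.
have Ea : a = a'.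
  by apply: (add_inj (c := (a' + b') * (a' + b'))); rewrite !(addC _ (_ * _)).
split=> //; apply: (add_inj (c := a)); rewrite (addC b) E' Ea.
exact: addC.
Qed.

Lemma le_pr1 a b : a <= pr a b.
Proof. exact: le_addl. Qed.

Lemma le_pr2 a b : b <= pr a b.
Proof.
case: (case0 b) => [->|[c ->]]; first exact: le_0.
by exists (a * a + a + a * c + c * a + c * c + c + a + a); mring.
Qed.

Lemma lt_pr2 a b : b < pr (sS a) b.
Proof.
by exists (a * a + (a + a) * b + b * b + b + a + a + a + s0 + sS s0); mring.
Qed.

Lemma le_pr a b a' b' : a <= a' -> b <= b' -> pr a b <= pr a' b'.
Proof. by move=> h h'; do ?apply: le_add => //; apply: le_mul => //; apply: le_add. Qed.

Lemma pr_sub1 n a b : a < pr (nm n.+1) (pr a b).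
Proof. exact: le_lt_trans (le_pr1 _ _) (lt_pr2 _ _). Qed.

Lemma pr_sub2 n a b : b < pr (nm n.+1) (pr a b).
Proof. exact: le_lt_trans (le_pr2 _ _) (lt_pr2 _ _). Qed.

Lemma nm_inj m n : nm m = nm n :> M -> m = n.
Proof.
elim: m n => [|m IH] [|n] // h; first by case: (q_S0 (esym h)).
  by case: (q_S0 h).
by congr S; apply: IH; apply: (q_SI).
Qed.

(** * The existence of coded sets *)

Notation dvd a b := (exists q, q * a = b).

(** Divisibility of differences, stated without subtraction. *)
Lemma dvd_sub m a b : dvd m (a + b) -> dvd m b -> dvd m a.
Proof.
move=> [q1 h1] [q2 h2]; move: h1; rewrite -{}h2.
case: (le_or_lt q2 q1) => -[k <-] h.
  by exists k; apply: (add_inj (c := q2 * m)); rewrite -h; mring.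
exists s0; have {}h : a + sS k * m = s0.
  by apply: (add_inj (c := q1 * m)); rewrite (add_0l) [RHS]h; mring.
rewrite (mul_0l); apply/esym; apply: (add_eq0 (a := sS k * m)).
by rewrite -[RHS]h; mring.
Qed.

Lemma dvd_mull m a b : dvd m b -> dvd m (a * b).
Proof. by move=> [q <-]; exists (a * q); mring. Qed.

(** The moduli 1 + (y + 1) d and 1 + (z + 1) d are coprime, as their combination
    (z + 1) (1 + (y + 1) d) - (y + 1) (1 + (z + 1) d) = z - y divides d, and d is
    coprime to both. *)
Lemma gauss y z d c : y <> z ->
  (forall k, k < y \/ k < z -> dvd (sS k) d) ->
  dvd (sS (sS y * d)) (c * sS (sS z * d)) -> dvd (sS (sS y * d)) c.
Proof.
move=> ne hd.
have fin u m : sS (u * d) = m -> dvd m (c * d) -> dvd m c.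
  move=> <- h; apply: (@dvd_sub _ _ (u * (c * d))); last exact: dvd_mull.
  by exists c; mring.
case: (le_or_lt y z) => [/(le_eq_or_lt)[//|]|] [l hl] h;
  apply: (fin (sS y)) => //.
- have [w hw] : dvd (sS l) d by apply: hd; right; exists y; rewrite -hl; mring.
  rewrite -{2}hw; have -> : c * (w * sS l) = w * (c * sS l) by mring.
  apply: dvd_mull; apply: (dvd_sub (b := sS y * (c * sS (sS z * d)))); last exact: dvd_mull.
  by exists (c * sS z); rewrite -hl; mring.
- have [w hw] : dvd (sS l) d by apply: hd; left; exists z; rewrite -hl; mring.
  rewrite -{2}hw; have -> : c * (w * sS l) = w * (c * sS l) by mring.
  apply: dvd_mull; apply: (dvd_sub (b := c * sS z * sS (sS y * d))); last by exists (c * sS z).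
  have -> : c * sS l + c * sS z * sS (sS y * d) = sS y * (c * sS (sS z * d)); last exact: dvd_mull.
  by rewrite -hl; mring.
Qed.

Lemma common_multiple b : exists d, d <> s0 /\ forall k, k < b -> dvd (sS k) d.
Proof.
move: b; apply: arith_ind; first by move=> T; definable_with (@nil M).
  by exists (nm 1); split=> [/(q_S0)//|k /(not_lt0)].
move=> b [d [d0 hd]]; exists (d * sS b); split.
  case: (case0 d) => [//|[d' ->]] h.
  by apply: (q_S0 (a := d' * sS b + b)); rewrite -[RHS]h; mring.
move=> k /(lt_S_le) /(le_eq_or_lt) [->|hk]; first by exists d.
have [q hq] := hd _ hk; exists (q * sS b); rewrite -hq; mring.
Qed.

(** The code c is the product of the moduli of the elements, built by induction;
    by coprimality no other modulus divides it. The hypothesis is the definability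
    of the induction formula. *)
Lemma comprehension (T P : M -> Prop) b : full_induction T ->
  (forall d, definable T (fun n => exists c, forall y, y <= b ->
     ((exists q, q * sS (sS y * d) = c) <-> (y < n /\ P y)))) ->
  exists c d, forall y, coded b c d y <-> (y <= b /\ P y).
Proof.
move=> HI D; have [d [d0 hd]] := common_multiple (sS b).
have H : forall n, exists c, forall y, y <= b ->
     ((exists q, q * sS (sS y * d) = c) <-> (y < n /\ P y)).
  apply: (full_ind HI (D d)).
    exists (nm 1) => y _; split=> [[q]|[/(not_lt0)//]].
    case: (case0 q) => [->|[q' ->]] h.
      by case: (q_S0 (a := s0)); rewrite -[LHS]h; mring.
    case: (case0 d) => [//|[d' E]]; move: h; rewrite E => h.
    case: (q_S0 (a := (sS y * d' + y) + q' * sS (sS y * sS d'))).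
    by apply: (q_SI); rewrite -[RHS]h; mring.
  move=> n [c hc]; case: (classic (P n)) => [Pn|nPn]; last first.
    exists c => y hy; rewrite hc //; split=> -[h1 h2]; split=> //.
      exact: lt_le_trans h1 (lt_le (lt_S n)).
    case: (le_eq_or_lt (lt_S_le h1)) => // E; by rewrite E in h2.
  case: (le_or_lt n b) => [nb|bn]; last first.
    exists c => y hy; rewrite hc //; split=> -[h1 h2]; split=> //.
      exact: lt_le_trans h1 (lt_le (lt_S n)).
    exact: (le_lt_trans hy bn).
  exists (c * sS (sS n * d)) => y hy; case: (classic (y = n)) => [->|ne].
    by split=> // _; [split=> //; apply: lt_S|exists c].
  transitivity (exists q, q * sS (sS y * d) = c).
    split=> [|[q <-]]; last by exists (q * sS (sS n * d)); mring.
    apply: gauss => // k hk; apply: hd; apply: (le_lt_trans (b := k)).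
      exact: le_refl.
    by apply: (le_lt_S); apply: (lt_le); case: hk => h; apply: lt_le_trans h _.
  rewrite hc //; split=> -[h1 h2]; split=> //.
    exact: lt_le_trans h1 (lt_le (lt_S n)).
  by case: (le_eq_or_lt (lt_S_le h1)).
have [c hc] := H (sS b); exists c, d => y; split=> -[h1 h2]; split=> //.
  by have [] := proj1 (hc _ h1) h2.
by apply/hc => //; split=> //; apply: (le_lt_S).
Qed.

Lemma arith_comprehension (P : M -> Prop) b :
  (forall (T : M -> Prop) d, definable T (fun n => exists c, forall y, y <= b ->
     ((exists q, q * sS (sS y * d) = c) <-> (y < n /\ P y)))) ->
  exists c d, forall y, coded b c d y <-> (y <= b /\ P y).
Proof. by have [T HI] := @q_ind M HM => D; apply: comprehension HI (D T). Qed.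

Lemma gen_inv step x : monotone step -> gen step x -> step (gen step) x.
Proof.
move=> mono [b [c [d [hx h]]]]; apply: mono (h _ hx) => z hz.
by exists b, c, d.
Qed.

Lemma gen_mono step step' x : (forall m y, step m y -> step' m y) -> gen step x -> gen step' x.
Proof. by move=> hs [b [c [d [hx h]]]]; exists b, c, d; split=> // y /h /hs. Qed.

(** The union of the sets that witness the two premises, together with the new
    element, is again coded. Two premises are enough for all clauses in use. *)
Lemma gen_intro2 step x1 x2 x : monotone step -> gen step x1 -> gen step x2 ->
  step (fun y => y = x1 \/ y = x2) x -> gen step x.
Proof.
move=> mono [b1 [c1 [d1 [h1 H1]]]] [b2 [c2 [d2 [h2 H2]]]] hx.
pose P y := coded b1 c1 d1 y \/ coded b2 c2 d2 y \/ y = x.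
have [c [d cd]] : exists c d, forall y, coded (b1 + b2 + x) c d y <-> (y <= b1 + b2 + x /\ P y).
  by apply: arith_comprehension => T d; rewrite /P;
     definable_with ([:: b1; c1; d1; b2; c2; d2; x; d] : seq M).
have {}cd y : coded (b1 + b2 + x) c d y <-> P y.
  rewrite cd; split=> [[]//|hy]; split=> //.
  case: hy => [[hy _]|[[hy _]|->]]; last exact: le_addl.
    by apply: le_trans hy _; apply: le_trans (le_addr _ _) (le_addr _ _).
  by apply: le_trans hy _; apply: le_trans (le_addr _ _); apply: le_addl.
exists (b1 + b2 + x), c, d; split; first by apply/cd; right; right.
move=> y /cd [hy|[hy|->]].
- by apply: mono (H1 _ hy) => z hz; apply/cd; left.
- by apply: mono (H2 _ hy) => z hz; apply/cd; right; left.
- by apply: mono hx => z [->|->]; apply/cd; [left|right; left].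
Qed.

Lemma gen_intro0 step x : monotone step -> step (fun=> False) x -> gen step x.
Proof.
move=> mono hx.
have [c [d cd]] : exists c d, forall y, coded x c d y <-> (y <= x /\ y = x).
  by apply: arith_comprehension => T d; definable_with ([:: x; d] : seq M).
exists x, c, d; split; first by apply/cd; split=> //; apply: le_refl.
by move=> y /cd [_ ->]; apply: mono hx.
Qed.

End Coding.

(** * The coded syntax inside a model *)

(** The codes of expressions, as elements of a model. *)
Notation cvar n := (pr (nm 1) n).
Notation czero := (pr (nm 2) s0).
Notation csucc s := (pr (nm 3) s).
Notation cadd s t := (pr (nm 4) (pr s t)).
Notation cmul s t := (pr (nm 5) (pr s t)).
Notation ceq s t := (pr (nm 6) (pr s t)).
Notation cneg p := (pr (nm 7) p).
Notation cand p q := (pr (nm 8) (pr p q)).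
Notation cor p q := (pr (nm 9) (pr p q)).
Notation cex v p := (pr (nm 10) (pr v p)).
Notation call v p := (pr (nm 11) (pr v p)).
Notation isvar x := (exists n, x = cvar n).

Section SyntaxDefinitions.
Variable M : structure.
Implicit Types (m : M -> Prop) (x y z v t : M).

(** The following predicates mirror the formulas of the arithmetized syntax clause
    by clause, so that [rp_solve] can match the two. *)
Definition cterm_st m y : Prop :=
  y = czero \/ (exists a, y = csucc a /\ m a)
  \/ (exists a b, (y = cadd a b \/ y = cmul a b) /\ m a /\ m b).
Definition iscterm x : Prop := gen cterm_st x.

Definition term_st m y : Prop := isvar y \/ cterm_st m y.
Definition isterm x : Prop := gen term_st x.

Definition form_st m y : Prop :=
  (exists a b, y = ceq a b /\ isterm a /\ isterm b)
  \/ (exists a, y = cneg a /\ m a)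
  \/ (exists a b, (y = cand a b \/ y = cor a b) /\ m a /\ m b)
  \/ (exists v a, (y = cex v a \/ y = call v a) /\ isvar v /\ m a).
Definition isform x : Prop := gen form_st x.

Definition occ_st v m y : Prop :=
  y = v
  \/ (exists a, y = csucc a /\ m a)
  \/ (exists a b, (y = cadd a b \/ y = cmul a b) /\ (m a \/ m b)).
Definition occ v x : Prop := gen (occ_st v) x.

Definition occf_st v m y : Prop :=
  (exists a b, y = ceq a b /\ (occ v a \/ occ v b))
  \/ (exists a, y = cneg a /\ m a)
  \/ (exists a b, (y = cand a b \/ y = cor a b) /\ (m a \/ m b))
  \/ (exists w a, (y = cex w a \/ y = call w a) /\ ~ w = v /\ m a).
Definition occf v x : Prop := gen (occf_st v) x.

Definition issent x : Prop := isform x /\ forall w, isvar w -> ~ occf w x.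

Definition isform1 v x : Prop :=
  isvar v /\ isform x /\ forall w, isvar w /\ occf w x -> w = v.

Definition denotes_st m z : Prop :=
  z = pr czero s0
  \/ (exists a i, z = pr (csucc a) (sS i) /\ m (pr a i))
  \/ (exists a i b j, (z = pr (cadd a b) (i + j) \/ z = pr (cmul a b) (i * j))
        /\ m (pr a i) /\ m (pr b j)).
Definition denotes x y : Prop := gen denotes_st (pr x y).

Definition tsub_st v t m z : Prop :=
  z = pr v t
  \/ (exists w, z = pr w w /\ isvar w /\ ~ w = v)
  \/ z = pr czero czero
  \/ (exists a a', z = pr (csucc a) (csucc a') /\ m (pr a a'))
  \/ (exists a a' b b', (z = pr (cadd a b) (cadd a' b') \/ z = pr (cmul a b) (cmul a' b'))
        /\ m (pr a a') /\ m (pr b b')).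
Definition tsub v t x x' : Prop := gen (tsub_st v t) (pr x x').

Definition fsub_st v t m z : Prop :=
  (exists a a' b b', z = pr (ceq a b) (ceq a' b') /\ tsub v t a a' /\ tsub v t b b')
  \/ (exists a a', z = pr (cneg a) (cneg a') /\ m (pr a a'))
  \/ (exists a a' b b', (z = pr (cand a b) (cand a' b') \/ z = pr (cor a b) (cor a' b'))
        /\ m (pr a a') /\ m (pr b b'))
  \/ (exists a, z = pr (cex v a) (cex v a) \/ z = pr (call v a) (call v a))
  \/ (exists w, isvar w /\ ~ w = v /\ exists a a',
        (z = pr (cex w a) (cex w a') \/ z = pr (call w a) (call w a')) /\ m (pr a a')).
Definition fsub v t x x' : Prop := gen (fsub_st v t) (pr x x').

Definition sameval s t : Prop := exists y, denotes s y /\ denotes t y.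

End SyntaxDefinitions.

Create HintDb rp_db.
Ltac rp_hook ::=
  lazymatch goal with
  | |- rp _ _ _ _ (coded _ _ _ _) => eapply rp_mem; den_solve
  | H : forall _ _ _ _, ext _ _ _ _ -> den _ _ _ _ -> rp _ _ _ _ (?m _) |- rp _ _ _ _ (?m _) =>
      eapply H; [ext_solve | den_solve]
  | |- _ => solve [auto with rp_db nocore]
  end.
Ltac rp_gen_solve := apply: rp_gen; [move=> ? ? ? ? ? ? ? ? ?|den_solve].

Section SyntaxFormulas.
Variables (M : structure) (T : M -> Prop).
Implicit Types (e : nat -> M) (k : nat) (t : term) (a : M).

Lemma rp_iscterm k e t a : den k e t a -> rp T k e (is_cterm k t) (iscterm a).
Proof. by move=> h; rp_gen_solve; rewrite /cterm_step /cterm_st; rp_solve. Qed.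

Lemma rp_isterm k e t a : den k e t a -> rp T k e (is_term k t) (isterm a).
Proof. by move=> h; rp_gen_solve; rewrite /cterm_step /term_st /cterm_st; rp_solve. Qed.
#[local] Hint Extern 0 (rp _ _ _ _ (isterm _)) => eapply rp_isterm; den_solve : rp_db.

Lemma rp_isform k e t a : den k e t a -> rp T k e (is_form k t) (isform a).
Proof. by move=> h; rp_gen_solve; rewrite /form_st; rp_solve. Qed.

Lemma rp_occ k e t a tv v : den k e tv v -> den k e t a ->
  rp T k e (occurs k tv t) (occ v a).
Proof. by move=> hv h; rp_gen_solve; rewrite /occ_st; rp_solve. Qed.
#[local] Hint Extern 0 (rp _ _ _ _ (occ _ _)) => eapply rp_occ; den_solve : rp_db.

Lemma rp_occf k e t a tv v : den k e tv v -> den k e t a ->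
  rp T k e (occurs_free k tv t) (occf v a).
Proof. by move=> hv h; rp_gen_solve; rewrite /occf_st; rp_solve. Qed.
#[local] Hint Extern 0 (rp _ _ _ _ (occf _ _)) => eapply rp_occf; den_solve : rp_db.
#[local] Hint Extern 0 (rp _ _ _ _ (isform _)) => eapply rp_isform; den_solve : rp_db.

Lemma rp_issent k e t a : den k e t a -> rp T k e (is_sentence k t) (issent a).
Proof. by move=> h; rewrite /issent; rp_solve. Qed.

Lemma rp_isform1 k e t a tv v : den k e tv v -> den k e t a ->
  rp T k e (is_form1 k tv t) (isform1 v a).
Proof. by move=> hv h; rewrite /isform1; rp_solve. Qed.

Lemma rp_denotes k e t a ty y : den k e t a -> den k e ty y -> rp T k e (value k t ty) (denotes a y).
Proof. by move=> hv h; rp_gen_solve; rewrite /denotes_st; rp_solve. Qed.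
#[local] Hint Extern 0 (rp _ _ _ _ (denotes _ _)) => eapply rp_denotes; den_solve : rp_db.

Lemma rp_sameval k e t a ty y : den k e t a -> den k e ty y ->
  rp T k e (same_value k t ty) (sameval a y).
Proof. by move=> hv h; rewrite /sameval; rp_solve. Qed.

Lemma rp_tsub k e tv v ts s tx x ty y : den k e tv v -> den k e ts s ->
  den k e tx x -> den k e ty y -> rp T k e (term_subst k tv ts tx ty) (tsub v s x y).
Proof. by move=> *; rp_gen_solve; rewrite /tsub_st; rp_solve. Qed.
#[local] Hint Extern 0 (rp _ _ _ _ (tsub _ _ _ _)) => eapply rp_tsub; den_solve : rp_db.

Lemma rp_fsub k e tv v ts s tx x ty y : den k e tv v -> den k e ts s ->
  den k e tx x -> den k e ty y -> rp T k e (form_subst k tv ts tx ty) (fsub v s x y).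
Proof. by move=> *; rp_gen_solve; rewrite /fsub_st; rp_solve. Qed.

End SyntaxFormulas.

#[export] Hint Extern 0 (rp _ _ _ _ (isterm _)) => eapply rp_isterm; den_solve : rp_db.
#[export] Hint Extern 0 (rp _ _ _ _ (iscterm _)) => eapply rp_iscterm; den_solve : rp_db.
#[export] Hint Extern 0 (rp _ _ _ _ (occ _ _)) => eapply rp_occ; den_solve : rp_db.
#[export] Hint Extern 0 (rp _ _ _ _ (occf _ _)) => eapply rp_occf; den_solve : rp_db.
#[export] Hint Extern 0 (rp _ _ _ _ (isform _)) => eapply rp_isform; den_solve : rp_db.
#[export] Hint Extern 0 (rp _ _ _ _ (issent _)) => eapply rp_issent; den_solve : rp_db.
#[export] Hint Extern 0 (rp _ _ _ _ (isform1 _ _)) => eapply rp_isform1; den_solve : rp_db.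
#[export] Hint Extern 0 (rp _ _ _ _ (denotes _ _)) => eapply rp_denotes; den_solve : rp_db.
#[export] Hint Extern 0 (rp _ _ _ _ (sameval _ _)) => eapply rp_sameval; den_solve : rp_db.
#[export] Hint Extern 0 (rp _ _ _ _ (tsub _ _ _ _)) => eapply rp_tsub; den_solve : rp_db.
#[export] Hint Extern 0 (rp _ _ _ _ (fsub _ _ _ _)) => eapply rp_fsub; den_solve : rp_db.

(** Codes behave like free constructors: pairing is injective and the tags are
    distinct numerals. *)
Ltac code_inv := repeat match goal with
  | H : False |- _ => destruct H
  | H : exists _, _ |- _ => destruct H
  | H : _ /\ _ |- _ => destruct H
  | H : _ \/ _ |- _ => destruct H
  | H : pr _ _ = pr _ _ |- _ => apply pr_inj in H; destruct H
  | H : nm ?i = nm ?i |- _ => clear H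
  | H : nm _ = nm _ |- _ => apply nm_inj in H; discriminate H
  | H : ?x = _ |- _ => is_var x; subst x
  | H : _ = ?x |- _ => is_var x; subst x
  end.

Section Syntax.
Context {M : structure} {HM : pa_model M}.
Implicit Types (m : M -> Prop) (a b p q s t v w x y z : M).

Ltac mono_solve := let h := fresh in let hy := fresh in
  move=> ? ? ? h hy; code_inv; repeat match goal with
  | h : forall z, ?m z -> _, H : ?m _ |- _ => apply h in H end; eauto 20.

Lemma mono_cterm : monotone (@cterm_st M).
Proof. rewrite /cterm_st; mono_solve. Qed.

Lemma mono_term : monotone (@term_st M).
Proof. rewrite /term_st /cterm_st; mono_solve. Qed.

Lemma mono_form : monotone (@form_st M).
Proof. rewrite /form_st; mono_solve. Qed.

Lemma mono_occ v : monotone (occ_st v).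
Proof. rewrite /occ_st; mono_solve. Qed.

Lemma mono_occf v : monotone (occf_st v).
Proof. rewrite /occf_st; mono_solve. Qed.

Lemma mono_denotes : monotone (@denotes_st M).
Proof. rewrite /denotes_st; mono_solve; do 2 right; do 4 eexists; eauto. Qed.

Lemma mono_tsub v t : monotone (tsub_st v t).
Proof. rewrite /tsub_st; mono_solve; do 4 right; do 4 eexists; eauto. Qed.

Lemma mono_fsub v t : monotone (fsub_st v t).
Proof.
rewrite /fsub_st => m m' z h.
case=> [?|[[a [a' [? /h ?]]]|[[a [a' [b [b' [? [/h ? /h ?]]]]]]|[?|[w [hw [ne [a [a' [? /h ?]]]]]]]]]].
- by left.
- by right; left; exists a, a'.
- by right; right; left; exists a, a', b, b'.
- by do 3 right; left.
- by do 4 right; exists w; do 2 split => //; exists a, a'.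
Qed.

Lemma ct_zero : iscterm (czero : M).
Proof. by apply: gen_intro0; [exact: mono_cterm|left]. Qed.

Lemma ct_succ t : iscterm t -> iscterm (csucc t).
Proof. by move=> h; apply: (gen_intro2 mono_cterm h h); right; left; eauto. Qed.

Lemma ct_add s t : iscterm s -> iscterm t -> iscterm (cadd s t).
Proof. by move=> h h'; apply: (gen_intro2 mono_cterm h h'); do 2 right; eauto 10. Qed.

Lemma ct_mul s t : iscterm s -> iscterm t -> iscterm (cmul s t).
Proof. by move=> h h'; apply: (gen_intro2 mono_cterm h h'); do 2 right; eauto 10. Qed.

Lemma ct_inv t : iscterm t -> cterm_st (@iscterm M) t.
Proof. exact: gen_inv mono_cterm. Qed.

Lemma t_cterm t : iscterm t -> isterm t.
Proof. by apply: gen_mono => m y; right. Qed.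

Lemma t_var n : isterm (cvar n : M).
Proof. by apply: gen_intro0; [exact: mono_term|left; exists n]. Qed.

Lemma t_succ t : isterm t -> isterm (csucc t).
Proof. by move=> h; apply: (gen_intro2 mono_term h h); right; right; left; eauto. Qed.

Lemma t_add s t : isterm s -> isterm t -> isterm (cadd s t).
Proof. by move=> h h'; apply: (gen_intro2 mono_term h h'); do 3 right; eauto 10. Qed.

Lemma t_mul s t : isterm s -> isterm t -> isterm (cmul s t).
Proof. by move=> h h'; apply: (gen_intro2 mono_term h h'); do 3 right; eauto 10. Qed.

Lemma f_eq s t : isterm s -> isterm t -> isform (ceq s t).
Proof. by move=> h h'; apply: gen_intro0; [exact: mono_form|left; exists s, t]. Qed.

Lemma f_neg p : isform p -> isform (cneg p).
Proof. by move=> h; apply: (gen_intro2 mono_form h h); right; left; eauto. Qed.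

Lemma f_and p q : isform p -> isform q -> isform (cand p q).
Proof. by move=> h h'; apply: (gen_intro2 mono_form h h'); do 2 right; left; eauto 10. Qed.

Lemma f_or p q : isform p -> isform q -> isform (cor p q).
Proof. by move=> h h'; apply: (gen_intro2 mono_form h h'); do 2 right; left; eauto 10. Qed.

Lemma f_ex n p : isform p -> isform (cex (cvar n) p).
Proof.
by move=> h; apply: (gen_intro2 mono_form h h); do 3 right; exists (cvar n), p; eauto 10.
Qed.

Lemma f_all n p : isform p -> isform (call (cvar n) p).
Proof.
by move=> h; apply: (gen_intro2 mono_form h h); do 3 right; exists (cvar n), p; eauto 10.
Qed.

(** * Occurrences *)

Lemma occ_inv v t : occ v t -> occ_st v (occ v) t.
Proof. exact: gen_inv (@mono_occ v). Qed.

Lemma occ_succ n t : occ (cvar n) (csucc t) -> occ (cvar n) t.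
Proof. by move=> /occ_inv h; rewrite /occ_st in h; code_inv. Qed.

Lemma occ_add n s t : occ (cvar n) (cadd s t) -> occ (cvar n) s \/ occ (cvar n) t.
Proof. by move=> /occ_inv h; rewrite /occ_st in h; code_inv; auto. Qed.

Lemma occ_mul n s t : occ (cvar n) (cmul s t) -> occ (cvar n) s \/ occ (cvar n) t.
Proof. by move=> /occ_inv h; rewrite /occ_st in h; code_inv; auto. Qed.

Lemma occ_zero n : ~ occ (cvar n) (czero : M).
Proof. by move=> /occ_inv h; rewrite /occ_st in h; code_inv. Qed.

Lemma occ_var n n' : occ (cvar n) (cvar n' : M) -> n = n'.
Proof. by move=> /occ_inv h; rewrite /occ_st in h; code_inv. Qed.

(** Induction in the model on the code of t, as t may be nonstandard. *)
Lemma occ_cterm n t : iscterm t -> ~ occ (cvar n) t.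
Proof.
move: t; apply: arith_strong_ind; first by move=> T; definable_with ([:: n] : seq M).
move=> t IH /ct_inv; rewrite /cterm_st => h h'; code_inv.
- exact: (occ_zero h').
- by move/occ_succ: h'; apply: IH => //; apply: lt_pr2.
- by case/occ_add: h'; apply: IH => //; [apply: pr_sub1|apply: pr_sub2].
- by case/occ_mul: h'; apply: IH => //; [apply: pr_sub1|apply: pr_sub2].
Qed.

Lemma occf_inv v p : occf v p -> occf_st v (occf v) p.
Proof. exact: gen_inv (@mono_occf v). Qed.

Lemma occf_eq v s t : occf v (ceq s t) -> occ v s \/ occ v t.
Proof. by move=> /occf_inv h; rewrite /occf_st in h; code_inv; auto. Qed.

Lemma occf_neg v p : occf v (cneg p) -> occf v p.
Proof. by move=> /occf_inv h; rewrite /occf_st in h; code_inv. Qed.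

Lemma occf_and v p q : occf v (cand p q) -> occf v p \/ occf v q.
Proof. by move=> /occf_inv h; rewrite /occf_st in h; code_inv; auto. Qed.

Lemma occf_or v p q : occf v (cor p q) -> occf v p \/ occf v q.
Proof. by move=> /occf_inv h; rewrite /occf_st in h; code_inv; auto. Qed.

Lemma occf_ex v w p : occf v (cex w p) -> w <> v /\ occf v p.
Proof. by move=> /occf_inv h; rewrite /occf_st in h; code_inv; auto. Qed.

Lemma occf_all v w p : occf v (call w p) -> w <> v /\ occf v p.
Proof. by move=> /occf_inv h; rewrite /occf_st in h; code_inv; auto. Qed.

(** * Values *)

Lemma denotes_inv x y : denotes x y -> denotes_st (gen (@denotes_st M)) (pr x y).
Proof. exact: gen_inv mono_denotes. Qed.

Lemma denotes_zero y : denotes (czero : M) y <-> y = s0.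
Proof.
split=> [/denotes_inv h|->]; first by rewrite /denotes_st in h; code_inv.
by apply: gen_intro0; [exact: mono_denotes|left].
Qed.

Lemma denotes_succ t y : denotes (csucc t) y <-> exists a, y = sS a /\ denotes t a.
Proof.
split=> [/denotes_inv h|[a [-> h]]]; first by rewrite /denotes_st in h; code_inv; eauto.
by apply: (gen_intro2 mono_denotes h h); right; left; eauto.
Qed.

Lemma denotes_add s t y : denotes (cadd s t) y <-> exists a b, y = a + b /\ denotes s a /\ denotes t b.
Proof.
split=> [/denotes_inv h|[a [b [-> [h h']]]]]; first by rewrite /denotes_st in h; code_inv; eauto 10.
by apply: (gen_intro2 mono_denotes h h'); do 2 right; exists s, a, t, b; auto.
Qed.

Lemma denotes_mul s t y : denotes (cmul s t) y <-> exists a b, y = a * b /\ denotes s a /\ denotes t b.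
Proof.
split=> [/denotes_inv h|[a [b [-> [h h']]]]]; first by rewrite /denotes_st in h; code_inv; eauto 10.
by apply: (gen_intro2 mono_denotes h h'); do 2 right; exists s, a, t, b; auto.
Qed.

Lemma denotes_fun t : forall y y', denotes t y -> denotes t y' -> y = y'.
Proof.
move: t; apply: arith_strong_ind; first by move=> T; definable_with (@nil M).
move=> t IH y y' /denotes_inv h; rewrite /denotes_st in h; code_inv.
- by move/denotes_zero->.
- move/denotes_succ=> [a [-> ha]]; congr sS; apply: IH ha => //; exact: lt_pr2.
- move/denotes_add=> [a [b [-> [ha hb]]]]; congr (_ + _).
    by apply: IH ha => //; apply: pr_sub1.
  by apply: IH hb => //; apply: pr_sub2.
- move/denotes_mul=> [a [b [-> [ha hb]]]]; congr (_ * _).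
    by apply: IH ha => //; apply: pr_sub1.
  by apply: IH hb => //; apply: pr_sub2.
Qed.

Lemma denotes_total t : iscterm t -> exists y, denotes t y.
Proof.
move: t; apply: arith_strong_ind; first by move=> T; definable_with (@nil M).
move=> t IH /ct_inv; rewrite /cterm_st => h; code_inv.
- by exists s0; apply/denotes_zero.
- have [|y hy] := IH _ _ H0; first exact: lt_pr2.
  by exists (sS y); apply/denotes_succ; exists y.
- have [|y hy] := IH _ _ H0; first exact: pr_sub1.
  have [|y' hy'] := IH _ _ H1; first exact: pr_sub2.
  by exists (y + y'); apply/denotes_add; exists y, y'.
- have [|y hy] := IH _ _ H0; first exact: pr_sub1.
  have [|y' hy'] := IH _ _ H1; first exact: pr_sub2.
  by exists (y * y'); apply/denotes_mul; exists y, y'.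
Qed.

(** Induction on a in the model. This links the quantifiers over closed terms in the
    axioms of truth to quantifiers over elements. *)
Lemma numeral a : exists t, iscterm t /\ denotes t a.
Proof.
move: a; apply: arith_ind; first by move=> T; definable_with (@nil M).
  by exists czero; split; [apply: ct_zero|apply/denotes_zero].
move=> a [t [h h']]; exists (csucc t); split; first exact: ct_succ.
by apply/denotes_succ; exists a.
Qed.

Lemma sameval_iff s t a : denotes s a -> (sameval s t <-> denotes t a).
Proof.
move=> h; split=> [[b [h1 h2]]|h2]; last by exists a.
by rewrite (denotes_fun h h1).
Qed.

(** * Substitution *)

Lemma tsub_inv v t x y : tsub v t x y -> tsub_st v t (gen (tsub_st v t)) (pr x y).
Proof. exact: gen_inv (@mono_tsub v t). Qed.

Section Tsub.
Variables (n t : M).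
Notation v := (cvar n).

Lemma tsub_same z : tsub v t v z <-> z = t.
Proof.
split=> [/tsub_inv h|->]; last by apply: gen_intro0; [exact: mono_tsub|left].
by rewrite /tsub_st in h; code_inv.
Qed.

Lemma tsub_other n' z : n' <> n -> (tsub v t (cvar n') z <-> z = cvar n').
Proof.
move=> ne; split=> [/tsub_inv h|->].
  by rewrite /tsub_st in h; code_inv.
apply: gen_intro0; [exact: mono_tsub|right; left; exists (cvar n'); split=> //].
by split; [exists n'|move=> /pr_inj[]].
Qed.

Lemma tsub_zero z : tsub v t czero z <-> z = czero.
Proof.
split=> [/tsub_inv h|->]; first by rewrite /tsub_st in h; code_inv.
by apply: gen_intro0; [exact: mono_tsub|right; right; left].
Qed.

Lemma tsub_succ a z : tsub v t (csucc a) z <-> exists a', z = csucc a' /\ tsub v t a a'.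
Proof.
split=> [/tsub_inv h|[a' [-> h]]]; first by rewrite /tsub_st in h; code_inv; eauto.
by apply: (gen_intro2 (@mono_tsub v t) h h); do 3 right; left; eauto.
Qed.

Lemma tsub_add a b z : tsub v t (cadd a b) z <->
  exists a' b', z = cadd a' b' /\ tsub v t a a' /\ tsub v t b b'.
Proof.
split=> [/tsub_inv h|[a' [b' [-> [h h']]]]].
  by rewrite /tsub_st in h; code_inv; eauto 10.
by apply: (gen_intro2 (@mono_tsub v t) h h'); do 4 right; exists a, a', b, b'; auto.
Qed.

Lemma tsub_mul a b z : tsub v t (cmul a b) z <->
  exists a' b', z = cmul a' b' /\ tsub v t a a' /\ tsub v t b b'.
Proof.
split=> [/tsub_inv h|[a' [b' [-> [h h']]]]].
  by rewrite /tsub_st in h; code_inv; eauto 10.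
by apply: (gen_intro2 (@mono_tsub v t) h h'); do 4 right; exists a, a', b, b'; auto.
Qed.

(** Again s may be nonstandard, so the induction is on its code in the model. *)
Lemma tsub_cterm s : iscterm s -> forall z, tsub v t s z <-> z = s.
Proof.
move: s; apply: arith_strong_ind; first by move=> T; definable_with ([:: n; t] : seq M).
move=> s IH /ct_inv; rewrite /cterm_st => h z; code_inv.
- exact: tsub_zero.
- rewrite tsub_succ; split=> [[a' [-> /IH ->]]|->] //; first exact: lt_pr2.
  by exists x; split=> //; apply/IH => //; apply: lt_pr2.
- have E1 := IH _ (pr_sub1 _ _ _) H0; have E2 := IH _ (pr_sub2 _ _ _) H1.
  rewrite tsub_add; split=> [[a' [b' [-> [/E1-> /E2->]]]]//|->].
  by exists x, x0; rewrite E1 E2.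
- have E1 := IH _ (pr_sub1 _ _ _) H0; have E2 := IH _ (pr_sub2 _ _ _) H1.
  rewrite tsub_mul; split=> [[a' [b' [-> [/E1-> /E2->]]]]//|->].
  by exists x, x0; rewrite E1 E2.
Qed.

Lemma fsub_inv x y : fsub v t x y -> fsub_st v t (gen (fsub_st v t)) (pr x y).
Proof. exact: gen_inv (@mono_fsub v t). Qed.

Lemma fsub_eq a b z : fsub v t (ceq a b) z <->
  exists a' b', z = ceq a' b' /\ tsub v t a a' /\ tsub v t b b'.
Proof.
split=> [/fsub_inv h|[a' [b' [-> [h h']]]]].
  by rewrite /fsub_st in h; code_inv; eauto 10.
by apply: gen_intro0; [exact: mono_fsub|left; exists a, a', b, b'].
Qed.

Lemma fsub_neg a z : fsub v t (cneg a) z <-> exists a', z = cneg a' /\ fsub v t a a'.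
Proof.
split=> [/fsub_inv h|[a' [-> h]]]; first by rewrite /fsub_st in h; code_inv; eauto.
by apply: (gen_intro2 (@mono_fsub v t) h h); right; left; eauto.
Qed.

Lemma fsub_and a b z : fsub v t (cand a b) z <->
  exists a' b', z = cand a' b' /\ fsub v t a a' /\ fsub v t b b'.
Proof.
split=> [/fsub_inv h|[a' [b' [-> [h h']]]]].
  by rewrite /fsub_st in h; code_inv; eauto 10.
by apply: (gen_intro2 (@mono_fsub v t) h h'); do 2 right; left; exists a, a', b, b'; auto.
Qed.

Lemma fsub_or a b z : fsub v t (cor a b) z <->
  exists a' b', z = cor a' b' /\ fsub v t a a' /\ fsub v t b b'.
Proof.
split=> [/fsub_inv h|[a' [b' [-> [h h']]]]].
  by rewrite /fsub_st in h; code_inv; eauto 10.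
by apply: (gen_intro2 (@mono_fsub v t) h h'); do 2 right; left; exists a, a', b, b'; auto.
Qed.

Lemma fsub_ex_same a z : fsub v t (cex v a) z <-> z = cex v a.
Proof.
split=> [/fsub_inv h|->].
  by rewrite /fsub_st in h; code_inv.
by apply: gen_intro0; [exact: mono_fsub|do 3 right; left; exists a; left].
Qed.

Lemma fsub_all_same a z : fsub v t (call v a) z <-> z = call v a.
Proof.
split=> [/fsub_inv h|->].
  by rewrite /fsub_st in h; code_inv.
by apply: gen_intro0; [exact: mono_fsub|do 3 right; left; exists a; right].
Qed.

Lemma fsub_ex n' a z : n' <> n -> (fsub v t (cex (cvar n') a) z <->
  exists a', z = cex (cvar n') a' /\ fsub v t a a').
Proof.
move=> ne; split=> [/fsub_inv h|[a' [-> h]]].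
  by rewrite /fsub_st in h; code_inv; eauto.
apply: (gen_intro2 (@mono_fsub v t) h h); do 4 right; exists (cvar n'); split; first by exists n'.
by split; [move=> /pr_inj[]|exists a, a'; auto].
Qed.

Lemma fsub_all n' a z : n' <> n -> (fsub v t (call (cvar n') a) z <->
  exists a', z = call (cvar n') a' /\ fsub v t a a').
Proof.
move=> ne; split=> [/fsub_inv h|[a' [-> h]]].
  by rewrite /fsub_st in h; code_inv; eauto.
apply: (gen_intro2 (@mono_fsub v t) h h); do 4 right; exists (cvar n'); split; first by exists n'.
by split; [move=> /pr_inj[]|exists a, a'; auto].
Qed.

End Tsub.
End Syntax.

(** * Standard contexts with a nonstandard formula *)

Section Templates.
Context {M : structure} {HM : pa_model M}.
Implicit Types (a b w z sigma : M) (r : nat -> M).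

Notation v_ x := (cvar (nm x)).

Fixpoint tcode (r : nat -> M) (t : term) : M :=
  match t with
  | Var x => r x
  | Zero => czero
  | Succ s => csucc (tcode r s)
  | Add s u => cadd (tcode r s) (tcode r u)
  | Mul s u => cmul (tcode r s) (tcode r u)
  end.

(** The clauses of substitution say that it is the graph of a function whenever it is
    so for the constituents. *)
Lemma graph1 (C : M -> M) (P : M -> Prop) A z : (forall z, P z <-> z = A) ->
  ((exists a', z = C a' /\ P a') <-> z = C A).
Proof. by move=> h; split=> [[a' [-> /h->]]//|->]; exists A; rewrite h. Qed.

Lemma graph2 (C : M -> M -> M) (P Q : M -> Prop) A B z :
  (forall z, P z <-> z = A) -> (forall z, Q z <-> z = B) ->
  ((exists a' b', z = C a' b' /\ P a' /\ Q b') <-> z = C A B).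
Proof.
move=> h h'; split=> [[a' [b' [-> [/h-> /h'->]]]]//|->].
by exists A, B; rewrite h h'.
Qed.

Lemma in_catl (l l' : seq nat) (P : nat -> Prop) :
  (forall y, y \in l ++ l' -> P y) -> forall y, y \in l -> P y.
Proof. by move=> h y hy; apply: h; rewrite mem_cat hy. Qed.

Lemma in_catr (l l' : seq nat) (P : nat -> Prop) :
  (forall y, y \in l ++ l' -> P y) -> forall y, y \in l' -> P y.
Proof. by move=> h y hy; apply: h; rewrite mem_cat hy orbT. Qed.

(** The formula sigma(s) for a formula sigma with free variable of index 0. Binding
    that variable by a quantifier, instead of substituting for it, spares all
    reasoning about substitution of terms within sigma. *)
Definition hole (sigma s : M) : M := cex (v_ 0) (cand (ceq (v_ 0) s) sigma).

(** The code of the standard formula f, in which T stands for sigma and a free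
    variable x is replaced by the term with code r x. *)
Fixpoint fcode (sigma : M) (r : nat -> M) (f : form) : M :=
  match f with
  | Eq s t => ceq (tcode r s) (tcode r t)
  | Tr t => hole sigma (tcode r t)
  | Neg g => cneg (fcode sigma r g)
  | And g h => cand (fcode sigma r g) (fcode sigma r h)
  | Or g h => cor (fcode sigma r g) (fcode sigma r h)
  | Ex x g => cex (v_ x) (fcode sigma (upd r x (v_ x)) g)
  | All x g => call (v_ x) (fcode sigma (upd r x (v_ x)) g)
  end.

(** The variable 0 is reserved for [hole], so it must not occur in the terms to
    which T is applied. *)
Fixpoint template (f : form) : bool :=
  match f with
  | Eq _ _ => true
  | Tr t => 0 \notin tvars t
  | Neg g | Ex _ g | All _ g => template g
  | And g h | Or g h => template g && template h
  end.

(** What has to be known about sigma to handle the codes of templates. It is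
    definable, so that it can be shown for nonstandard formulas by induction. *)
Definition good sigma : Prop :=
  isform sigma /\ (forall w, isvar w -> occf w sigma -> w = v_ 0) /\
  (forall n t z, n <> nm 0 -> (fsub (cvar n) t sigma z <-> z = sigma)).

Definition leaf r x : Prop := iscterm (r x) \/ r x = v_ x.

Lemma tcode_ext r r' t : {in tvars t, r =1 r'} -> tcode r t = tcode r' t.
Proof.
elim: t => //= [x|s IH|s IHs u IHu|s IHs u IHu] h.
- by apply: h; rewrite inE.
- by rewrite IH.
- by rewrite IHs ?IHu // => x hx; apply: h; rewrite mem_cat hx ?orbT.
- by rewrite IHs ?IHu // => x hx; apply: h; rewrite mem_cat hx ?orbT.
Qed.

Lemma fcode_ext sigma r r' f : {in fv f, r =1 r'} -> fcode sigma r f = fcode sigma r' f.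
Proof.
elim: f r r' => /= [s t|t|f IH|f IHf g IHg|f IHf g IHg|x f IH|x f IH] r r' h.
- by congr (ceq _ _); apply: tcode_ext => x hx; apply: h; rewrite mem_cat hx ?orbT.
- by congr (hole _ _); apply: tcode_ext.
- by rewrite (IH r r').
- by rewrite (IHf r r') ?(IHg r r') // => x hx; apply: h; rewrite mem_cat hx ?orbT.
- by rewrite (IHf r r') ?(IHg r r') // => x hx; apply: h; rewrite mem_cat hx ?orbT.
- rewrite (IH (upd r x (v_ x)) (upd r' x (v_ x))) // => y hy; rewrite /upd.
  by case: ifP => // /negbT ne; apply: h; rewrite mem_filter ne.
- rewrite (IH (upd r x (v_ x)) (upd r' x (v_ x))) // => y hy; rewrite /upd.
  by case: ifP => // /negbT ne; apply: h; rewrite mem_filter ne.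
Qed.

Lemma tcode_term r t : (forall x, x \in tvars t -> leaf r x) -> isterm (tcode r t).
Proof.
elim: t => /= [x||s IH|s IHs u IHu|s IHs u IHu] h.
- by have [/t_cterm|->] := h x (mem_head _ _); last exact: t_var.
- exact: t_cterm ct_zero.
- exact: t_succ (IH h).
- by apply: t_add; [apply: IHs|apply: IHu] => x hx; apply: h; rewrite mem_cat hx ?orbT.
- by apply: t_mul; [apply: IHs|apply: IHu] => x hx; apply: h; rewrite mem_cat hx ?orbT.
Qed.

Lemma tcode_occ r t n : (forall x, x \in tvars t -> leaf r x) ->
  occ (cvar n) (tcode r t) -> exists x, x \in tvars t /\ n = nm x /\ r x = v_ x.
Proof.
elim: t => /= [x||s IH|s IHs u IHu|s IHs u IHu] h.
- have [/occ_cterm H /H //|E] := h x (mem_head _ _).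
  by rewrite E => /occ_var->; exists x; rewrite inE.
- by move=> /occ_zero.
- by move=> /occ_succ; apply: IH.
- by move=> /occ_add[/IHs|/IHu] [x hx|x [hx hn]]; first [apply: h|exists x];
    rewrite mem_cat hx ?orbT.
- by move=> /occ_mul[/IHs|/IHu] [x hx|x [hx hn]]; first [apply: h|exists x];
    rewrite mem_cat hx ?orbT.
Qed.

Lemma tcode_tsub r t x s : (forall y, y \in tvars t -> leaf r y) ->
  (forall y, y \in tvars t -> y = x -> r x = v_ x) ->
  forall z, tsub (v_ x) s (tcode r t) z <-> z = tcode (upd r x s) t.
Proof.
elim: t => /= [y||t IH|t IHt u IHu|t IHt u IHu] h hx z.
- move: (h y (mem_head _ _)); rewrite /leaf /upd; case: eqP => [E _|ne].
    by rewrite E (hx _ (mem_head _ _) E); exact: tsub_same.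
  case=> [hy|->]; first exact: tsub_cterm.
  by apply: tsub_other => /nm_inj.
- exact: tsub_zero.
- by rewrite tsub_succ; apply: graph1; apply: IH.
- rewrite tsub_add; apply: graph2.
    by apply: IHt; [apply: in_catl h|apply: in_catl hx].
  by apply: IHu; [apply: in_catr h|apply: in_catr hx].
- rewrite tsub_mul; apply: graph2.
    by apply: IHt; [apply: in_catl h|apply: in_catl hx].
  by apply: IHu; [apply: in_catr h|apply: in_catr hx].
Qed.

Section Good.
Variable sigma : M.
Hypothesis hsigma : good sigma.

Lemma leaf_upd r x l : (forall y, y \in [seq y <- l | y != x] -> leaf r y) ->
  forall y, y \in l -> leaf (upd r x (v_ x)) y.
Proof.
move=> h y hy; rewrite /leaf /upd; case: eqP => [->|/eqP ne]; first by right.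
by apply: h; rewrite mem_filter ne.
Qed.

Lemma fcode_form r f : (forall x, x \in fv f -> leaf r x) -> isform (fcode sigma r f).
Proof.
elim: f r => /= [s t|t|f IH|f IHf g IHg|f IHf g IHg|x f IH|x f IH] r h.
- by apply: f_eq; apply: tcode_term; [apply: in_catl h|apply: in_catr h].
- apply/f_ex/f_and; last by case: hsigma.
  by apply: f_eq; [apply: t_var|apply: tcode_term].
- exact/f_neg/IH.
- by apply: f_and; [apply/IHf/(in_catl h)|apply/IHg/(in_catr h)].
- by apply: f_or; [apply/IHf/(in_catl h)|apply/IHg/(in_catr h)].
- by apply: f_ex; apply: IH; apply: leaf_upd.
- by apply: f_all; apply: IH; apply: leaf_upd.
Qed.

Lemma fcode_occf r f n : (forall x, x \in fv f -> leaf r x) ->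
  occf (cvar n) (fcode sigma r f) -> exists x, x \in fv f /\ n = nm x /\ r x = v_ x.
Proof.
have Q x g r' : (exists y, y \in fv g /\ n = nm y /\ upd r' x (v_ x) y = v_ y) ->
    v_ x <> cvar n ->
    exists y, y \in [seq y <- fv g | y != x] /\ n = nm y /\ r' y = v_ y.
  move=> [y [hy [->]]]; rewrite /upd; case: eqP => [->//|/eqP ne hr _].
  by exists y; rewrite mem_filter ne.
have C g l r' : (exists x, x \in l /\ n = nm x /\ r' x = v_ x) -> {subset l <= g} ->
    exists x, x \in g /\ n = nm x /\ r' x = v_ x.
  by move=> [x [hx H]] hs; exists x; split=> //; apply: hs.
have sl (l l' : seq nat) : {subset l <= l ++ l'} by move=> y hy; rewrite mem_cat hy.
have sr (l l' : seq nat) : {subset l' <= l ++ l'} by move=> y hy; rewrite mem_cat hy orbT.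
elim: f r => /= [s t|t|f IH|f IHf g IHg|f IHf g IHg|x f IH|x f IH] r h.
- move=> /occf_eq[/tcode_occ H|/tcode_occ H].
    by apply: C (H (in_catl h)) (sl _ _).
  by apply: C (H (in_catr h)) (sr _ _).
- move=> /occf_ex[ne /occf_and[/occf_eq[/occ_var E|/tcode_occ H]|H]].
  + by case: ne; rewrite E.
  + exact: H.
  + by case: ne; case: hsigma => _ [E _]; rewrite (E (cvar n)) //; exists n.
- by move=> /occf_neg /IH; apply.
- move=> /occf_and[/IHf H|/IHg H].
    by apply: C (H (in_catl h)) (sl _ _).
  by apply: C (H (in_catr h)) (sr _ _).
- move=> /occf_or[/IHf H|/IHg H].
    by apply: C (H (in_catl h)) (sl _ _).
  by apply: C (H (in_catr h)) (sr _ _).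
- by move=> /occf_ex[ne /IH H]; apply: Q ne; apply/H/leaf_upd.
- by move=> /occf_all[ne /IH H]; apply: Q ne; apply/H/leaf_upd.
Qed.

(** Substitution into the code of a template changes the terms that replace its
    variables and leaves sigma alone. *)
Lemma fcode_fsub r f x s : template f -> (forall y, y \in fv f -> leaf r y) ->
  (forall y, y \in fv f -> y = x -> r x = v_ x) ->
  forall z, fsub (v_ x) s (fcode sigma r f) z <-> z = fcode sigma (upd r x s) f.
Proof.
have Q y g r' : y <> x -> (forall y', y' \in [seq y' <- fv g | y' != y] -> y' = x -> r' x = v_ x) ->
    (forall y', y' \in fv g -> y' = x -> upd r' y (v_ y) x = v_ x).
  move=> ne h y' hy' E; rewrite upd_other; last by apply/eqP => E'; apply: ne.
  by apply: h (E); rewrite mem_filter hy' E andbT; apply/eqP => E'; apply: ne.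
have E1 r' g : fcode sigma (upd (upd r' x s) x (v_ x)) g = fcode sigma (upd r' x (v_ x)) g.
  by apply: fcode_ext => y _; rewrite /upd; case: eqP.
have E2 y r' g : y <> x -> fcode sigma (upd (upd r' y (v_ y)) x s) g =
    fcode sigma (upd (upd r' x s) y (v_ y)) g.
  move=> ne; apply: fcode_ext => u _; rewrite /upd.
  by case: eqP => [->|//]; case: eqP => // E; case: ne.
elim: f r => /= [t u|t|f IH|f IHf g IHg|f IHf g IHg|y f IH|y f IH] r.
- move=> _ h hx z; rewrite fsub_eq; apply: graph2.
    by apply: tcode_tsub; [apply: in_catl h|apply: in_catl hx].
  by apply: tcode_tsub; [apply: in_catr h|apply: in_catr hx].
- move=> ht h hx z; rewrite /hole; case: (eqVneq x 0) => [E|/eqP ne].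
    rewrite {1}E fsub_ex_same (_ : tcode (upd r x s) t = tcode r t) //.
    by apply: tcode_ext => y hy; rewrite upd_other //; apply: contraNneq ht => Ey; rewrite -E -Ey.
  rewrite fsub_ex => [|/nm_inj E]; last by apply: ne; rewrite E.
  apply: graph1 => {}z; rewrite fsub_and; apply: graph2 => {}z; last first.
    by case: hsigma => _ [_]; apply=> /nm_inj.
  rewrite fsub_eq; apply: graph2 => {}z; last exact: tcode_tsub.
  by apply: tsub_other => /nm_inj E; apply: ne.
- by move=> ht h hx z; rewrite fsub_neg; apply: graph1; apply: IH.
- move=> /andP[h1 h2] h hx z; rewrite fsub_and; apply: graph2.
    by apply: IHf; [|apply: in_catl h|apply: in_catl hx].
  by apply: IHg; [|apply: in_catr h|apply: in_catr hx].
- move=> /andP[h1 h2] h hx z; rewrite fsub_or; apply: graph2.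
    by apply: IHf; [|apply: in_catl h|apply: in_catl hx].
  by apply: IHg; [|apply: in_catr h|apply: in_catr hx].
- move=> ht h hx z; case: (classic (y = x)) => [->|ne].
    by rewrite fsub_ex_same E1.
  rewrite fsub_ex => [|/nm_inj//]; rewrite -E2 //; apply: graph1.
  by apply: IH; [|apply: leaf_upd|apply: Q].
- move=> ht h hx z; case: (classic (y = x)) => [->|ne].
    by rewrite fsub_all_same E1.
  rewrite fsub_all => [|/nm_inj//]; rewrite -E2 //; apply: graph1.
  by apply: IH; [|apply: leaf_upd|apply: Q].
Qed.

Lemma tcode_tsub_fresh r t n s : (forall x, x \in tvars t -> leaf r x /\ r x <> cvar n) ->
  forall z, tsub (cvar n) s (tcode r t) z <-> z = tcode r t.
Proof.
elim: t => /= [x||t IH|t IHt u IHu|t IHt u IHu] h z.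
- case: (h x (mem_head _ _)) => -[hx _|->]; first exact: tsub_cterm.
  by move=> ne; apply: tsub_other => E; apply: ne; rewrite E.
- exact: tsub_zero.
- by rewrite tsub_succ; apply: graph1; apply: IH.
- by rewrite tsub_add; apply: graph2; [apply/IHt/(in_catl h)|apply/IHu/(in_catr h)].
- by rewrite tsub_mul; apply: graph2; [apply/IHt/(in_catl h)|apply/IHu/(in_catr h)].
Qed.

(** Here the substituted variable is any variable of the model other than that of
    index 0, even a nonstandard one, that is not left in place by r; it may be
    bound in the template. *)
Lemma fcode_fsub_fresh r f n s : template f -> n <> nm 0 ->
  (forall x, x \in fv f -> leaf r x /\ r x <> cvar n) ->
  forall z, fsub (cvar n) s (fcode sigma r f) z <-> z = fcode sigma r f.
Proof.
have Q x g r' : nm x <> n -> (forall y, y \in [seq y <- fv g | y != x] -> leaf r' y /\ r' y <> cvar n) ->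
    forall y, y \in fv g -> leaf (upd r' x (v_ x)) y /\ upd r' x (v_ x) y <> cvar n.
  move=> ne h y hy; rewrite /leaf /upd; case: eqP => [->|/eqP ne'].
    by split; [right|move=> /pr_inj[]].
  by apply: h; rewrite mem_filter ne'.
move=> + ne0; elim: f r => /= [t u|t|f IH|f IHf g IHg|f IHf g IHg|y f IH|y f IH] r.
- move=> _ h z; rewrite fsub_eq; apply: graph2.
    exact/tcode_tsub_fresh/(in_catl h).
  exact/tcode_tsub_fresh/(in_catr h).
- move=> _ h z; rewrite /hole fsub_ex; last by move=> E; apply: ne0.
  apply: graph1 => {}z; rewrite fsub_and; apply: graph2 => {}z; last first.
    by case: hsigma => _ [_]; apply.
  rewrite fsub_eq; apply: graph2 => {}z; last exact: tcode_tsub_fresh.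
  by apply: tsub_other => E; apply: ne0.
- by move=> ht h z; rewrite fsub_neg; apply: graph1; apply: IH.
- move=> /andP[h1 h2] h z; rewrite fsub_and; apply: graph2.
    by apply: IHf => //; apply: in_catl h.
  by apply: IHg => //; apply: in_catr h.
- move=> /andP[h1 h2] h z; rewrite fsub_or; apply: graph2.
    by apply: IHf => //; apply: in_catl h.
  by apply: IHg => //; apply: in_catr h.
- move=> ht h z; case: (classic (nm y = n)) => [<-|ne]; first by rewrite fsub_ex_same.
  by rewrite fsub_ex //; apply: graph1; apply: IH => //; apply: Q.
- move=> ht h z; case: (classic (nm y = n)) => [<-|ne]; first by rewrite fsub_all_same.
  by rewrite fsub_all //; apply: graph1; apply: IH => //; apply: Q.
Qed.

(** This closes the recursion that defines the formulas of the hierarchy. *)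
Lemma good_fcode r f : template f ->
  (forall x, x \in fv f -> iscterm (r x) \/ x = 0 /\ r x = v_ 0) -> good (fcode sigma r f).
Proof.
move=> ht h; have h' x : x \in fv f -> leaf r x.
  by move=> /h[|[-> E]]; [left|right].
split; first exact: fcode_form.
split=> [w [n ->]|n s z ne].
  move=> /fcode_occf-/(_ h') [x [/h hx [-> E]]]; case: hx => [|[-> //]].
  by rewrite E => /ct_inv hx; rewrite /cterm_st in hx; code_inv.
apply: fcode_fsub_fresh => // x hx; split; first exact: h'.
case: (h x hx) => [hc E|[_ ->] /pr_inj[_ E]]; last by apply: ne.
by move: hc; rewrite E => /ct_inv hc; rewrite /cterm_st in hc; code_inv.
Qed.

End Good.
End Templates.

Definition valid (M : structure) (T : M -> Prop) (A : theory) : Prop :=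
  forall q, A q -> forall e, sat T e q.

Lemma rp_sat (M : structure) (T : M -> Prop) e k f P : rp T k e f P -> (sat T e f <-> P).
Proof. by apply; apply: ext_refl. Qed.

(** * Models of PA *)

(** Replaces T by the empty predicate, which turns induction for arithmetical
    formulas into induction for all formulas with that predicate. *)
Fixpoint untrue (f : form) : form :=
  match f with
  | Eq _ _ => f
  | Tr _ => ~' (Zero =' Zero)
  | Neg g => Neg (untrue g)
  | And g h => And (untrue g) (untrue h)
  | Or g h => Or (untrue g) (untrue h)
  | Ex x g => Ex x (untrue g)
  | All x g => All x (untrue g)
  end.

Lemma untrue_arithmetical f : arithmetical (untrue f).
Proof. by elim: f => //= f -> g ->. Qed.

Lemma sat_untrue (M : structure) (T : M -> Prop) e f :
  sat T e (untrue f) <-> sat (fun _ : M => False) e f.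
Proof.
elim: f e => /= [s t|t|f IH|f IHf g IHg|f IHf g IHg|x f IH|x f IH] e.
- by [].
- by split=> // h; apply: h.
- by rewrite IH.
- by rewrite IHf IHg.
- by rewrite IHf IHg.
- by split=> -[a /IH]; exists a.
- by split=> h a; apply/IH.
Qed.

Lemma sat_arithmetical (M : structure) (T T' : M -> Prop) e f :
  arithmetical f -> (sat T e f <-> sat T' e f).
Proof.
elim: f e => /= [s t|t|f IH|f IHf g IHg|f IHf g IHg|x f IH|x f IH] e //.
- by move=> h; rewrite IH.
- by move=> /andP[h1 h2]; rewrite IHf // IHg.
- by move=> /andP[h1 h2]; rewrite IHf // IHg.
- by move=> h; split=> -[a /IH]; exists a; auto.
- by move=> h; split=> h' a; apply/IH.
Qed.

Lemma pa_model_valid (M : structure) (T : M -> Prop) : valid T PA <-> pa_model M.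
Proof.
split=> [h|HM].
  have e : nat -> M := fun=> s0.
  split.
  - by apply: (proj1 (rp_sat (k := 0) _) (h _ PA_succ0 e)); rp_solve.
  - by apply: (proj1 (rp_sat (k := 0) _) (h _ PA_succI e)); rp_solve.
  - by apply: (proj1 (rp_sat (k := 0) _) (h _ PA_add0 e)); rp_solve.
  - by apply: (proj1 (rp_sat (k := 0) _) (h _ PA_addS e)); rp_solve.
  - by apply: (proj1 (rp_sat (k := 0) _) (h _ PA_mul0 e)); rp_solve.
  - by apply: (proj1 (rp_sat (k := 0) _) (h _ PA_mulS e)); rp_solve.
  - exists (fun=> False) => f x e'.
    have /sat_induction H := h _ (PA_induction x (untrue_arithmetical f)) e'.
    move=> h0 hS a; apply/(sat_untrue T); apply: H => [|b]; first exact/sat_untrue.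
    by move=> /sat_untrue hb; apply/sat_untrue; apply: hS.
move=> q; case=> [||||||x f hf] e; last 1 first.
- have [T' HI] := @q_ind M HM; apply/sat_induction => e' h0 hS a.
  have E e1 := @sat_arithmetical M T T' e1 f hf.
  apply/E; apply: HI => [|b hb]; first by apply/E.
  by apply/E; apply: hS; apply/E.
- by apply: (proj2 (rp_sat (k := 0) _) (@q_S0 M HM)); rp_solve.
- by apply: (proj2 (rp_sat (k := 0) _) (@q_SI M HM)); rp_solve.
- by apply: (proj2 (rp_sat (k := 0) _) (@q_A0 M HM)); rp_solve.
- by apply: (proj2 (rp_sat (k := 0) _) (@q_AS M HM)); rp_solve.
- by apply: (proj2 (rp_sat (k := 0) _) (@q_M0 M HM)); rp_solve.
- by apply: (proj2 (rp_sat (k := 0) _) (@q_MS M HM)); rp_solve.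
Qed.

(** * Models of the theory of truth *)

Definition tr_inst (M : structure) (T : M -> Prop) (v p t : M) : Prop :=
  exists y, fsub v t p y /\ T y.

Class truth_model (M : structure) (T : M -> Prop) : Prop := TruthModel {
  tr_eq : forall s t, iscterm s /\ iscterm t -> (T (ceq s t) <-> sameval s t);
  tr_and : forall p q, issent p /\ issent q -> (T (cand p q) <-> T p /\ T q);
  tr_or : forall p q, issent p /\ issent q -> (T (cor p q) <-> T p \/ T q);
  tr_neg : forall p, issent p -> (T (cneg p) <-> ~ T p);
  tr_ex : forall v p, isform1 v p ->
    (T (cex v p) <-> exists t, iscterm t /\ tr_inst T v p t);
  tr_all : forall v p, isform1 v p ->
    (T (call v p) <-> forall t, iscterm t -> tr_inst T v p t);
  tr_reg : forall v p t s, isform1 v p /\ iscterm t /\ iscterm s ->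
    (sameval t s -> (tr_inst T v p t <-> tr_inst T v p s)) }.

Lemma truth_model_valid (M : structure) (T : M -> Prop) :
  valid T CT_Delta0_regular -> pa_model M /\ truth_model T.
Proof.
move=> h; split; first by apply/(@pa_model_valid M T) => q hq; apply: h; apply: Or31; apply: CTminus_t_PA.
have e : nat -> M := fun=> s0.
have h' q : CTminus_t q -> sat T e q by move=> hq; apply: h; apply: Or31.
split; rewrite /tr_inst.
- by apply: (proj1 (rp_sat (k := 0) _) (h' _ CTminus_t_eq)); rp_solve.
- by apply: (proj1 (rp_sat (k := 0) _) (h' _ CTminus_t_and)); rp_solve.
- by apply: (proj1 (rp_sat (k := 0) _) (h' _ CTminus_t_or)); rp_solve.
- by apply: (proj1 (rp_sat (k := 0) _) (h' _ CTminus_t_neg)); rp_solve.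
- by apply: (proj1 (rp_sat (k := 0) _) (h' _ CTminus_t_ex)); rp_solve.
- by apply: (proj1 (rp_sat (k := 0) _) (h' _ CTminus_t_all)); rp_solve.
- have hr : sat T e regularity by apply: h; apply: Or33.
  by apply: (proj1 (rp_sat (k := 0) _) hr); rp_solve.
Qed.

Section Truth.
Context {M : structure} {HM : pa_model M} {T : M -> Prop} {HT : truth_model T}.
Implicit Types (a b w z sigma : M) (r e : nat -> M).
Notation v_ x := (cvar (nm x)).

(** The set that T takes sigma to define. *)
Definition says sigma a : Prop := exists t, iscterm t /\ denotes t a /\ T (hole sigma t).

Definition env r e x : Prop := iscterm (r x) /\ denotes (r x) (e x).

(** By regularity, applied to the formula that arises from the hole by replacing the
    term by a variable, the choice of the term that denotes a does not matter. *)
Lemma says_hole sigma t a : good sigma -> iscterm t -> denotes t a ->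
  (T (hole sigma t) <-> says sigma a).
Proof.
move=> hs ht ha; split=> [h|[s [hs1 [hs2 hs3]]]]; first by exists t.
pose r x : M := v_ x; pose f := Tr (Var 1).
have sub u z : fsub (v_ 1) u (fcode sigma r f) z <-> z = hole sigma u.
  by rewrite fcode_fsub // => y _; right.
have F1 : isform1 (v_ 1) (fcode sigma r f).
  split; [by exists (nm 1)|split]; first by apply: fcode_form => // y _; right.
  move=> w [[n ->] /fcode_occf []//]; first by move=> y _; right.
  by move=> y; rewrite inE => -[/eqP-> [-> _]].
have [z [/sub -> //]] : tr_inst T (v_ 1) (fcode sigma r f) t.
apply/(tr_reg (conj F1 (conj ht hs1))); first by exists a.
by exists (hole sigma s); rewrite sub.
Qed.

Lemma tcode_cterm r t : (forall x, x \in tvars t -> iscterm (r x)) -> iscterm (tcode r t).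
Proof.
elim: t => /= [x||s IH|s IHs u IHu|s IHs u IHu] h.
- exact: h (mem_head _ _).
- exact: ct_zero.
- exact: ct_succ (IH h).
- by apply: ct_add; [apply: IHs; apply: in_catl h|apply: IHu; apply: in_catr h].
- by apply: ct_mul; [apply: IHs; apply: in_catl h|apply: IHu; apply: in_catr h].
Qed.

Lemma tcode_denotes r e t : (forall x, x \in tvars t -> env r e x) ->
  denotes (tcode r t) (eval e t).
Proof.
elim: t => /= [x||s IH|s IHs u IHu|s IHs u IHu] h.
- by case: (h x (mem_head _ _)).
- exact/denotes_zero.
- by apply/denotes_succ; eexists; split; [reflexivity|apply: IH].
- apply/denotes_add; eexists _, _; split; first reflexivity.
  by split; [apply: IHs; apply: in_catl h|apply: IHu; apply: in_catr h].
- apply/denotes_mul; eexists _, _; split; first reflexivity.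
  by split; [apply: IHs; apply: in_catl h|apply: IHu; apply: in_catr h].
Qed.

Lemma fcode_sent sigma r e f : good sigma -> (forall x, x \in fv f -> env r e x) ->
  issent (fcode sigma r f).
Proof.
move=> hs h; have h' x : x \in fv f -> leaf r x by move=> /h[]; left.
split; first exact: fcode_form.
move=> w [n ->] /fcode_occf-/(_ hs h') [x [/h [hx _] [_ E]]].
by move: hx; rewrite E => /ct_inv hx; rewrite /cterm_st in hx; code_inv.
Qed.

Lemma fcode_form1 sigma r e x f : good sigma ->
  (forall y, y \in [seq y <- fv f | y != x] -> env r e y) ->
  isform1 (v_ x) (fcode sigma (upd r x (v_ x)) f).
Proof.
move=> hs h.
have h' : forall y, y \in fv f -> leaf (upd r x (v_ x)) y.
  by apply: leaf_upd => y /h[]; left.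
split; first by exists (nm x).
split; first exact: fcode_form.
move=> w [[n ->]] /fcode_occf-/(_ hs h') [y [hy [-> E]]].
have [->//|ne] := eqVneq y x.
have [] : env r e y by apply: h; rewrite mem_filter ne.
move: E; rewrite upd_other // => -> /ct_inv hx _; rewrite /cterm_st in hx; code_inv.
Qed.

Lemma fcode_inst sigma r e x f t : good sigma -> template f ->
  (forall y, y \in [seq y <- fv f | y != x] -> env r e y) ->
  (tr_inst T (v_ x) (fcode sigma (upd r x (v_ x)) f) t <-> T (fcode sigma (upd r x t) f)).
Proof.
move=> hs ht h.
have sub z : fsub (v_ x) t (fcode sigma (upd r x (v_ x)) f) z <-> z = fcode sigma (upd r x t) f.
  rewrite fcode_fsub //.
  - rewrite (@fcode_ext M sigma _ (upd r x t)) // => y _.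
    by rewrite /upd; case: eqP.
  - by apply: leaf_upd => y /h[]; left.
  - by move=> y _ _; rewrite upd_same.
by split=> [[z [/sub->]]//|hh]; exists (fcode sigma (upd r x t) f); rewrite sub.
Qed.

Lemma env_upd r e x t a f : iscterm t -> denotes t a ->
  (forall y, y \in [seq y <- fv f | y != x] -> env r e y) ->
  forall y, y \in fv f -> env (upd r x t) (upd e x a) y.
Proof.
move=> ht ha h y hy; rewrite /env /upd; case: eqP => // /eqP ne.
by apply: h; rewrite mem_filter ne.
Qed.

(** By induction on the standard formula f, with one axiom of truth per case. The
    quantifier axioms range over closed terms; these have values, and every
    element is the value of one. *)
Lemma truth sigma r e f : good sigma -> template f ->
  (forall x, x \in fv f -> env r e x) ->
  (T (fcode sigma r f) <-> sat (says sigma) e f).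
Proof.
move=> hs; elim: f r e => /= [s t|t|f IH|f IHf g IHg|f IHf g IHg|x f IH|x f IH] r e ht h.
- rewrite tr_eq; last first.
    by split; apply: tcode_cterm => x hx; apply h; rewrite mem_cat hx ?orbT.
  have E1 : denotes (tcode r s) (eval e s) by apply: tcode_denotes; apply: in_catl h.
  have E2 : denotes (tcode r t) (eval e t) by apply: tcode_denotes; apply: in_catr h.
  rewrite (sameval_iff _ E1); split=> [E|->//]; exact: denotes_fun E E2.
- by apply: says_hole => //; [apply: tcode_cterm => x /h[]|apply: tcode_denotes].
- by rewrite tr_neg ?(IH r e) //; apply: fcode_sent h.
- move/andP: ht => [h1 h2]; have hl := in_catl h; have hr := in_catr h.
  rewrite tr_and; last by split; [apply: fcode_sent hl|apply: fcode_sent hr].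
  by rewrite (IHf r e) // (IHg r e).
- move/andP: ht => [h1 h2]; have hl := in_catl h; have hr := in_catr h.
  rewrite tr_or; last by split; [apply: fcode_sent hl|apply: fcode_sent hr].
  by rewrite (IHf r e) // (IHg r e).
- rewrite tr_ex; last exact: fcode_form1 h.
  split=> [[t [h1 /(fcode_inst _ hs ht h) h2]]|[a ha]].
    have [a ha] := denotes_total h1; exists a.
    by apply/(IH (upd r x t)) => //; apply: env_upd.
  have [t [h1 h2]] := numeral a; exists t; split=> //; apply/(fcode_inst _ hs ht h).
  by apply/(IH _ (upd e x a)) => //; apply: env_upd.
- rewrite tr_all; last exact: fcode_form1 h.
  split=> [H a|H t h1].
    have [t [h1 h2]] := numeral a; have /(fcode_inst _ hs ht h) := H t h1.
    by move=> /(IH _ (upd e x a)); apply => //; apply: env_upd.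
  have [a ha] := denotes_total h1; apply/(fcode_inst _ hs ht h).
  by apply/(IH _ (upd e x a)) => //; apply: env_upd.
Qed.

End Truth.
Arguments says {M} T sigma a.

(** * Induction for truth along sequences of sentences *)

Ltac rp_hook ::=
  lazymatch goal with
  | |- rp _ _ _ _ (coded _ _ _ _) => eapply rp_mem; den_solve
  | H : forall _ _ _ _, ext _ _ _ _ -> den _ _ _ _ -> rp _ _ _ _ (?m _) |- rp _ _ _ _ (?m _) =>
      eapply H; [ext_solve | den_solve]
  | H : forall _ _ _ _ _ _ _ _ _ _ _, _ |- rp _ _ _ _ (_ _ _ _ _) => eapply H; den_solve
  | |- _ => solve [auto with rp_db nocore]
  end.

(** H is the graph of a sequence i |-> h with two parameters, defined by a formula
    whose bound variables can be moved to any level. *)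
Definition representable (M : structure) (H : M -> M -> M -> M -> Prop) : Prop :=
  exists F, forall (T : M -> Prop) k e t1 t2 t3 t4 p q i h,
    den k e t1 p -> den k e t2 q -> den k e t3 i -> den k e t4 h ->
    rp T k e (F k t1 t2 t3 t4) (H p q i h).

Definition tr_sign (M : structure) (T : M -> Prop) (b : bool) (h : M) : Prop :=
  if b then T h else ~ T h.

(** The bounded formula to which induction is applied: i <= n implies that some
    h <= B with the pair of i and h in the coded graph satisfies T (or its negation,
    according to b). The variables 0, ..., 4 are i, n, B, c, d. Induction for the
    negation is needed to transfer falsity along a sequence. *)
Definition seq_form (b : bool) : form :=
  ~' (Ex 5 (le_f 6 (Var 5) (Var 1) /\' (Var 5 =' Var 0)))
  \/' Ex 5 (le_f 6 (Var 5) (Var 2) /\'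
        (Ex 6 (le_f 7 (Var 6) (Var 3) /\'
           (Mul (Var 6) (Succ (Mul (Succ (pair_t (Var 0) (Var 5))) (Var 4))) =' Var 3))
         /\' (if b then Tr (Var 5) else ~' (Tr (Var 5))))).

Lemma seq_form_Delta0 b : Delta0 (seq_form b).
Proof.
apply: Delta0_or.
  by apply: Delta0_neg; apply: Delta0_ex => //; apply: Delta0_eq.
apply: Delta0_ex => //; apply: Delta0_and.
  by apply: Delta0_ex => //; apply: Delta0_eq.
by case: b; [|apply: Delta0_neg]; apply: Delta0_tr.
Qed.

Section Sequences.
Context {M : structure} {HM : pa_model M} {T : M -> Prop}.
Hypothesis HD : valid T Delta0_induction.
Implicit Types (i n h p q : M).

(** Induction on i for T (h_i). Below a given n the arithmetical graph of the
    sequence is replaced by a coded finite set, so that the induction formula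
    becomes bounded. *)
Lemma truth_seq b (H : M -> M -> M -> M -> Prop) p q : representable H ->
  (forall i, exists h, H p q i h) ->
  (forall i h h', H p q i h -> H p q i h' -> h = h') ->
  (forall h, H p q s0 h -> tr_sign T b h) ->
  (forall i h h', H p q i h -> H p q (sS i) h' -> tr_sign T b h -> tr_sign T b h') ->
  forall i h, H p q i h -> tr_sign T b h.
Proof.
move=> [F hF] tot fn h0 hS n h hn.
have [B hB] : exists B, forall i, i <= n -> forall h, H p q i h -> h <= B.
  move: {h hn} n; apply: arith_ind.
  - by move=> T'; definable_with ([:: p; q] : seq M).
  - have [h hh] := tot s0; exists h => i hi h' hh'.
    have E : i = s0 by apply: le_antisym hi _; apply: le_0.
    by rewrite E in hh'; rewrite (fn _ _ _ hh hh'); apply: le_refl.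
  - move=> n [B hB]; have [h hh] := tot (sS n); exists (B + h) => i hi h' hh'.
    case: (le_eq_or_lt hi) => [E|/lt_S_le /hB /(_ _ hh') hb].
      by rewrite E in hh'; rewrite (fn _ _ _ hh hh'); apply: le_addl.
    by apply: le_trans hb _; apply: le_addr.
pose P z := exists i h, z = pr i h /\ H p q i h.
have [c [d cd]] : exists c d, forall y, coded (pr n B) c d y <-> (y <= pr n B /\ P y).
  by apply: arith_comprehension => T' d; rewrite /P;
     definable_with ([:: p; q; n; B; d] : seq M).
(* the quotient in the coding of the set is bounded by c *)
have code i h' : i <= n -> h' <= B ->
    ((exists x, x <= c /\ x * sS (sS (pr i h') * d) = c) <-> H p q i h').
  move=> hi hh'; have hz : pr i h' <= pr n B by apply: le_pr.
  transitivity (coded (pr n B) c d (pr i h')).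
    split=> [[x [_ hx]]|[_ [x hx]]]; first by split=> //; exists x.
    exists x; split=> //; rewrite -hx; exists (x * (sS (pr i h') * d)).
    by rewrite q_MS.
  rewrite cd; split=> [[_ [i' [h'' [/pr_inj[-> ->]]]]]//|hh].
  by split=> //; exists i, h'.
pose Q i := ~ (exists x, x <= n /\ x = i) \/ (exists h', h' <= B /\
   (exists x, x <= c /\ x * sS (sS (pr i h') * d) = c) /\ tr_sign T b h').
pose e := nth s0 [:: s0; n; B; c; d].
have E i : sat T (upd e 0 i) (seq_form b) <-> Q i.
  have : rp T 5 (nth s0 [:: i; n; B; c; d]) (seq_form b) (Q i).
    by rewrite /Q /seq_form /tr_sign; case: (b); rp_solve.
  by apply; split=> // -[|[|[|[|[|]]]]].
have QP i : i <= n -> (Q i <-> forall h, H p q i h -> tr_sign T b h).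
  move=> hi; have [h' hh'] := tot i; have hb := hB _ hi _ hh'.
  split=> [[hn'|[h1 [hb1 [/(code _ _ hi hb1) H1 t1]]]] h2 H2|H1].
  - by case: hn'; exists i.
  - by rewrite -(fn _ _ _ H1 H2).
  - by right; exists h'; split=> //; split; [apply/code|apply: H1].
have : Q n; last by move/(QP _ (le_refl n)); apply.
apply/E; apply: (proj1 (sat_induction T e 0 (seq_form b))).
- by apply: HD; apply: Delta0_induction_ax; apply: seq_form_Delta0.
- by apply/E; apply/QP => //; apply: le_0.
move=> i /E hi; apply/E; case: (le_or_lt (sS i) n) => [hin|hin].
  apply/QP => // h' hh'; have [h'' hh''] := tot i.
  have hin' : i <= n by apply: lt_le.
  apply: (hS _ _ _ hh'' hh'); exact: (proj1 (QP i hin') hi _ hh'').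
left=> -[x [hx E']]; rewrite E' in hx; exact: (lt_not_le hin hx).
Qed.

End Sequences.

(** * Satisfaction classes *)

Section Step.
Variable M : structure.
Implicit Types (i m n x y z : M).

(** The elementary operations on stacks by which formulas are built: identity, push
    of an arbitrary value, test for equality of the two top values, removal of the
    second value, push of 0, and replacement of the top by its successor, of the two
    top values by their sum, and by their product. *)
Definition move_ i y z : Prop :=
  (i = nm 1 /\ z = y)
  \/ (i = nm 2 /\ exists a, z = pr a y)
  \/ (i = nm 3 /\ z = y /\ exists a r, y = pr a (pr a r))
  \/ (i = nm 4 /\ exists a b r, y = pr a (pr b r) /\ z = pr a r)
  \/ (i = nm 5 /\ z = pr s0 y)
  \/ (i = nm 6 /\ exists a r, y = pr a r /\ z = pr (sS a) r)
  \/ (i = nm 7 /\ exists a b r, y = pr a (pr b r) /\ z = pr (a + b) r)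
  \/ (i = nm 8 /\ exists a b r, y = pr a (pr b r) /\ z = pr (a * b) r).

(** The only way to build a formula: <i, <m, m'>> is false of y iff an i-move leads
    from y to some z of which both m and m' are true. With the identity this is the
    Sheffer stroke, with the push it is a negated existential quantifier. All other
    numbers are codes of true formulas. Constituents have smaller codes, since i > 0. *)
Definition refuted (P : M -> Prop) x y : Prop :=
  exists i m m' z, x = pr (sS i) (pr m m') /\ move_ (sS i) y z /\ P (pr m z) /\ P (pr m' z).

(** Tarski's definition of satisfaction for the formulas up to n, if P is
    satisfaction for the formulas below n. *)
Definition step (P : M -> Prop) n a : Prop :=
  exists x y, a = pr x y /\ ((x < n /\ P (pr x y)) \/ (~ x < n /\ ~ refuted P x y)).

End Step.

Definition move_f (k : nat) (i y z : term) : form :=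
  (i =' num 1 /\' z =' y)
  \/' (i =' num 2 /\' ex1 k (fun k a => z =' pair_t a y))
  \/' (i =' num 3 /\' z =' y /\' ex2 k (fun k a r => y =' pair_t a (pair_t a r)))
  \/' (i =' num 4 /\' ex2 k (fun k a b => ex1 k (fun k r =>
         y =' pair_t a (pair_t b r) /\' z =' pair_t a r)))
  \/' (i =' num 5 /\' z =' pair_t Zero y)
  \/' (i =' num 6 /\' ex2 k (fun k a r => y =' pair_t a r /\' z =' pair_t (Succ a) r))
  \/' (i =' num 7 /\' ex2 k (fun k a b => ex1 k (fun k r =>
         y =' pair_t a (pair_t b r) /\' z =' pair_t (Add a b) r)))
  \/' (i =' num 8 /\' ex2 k (fun k a b => ex1 k (fun k r =>
         y =' pair_t a (pair_t b r) /\' z =' pair_t (Mul a b) r))).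

Definition refuted_f (k : nat) (x y : term) : form :=
  ex2 k (fun k i m => ex2 k (fun k m' z =>
    x =' pair_t (Succ i) (pair_t m m') /\' move_f k (Succ i) y z
    /\' Tr (pair_t m z) /\' Tr (pair_t m' z))).

Definition step_f : form :=
  ex2 2 (fun k x y => Var 0 =' pair_t x y /\'
    ((le_f k (Succ x) (Var 1) /\' Tr (pair_t x y))
     \/' (~' le_f k (Succ x) (Var 1) /\' ~' refuted_f k x y))).

Lemma rp_step (M : structure) (P : M -> Prop) (e : nat -> M) :
  rp P 2 e step_f (step P (e 1) (e 0)).
Proof.
have h0 : den 2 e (Var 0) (e 0) by apply: den_var.
have h1 : den 2 e (Var 1) (e 1) by apply: den_var.
by rewrite /step /refuted /move_ /step_f /refuted_f /move_f /ex2; rp_solve.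
Qed.

Lemma template_step : template step_f /\ {subset fv step_f <= [:: 0; 1]}.
Proof. by split; [vm_compute|apply/allP; vm_compute]. Qed.

(** The codes of templates as terms of the language, for use in formulas. *)
Fixpoint tcode_t (r : nat -> term) (t : term) : term :=
  match t with
  | Var x => r x
  | Zero => c_zero
  | Succ s => c_succ (tcode_t r s)
  | Add s u => c_add (tcode_t r s) (tcode_t r u)
  | Mul s u => c_mul (tcode_t r s) (tcode_t r u)
  end.

Fixpoint fcode_t (s : term) (r : nat -> term) (f : form) : term :=
  match f with
  | Eq t u => c_eq (tcode_t r t) (tcode_t r u)
  | Tr t => c_ex (c_var (num 0)) (c_and (c_eq (c_var (num 0)) (tcode_t r t)) s)
  | Neg g => c_neg (fcode_t s r g)
  | And g h => c_and (fcode_t s r g) (fcode_t s r h)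
  | Or g h => c_or (fcode_t s r g) (fcode_t s r h)
  | Ex x g => c_ex (c_var (num x)) (fcode_t s (upd r x (c_var (num x))) g)
  | All x g => c_all (c_var (num x)) (fcode_t s (upd r x (c_var (num x))) g)
  end.

Definition var_code (M : structure) (x : nat) : M := cvar (nm x).
Definition step_code (M : structure) (t s : M) : M :=
  fcode s (upd (@var_code M) 1 t) step_f.
Definition step_code_t (t s : term) : term :=
  fcode_t s (upd (fun x => c_var (num x)) 1 t) step_f.

Section StepCode.
Variable M : structure.
Implicit Types (e : nat -> M) (k : nat).

Lemma den_tcode k e rt (r : nat -> M) t : (forall x, den k e (rt x) (r x)) ->
  den k e (tcode_t rt t) (tcode r t).
Proof.
by move=> h; elim: t => /= [x||t IH|t IHt u IHu|t IHt u IHu] //;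
   do ?apply: den_pr => //; try exact: den_num; exact: den_zero.
Qed.

Lemma den_fcode k e rt (r : nat -> M) st (s : M) f : (forall x, den k e (rt x) (r x)) ->
  den k e st s -> den k e (fcode_t st rt f) (fcode s r f).
Proof.
move=> + hs; elim: f rt r => /= [t u|t|f IH|f IHf g IHg|f IHf g IHg|x f IH|x f IH] rt r h.
- by do ?apply: den_pr; try exact: den_num; apply: den_tcode.
- by do ?apply: den_pr => //; try exact: den_num; apply: den_tcode.
- by do ?apply: den_pr; try exact: den_num; apply: IH.
- by do ?apply: den_pr; try exact: den_num; [apply: IHf|apply: IHg].
- by do ?apply: den_pr; try exact: den_num; [apply: IHf|apply: IHg].
- do ?apply: den_pr; try exact: den_num; apply: IH => y; rewrite /upd; case: eqP => // _.
  by apply: den_pr; apply: den_num.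
- do ?apply: den_pr; try exact: den_num; apply: IH => y; rewrite /upd; case: eqP => // _.
  by apply: den_pr; apply: den_num.
Qed.

Lemma den_step_code k e tt ts (t s : M) : den k e tt t -> den k e ts s ->
  den k e (step_code_t tt ts) (step_code t s).
Proof.
move=> h1 h2; apply: den_fcode => // x; rewrite /upd; case: eqP => // _.
by apply: den_pr; apply: den_num.
Qed.

(** The hierarchy of the formulas s = sigma_i inside a model, along with the numeral
    t of i, which occurs in the next formula. *)
Definition sig_st (m : M -> Prop) (z : M) : Prop :=
  z = pr s0 (pr czero (ceq czero czero))
  \/ exists i t s, z = pr (sS i) (pr (csucc t) (step_code t s)) /\ m (pr i (pr t s)).
Definition sig (i t s : M) : Prop := gen sig_st (pr i (pr t s)).

Definition sig_form (k : nat) (i t s : term) : form :=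
  generated (fun k y m =>
    y =' pair_t Zero (pair_t c_zero (c_eq c_zero c_zero))
    \/' ex1 k (fun k i => ex1 k (fun k t => ex1 k (fun k s =>
      y =' pair_t (Succ i) (pair_t (c_succ t) (step_code_t t s)) /\'
      m k (pair_t i (pair_t t s)))))) k (pair_t i (pair_t t s)).

End StepCode.

Ltac den_hook ::=
  lazymatch goal with |- den _ _ _ (step_code _ _) => apply den_step_code; den_solve end.

Lemma rp_sig (M : structure) (T : M -> Prop) k e ti (i : M) tt t ts s :
  den k e ti i -> den k e tt t -> den k e ts s ->
  rp T k e (sig_form k ti tt ts) (sig i t s).
Proof. by move=> h1 h2 h3; rp_gen_solve; rewrite /sig_st; rp_solve. Qed.
#[export] Hint Extern 0 (rp _ _ _ _ (sig _ _ _)) => eapply rp_sig; den_solve : rp_db.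

Section Sig.
Context {M : structure} {HM : pa_model M}.
Implicit Types (i t s x y z : M).

Lemma mono_sig : monotone (@sig_st M).
Proof. by move=> m m' z h [->|[i [t [s [-> /h hm]]]]]; [left|right; exists i, t, s]. Qed.

Lemma sig_0 t s : sig s0 t s <-> t = czero /\ s = ceq czero czero.
Proof.
split=> [/(gen_inv mono_sig)[|[i [t' [s' [/pr_inj[/esym/q_S0]]]]]]//|[-> ->]].
  by move=> /pr_inj[_ /pr_inj[]].
by apply: gen_intro0; [exact: mono_sig|left].
Qed.

Lemma sig_S i t s : sig (sS i) t s <->
  exists t' s', sig i t' s' /\ t = csucc t' /\ s = step_code t' s'.
Proof.
split=> [/(gen_inv mono_sig)[/pr_inj[/q_S0]//|[i' [t' [s' [/pr_inj[/q_SI-> /pr_inj[-> ->]] h]]]]]|].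
  by exists t', s'.
move=> [t' [s' [h [-> ->]]]]; apply: (gen_intro2 mono_sig h h); right; exists i, t', s'.
by split=> //; left.
Qed.

Lemma sig_total i : exists t s, sig i t s.
Proof.
move: i; apply: arith_ind; first by move=> T; definable_with (@nil M).
  by exists czero, (ceq czero czero); apply/sig_0.
by move=> i [t [s h]]; do 2 eexists; apply/sig_S; exists t, s.
Qed.

Lemma sig_fun i : forall t s t' s', sig i t s -> sig i t' s' -> t = t' /\ s = s'.
Proof.
move: i; apply: arith_ind; first by move=> T; definable_with (@nil M).
  by move=> t s t' s' /sig_0[-> ->] /sig_0[-> ->].
move=> i IH t s t' s' /sig_S[t1 [s1 [h [-> ->]]]] /sig_S[t2 [s2 [h' [-> ->]]]].
by have [-> ->] := IH _ _ _ _ h h'.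
Qed.

Lemma good_sig0 : good (ceq czero czero : M).
Proof.
split; first by apply: f_eq; apply/t_cterm/ct_zero.
split=> [w [n ->] /occf_eq[] /occ_zero //|n t z ne].
by rewrite fsub_eq; apply: graph2 => ?; apply: tsub_zero.
Qed.

Lemma sig_good i : forall t s, sig i t s -> iscterm t /\ denotes t i /\ good s.
Proof.
move: i; apply: arith_ind; first by move=> T; rewrite /good; definable_with (@nil M).
  move=> t s /sig_0[-> ->]; split; first exact: ct_zero.
  by split; [apply/denotes_zero|apply: good_sig0].
move=> i IH t s /sig_S[t' [s' [/IH[h1 [h2 h3]] [-> ->]]]].
split; first exact: ct_succ.
split; first by apply/denotes_succ; exists i.
have [h4 h5] := template_step; apply: good_fcode => // x /h5.
by rewrite !inE => /orP[/eqP->|/eqP->]; [right|left].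
Qed.

End Sig.

(** Shifting all variables by one frees the variable 0 and turns any formula into a
    template. *)
Fixpoint tshift (t : term) : term :=
  match t with
  | Var x => Var x.+1
  | Zero => Zero
  | Succ s => Succ (tshift s)
  | Add s u => Add (tshift s) (tshift u)
  | Mul s u => Mul (tshift s) (tshift u)
  end.

Fixpoint shift (f : form) : form :=
  match f with
  | Eq s t => Eq (tshift s) (tshift t)
  | Tr t => Tr (tshift t)
  | Neg g => Neg (shift g)
  | And g h => And (shift g) (shift h)
  | Or g h => Or (shift g) (shift h)
  | Ex x g => Ex x.+1 (shift g)
  | All x g => All x.+1 (shift g)
  end.

Lemma eval_tshift (M : structure) (e : nat -> M) t : eval e (tshift t) = eval (fun x => e x.+1) t.
Proof. by elim: t => //= [t ->|t -> u ->|t -> u ->]. Qed.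

Lemma sat_shift (M : structure) (P : M -> Prop) e f : sat P e (shift f) <-> sat P (fun x => e x.+1) f.
Proof.
have U e' x a f' : sat P (fun y => upd e' x.+1 a y.+1) f' <-> sat P (upd (fun y => e' y.+1) x a) f'.
  by apply: sat_ext => y _; rewrite /upd eqSS.
elim: f e => /= [s t|t|f IH|f IHf g IHg|f IHf g IHg|x f IH|x f IH] e.
- by rewrite !eval_tshift.
- by rewrite eval_tshift.
- by rewrite IH.
- by rewrite IHf IHg.
- by rewrite IHf IHg.
- by split=> -[a]; rewrite ?IH -?U => h; exists a; rewrite ?IH -?U in h *.
- by split=> h a; move: (h a); rewrite IH U.
Qed.

Lemma template_shift f : template (shift f) /\ 0 \notin fv (shift f).
Proof.
have H t : 0 \notin tvars (tshift t).
  by elim: t => //= t IHt u IHu; rewrite mem_cat negb_or IHt.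
elim: f => //= [s t|f [-> hf] g [-> hg]|f [-> hf] g [-> hg]|x f [-> hf]|x f [-> hf]].
- by rewrite mem_cat negb_or !H.
- by rewrite mem_cat negb_or hf.
- by rewrite mem_cat negb_or hf.
- by rewrite mem_filter negb_and hf orbT.
- by rewrite mem_filter negb_and hf orbT.
Qed.

Section Classes.
Context {M : structure} {HM : pa_model M} {T : M -> Prop} {HT : truth_model T}.
Hypothesis HD : valid T Delta0_induction.
Implicit Types (i t s x y z : M).

Lemma says_step i t s a : iscterm t -> denotes t i -> good s ->
  (says T (step_code t s) a <-> step (says T s) i a).
Proof.
move=> ht hi hs; have [u [hu1 hu2]] := numeral a.
have [temp sub] := template_step.
have gs : good (step_code t s).
  by apply: good_fcode => // x /sub; rewrite !inE => /orP[/eqP->|/eqP->]; [right|left].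
rewrite -(says_hole gs hu1 hu2).
pose r := upd (upd (@var_code M) 1 t) 20 u.
pose e := upd (upd (fun=> s0) 1 i) 20 a.
pose f := Ex 0 ((Var 0 =' Var 20) /\' step_f).
have -> : hole (step_code t s) u = fcode s r f.
  by rewrite /f /=; congr (cex _ (cand (ceq _ _) _)).
have sf : {subset fv f <= [:: 1; 20]} by apply/allP; vm_compute.
have henv (x : nat) : x \in fv f -> env r e x by move=> /sf; rewrite !inE => /orP[] /eqP->.
rewrite (truth hs _ henv) -?[sat _ _ f]/(exists b, b = a /\ sat (says T s) (upd e 0 b) step_f);
  last exact: temp.
have E b : sat (says T s) (upd e 0 b) step_f <-> step (says T s) i b.
  have := rp_sat (@rp_step M (says T s) (upd e 0 b)).
  by rewrite upd_same upd_other // /e upd_other // upd_same.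
by split=> [[b [-> /E]]//|/E h]; exists a.
Qed.

(** A formula x is evaluated at the first stage that deals with it. *)
Definition sat_class (a : M) : Prop :=
  exists x y t s, a = pr x y /\ sig (sS x) t s /\ says T s a.

Lemma representable_hole : representable (fun p q i h : M =>
  exists t s, sig (p + i) t s /\ h = hole s q).
Proof.
eexists=> T' k e t1 t2 t3 t4 p q i h h1 h2 h3 h4; rewrite /hole; rp_solve.
Qed.

(** From a stage to the next one above x nothing changes for x, by the axioms of
    truth; induction along the sequence of sentences sigma_j(<x, y>) covers any
    distance. *)
Lemma says_sat_class i t s x y : sig i t s -> x < i ->
  (says T s (pr x y) <-> sat_class (pr x y)).
Proof.
move=> hi [j0 hj0]; have {hj0} E0 : sS x + j0 = i by rewrite addC.
have [u [hu1 hu2]] := numeral (pr x y).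
have [t1 [s1 h1]] := sig_total (sS x).
have -> : sat_class (pr x y) <-> says T s1 (pr x y).
  split=> [[x' [y' [t' [s' [/pr_inj[<- _] [h' H]]]]]]|H]; last by exists x, y, t1, s1.
  by have [_ ->] := sig_fun h1 h'.
have toT j t' s' : sig j t' s' -> (says T s' (pr x y) <-> T (hole s' u)).
  by move=> /sig_good[_ [_ hs]]; rewrite (says_hole hs hu1 hu2).
have L b : tr_sign T b (hole s1 u) -> tr_sign T b (hole s u).
  move=> hT; apply: (@truth_seq M HM T HD b _ (sS x) u representable_hole _ _ _ _ j0 (hole s u)).
  - by move=> j; have [t' [s' h']] := sig_total (sS x + j); exists (hole s' u), t', s'.
  - move=> j h h' [t' [s' [H ->]]] [t'' [s'' [H' ->]]].
    by have [_ ->] := sig_fun H H'.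
  - by move=> h [t' [s' []]]; rewrite q_A0 => /(sig_fun h1)[_ <-] ->.
  - move=> j h h' [t' [s' [H ->]]] [t'' [s'' []]]; rewrite q_AS => H' ->.
    have: T (hole s' u) <-> T (hole s'' u).
      rewrite -(toT _ _ _ H) -(toT _ _ _ H').
      have [t3 [s3 [H3 [_ ->]]]] := proj1 (sig_S _ _ _) H'.
      have [_ <-] := sig_fun H H3; have [<- _] := sig_fun H H3.
      have [g1 [g2 g3]] := sig_good H; rewrite says_step; [|exact: g1|exact: g2|exact: g3].
      have hlt : x < sS x + j by exists j; rewrite addC.
      split=> [hs|[x' [y' [/pr_inj[<- <-] [[_ //]|[nlt _]]]]]]; last by case: nlt.
      by exists x, y; split=> //; left.
    by case: (b) => /= E; rewrite E.
  - by exists t, s; rewrite E0.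
rewrite (toT _ _ _ hi) (toT _ _ _ h1); split=> [h|]; last exact: (L true).
by apply: NNPP => /(L false).
Qed.

(** Tarski's clauses hold without any bound on the formula. *)
Lemma sat_classE x y : sat_class (pr x y) <-> ~ refuted sat_class x y.
Proof.
have [t [s h]] := sig_total x; have [h1 [h2 h3]] := sig_good h.
have hS : sig (sS x) (csucc t) (step_code t s) by apply/sig_S; exists t, s.
rewrite -(says_sat_class y hS (lt_S x)) (says_step _ h1 h2 h3).
have E : refuted (says T s) x y <-> refuted sat_class x y.
  have Em i m m' z : x = pr (sS i) (pr m m') ->
      (says T s (pr m z) <-> sat_class (pr m z)) /\
      (says T s (pr m' z) <-> sat_class (pr m' z)).
    move=> Ex; split; apply: (says_sat_class _ h); rewrite Ex.
      exact: le_lt_trans (le_pr1 _ _) (lt_pr2 _ _).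
    exact: le_lt_trans (le_pr2 _ _) (lt_pr2 _ _).
  by split=> -[i [m [m' [z [Ex [hm [H1 H2]]]]]]]; have [E1 E2] := Em _ _ _ z Ex;
     exists i, m, m', z; do 2 split=> //; split; [apply/E1|apply/E2|apply/E1|apply/E2].
split=> [[x' [y' [/pr_inj[<- <-] [[/lt_irrefl]//|[_]]]]]|H]; first by rewrite E.
by exists x, y; split=> //; right; split; [apply: lt_irrefl|rewrite E].
Qed.

Lemma representable_inst : representable (fun p q i h : M =>
  exists t s, sig i t s /\ h = cex p (cand (ceq p t) q)).
Proof. by eexists=> T' k e t1 t2 t3 t4 p q i h h1 h2 h3 h4; rp_solve. Qed.

(** The sentences that f holds of the numerals, with T replaced by sigma_i, form a
    definable sequence; induction along it is induction for f. Putting the numeral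
    behind an equation, as in [hole], makes the sequence easy to define. *)
Lemma says_induction i t s : sig i t s -> full_induction (says T s).
Proof.
move=> /sig_good[_ [_ gs]] f x e h0 hS.
pose g := shift f; pose w := (x.+1 + (\max_(y <- fv g) y).+1)%N.
have hw : w \notin fv g.
  apply/negP => hw; suff: (w <= \max_(y <- fv g) y)%N.
    by rewrite /w addnS ltnNge leq_addl.
  by rewrite (big_rem _ hw) /=; apply: leq_maxl.
have wx : w != x.+1 by rewrite /w addnS eqn_leq negb_and -ltnNge ltnS leq_addr.
have [tg g0] := template_shift f.
pose num_ a := epsilon (inhabits a) (fun t => iscterm t /\ denotes t a).
have numP a : iscterm (num_ a) /\ denotes (num_ a) a.
  exact: (epsilon_spec (inhabits a) (fun t => iscterm t /\ denotes t a) (numeral a)).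
pose e1 (y : nat) := e y.-1; pose r (y : nat) := num_ (e1 y).
pose q := fcode s (upd r x.+1 (var_code M x.+1)) g.
pose G := Ex x.+1 ((Var x.+1 =' Var w) /\' g).
have E j t' : iscterm t' -> denotes t' j ->
    (T (cex (var_code M x.+1) (cand (ceq (var_code M x.+1) t') q)) <->
     sat (says T s) (upd e x j) f).
  move=> h1 h2.
  have -> : cex (var_code M x.+1) (cand (ceq (var_code M x.+1) t') q) =
      fcode s (upd r w t') G.
    rewrite /G /= upd_same upd_other // upd_same; congr (cex _ (cand _ _)).
    apply: fcode_ext => y hy; rewrite /upd; case: eqP => // _; case: eqP => // E.
    by rewrite -E hy in hw.
  rewrite (@truth M HM T HT s _ (upd e1 w j) G gs) //; last first.
    by move=> y _; rewrite /env /upd; case: eqP => // _; apply: numP.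
  have E' b : sat (says T s) (upd (upd e1 w j) x.+1 b) g <-> sat (says T s) (upd e x b) f.
    transitivity (sat (says T s) (upd e1 x.+1 b) g).
      apply: sat_ext => y hy; rewrite /upd; case: eqP => // _; case: eqP => // Ey.
      by rewrite -Ey hy in hw.
    rewrite sat_shift; apply: sat_ext => y _; by rewrite /upd eqSS.
  split=> [[b [/= + /E']]|/E' h].
    by rewrite upd_same upd_other // upd_same => ->.
  by exists j; split=> //=; rewrite upd_same upd_other // upd_same.
move=> a; have [ta [sa ha]] := sig_total a; have [k1 [k2 _]] := sig_good ha.
apply/(E _ _ k1 k2).
apply: (@truth_seq M HM T HD true _ (var_code M x.+1) q representable_inst _ _ _ _ a).
- by move=> j; have [t' [s' h']] := sig_total j; eexists; exists t', s'; split; [exact: h'|].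
- by move=> j h h' [t' [s' [H ->]]] [t'' [s'' [H' ->]]]; have [-> _] := sig_fun H H'.
- by move=> h [t' [s' [/sig_good[H1 [H2 _]] ->]]]; apply/(E _ _ H1 H2).
- move=> j h h' [t' [s' [/sig_good[H1 [H2 _]] ->]]] [t'' [s'' [/sig_good[H1' [H2' _]] ->]]].
  by move=> /= /(E _ _ H1 H2) /hS /(E _ _ H1' H2').
- by exists ta, sa.
Qed.

End Classes.

(** * Formulas as predicates of a stack *)

Definition nat_str : structure := @Structure nat 0 S addn muln.

(** The standard codes of formulas that are evaluated at stacks. *)
Definition op2 (i m m' : nat) : nat := @pr nat_str i (@pr nat_str m m').
Arguments op2 : simpl never.

Definition op_neg (m : nat) : nat := op2 1 m m.
Definition op (i m : nat) : nat := op_neg (op2 i m m).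
Definition op_and (m m' : nat) : nat := op_neg (op2 1 m m').
Definition op_or (m m' : nat) : nat := op2 1 (op_neg m) (op_neg m').
Definition op_ex (m m' : nat) : nat := op_neg (op2 2 m m').

(** Equality of the top of the stack with the value at position n below it. *)
Definition op_var (n : nat) : nat := iter n (op 4) (op_neg (op2 3 0 0)).
Arguments op_var : simpl never.

(** Evaluates t, pushes its value, and goes on with m. The stack holds n auxiliary
    values above those of the variables vs. *)
Fixpoint push (vs : seq nat) (n : nat) (t : term) (m : nat) : nat :=
  match t with
  | Var x => op_ex (op_var (n + index x vs)%N) m
  | Zero => op 5 m
  | Succ s => push vs n s (op 6 m)
  | Add s u => push vs n u (push vs n.+1 s (op 7 m))
  | Mul s u => push vs n u (push vs n.+1 s (op 8 m))
  end.

(** The variables vs list the positions of the values on the stack. Only the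
    interpretation of T by the empty predicate matters. *)
Fixpoint code (vs : seq nat) (f : form) : nat :=
  match f with
  | Eq s t => push vs 0 t (push vs 1 s (op_var 0))
  | Tr t => op_and 0 (op_neg 0)
  | Neg g => op_neg (code vs g)
  | And g h => op_and (code vs g) (code vs h)
  | Or g h => op_or (code vs g) (code vs h)
  | Ex x g => op_ex (code (x :: vs) g) (code (x :: vs) g)
  | All x g => op2 2 (op_neg (code (x :: vs) g)) (op_neg (code (x :: vs) g))
  end.

(** The clauses of satisfaction, for P m y read as truth of the formula m of the stack
    y. They hold for satisfaction in a model as well as for the model that is built
    from a diagram. *)
Record stack_semantics (X : structure) (stk : X -> X -> X) (P : nat -> X -> Prop) : Prop := {
  ss_nand : forall m m' y, P (op2 1 m m') y <-> ~ (P m y /\ P m' y);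
  ss_ex : forall m m' y, P (op2 2 m m') y <-> ~ exists a, P m (stk a y) /\ P m' (stk a y);
  ss_eq : forall a b y, P (op2 3 0 0) (stk a (stk b y)) <-> ~ a = b;
  ss_drop : forall m a b y, P (op2 4 m m) (stk a (stk b y)) <-> ~ P m (stk a y);
  ss_zero : forall m y, P (op2 5 m m) y <-> ~ P m (stk s0 y);
  ss_succ : forall m a y, P (op2 6 m m) (stk a y) <-> ~ P m (stk (sS a) y);
  ss_add : forall m a b y, P (op2 7 m m) (stk a (stk b y)) <-> ~ P m (stk (a + b) y);
  ss_mul : forall m a b y, P (op2 8 m m) (stk a (stk b y)) <-> ~ P m (stk (a * b) y) }.

Section Code.
Variables (X : structure) (stk : X -> X -> X) (P : nat -> X -> Prop).
Hypothesis H : stack_semantics stk P.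
Implicit Types (m : nat) (a y : X) (l : seq X) (e : nat -> X).

Lemma P_neg m y : P (op_neg m) y <-> ~ P m y.
Proof. by rewrite /op_neg (ss_nand H); split=> h h'; apply: h; [|case: h']. Qed.

Lemma P_and m m' y : P (op_and m m') y <-> P m y /\ P m' y.
Proof. by rewrite /op_and P_neg (ss_nand H); split=> [/NNPP|h]; [|apply]. Qed.

Lemma P_or m m' y : P (op_or m m') y <-> P m y \/ P m' y.
Proof.
rewrite /op_or (ss_nand H) !P_neg; split=> [h|[h|h] []//].
by apply: NNPP => h'; apply: h; split=> h''; apply: h'; [left|right].
Qed.

Lemma P_ex m m' y : P (op_ex m m') y <-> exists a, P m (stk a y) /\ P m' (stk a y).
Proof. by rewrite /op_ex P_neg (ss_ex H); split=> [/NNPP|h]; [|apply]. Qed.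

Definition stack l y : X := foldr stk y l.

Lemma P_var n a l y : (n < size l)%N ->
  (P (op_var n) (stk a (stack l y)) <-> a = nth s0 l n).
Proof.
elim: n l => [|n IH] [|b l] //= hn.
  by rewrite /op_var /= P_neg (ss_eq H); split=> [/NNPP|->] //; apply.
by rewrite -[op_var _]/(op 4 (op_var n)) /op P_neg (ss_drop H) -(IH l) //; split=> [/NNPP|h]; [|apply].
Qed.

Lemma P_push vs n t m l y e :
  {in tvars t, forall x, (n + index x vs < size l)%N /\ e x = nth s0 l (n + index x vs)%N} ->
  (P (push vs n t m) (stack l y) <-> P m (stk (eval e t) (stack l y))).
Proof.
have Dn Q : ~ ~ Q <-> Q by split=> [/NNPP|h]; [|apply].
elim: t n m l => /= [x||t IH|t IHt u IHu|t IHt u IHu] n m l h.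
- have [h1 h2] := h x (mem_head _ _); rewrite P_ex h2; split=> [[a []]|hm].
    by rewrite P_var // => ->.
  by exists (nth s0 l (n + index x vs)); rewrite P_var.
- by rewrite /op P_neg (ss_zero H) Dn.
- by rewrite IH // /op P_neg (ss_succ H) Dn.
- rewrite IHu; last by move=> x hx; apply: h; rewrite mem_cat hx orbT.
  rewrite -[stk _ _]/(stack (eval e u :: l) y) IHt.
    by rewrite /op P_neg (ss_add H) Dn.
  by move=> x hx; rewrite /= addSn ltnS; apply: h; rewrite mem_cat hx.
- rewrite IHu; last by move=> x hx; apply: h; rewrite mem_cat hx orbT.
  rewrite -[stk _ _]/(stack (eval e u :: l) y) IHt.
    by rewrite /op P_neg (ss_mul H) Dn.
  by move=> x hx; rewrite /= addSn ltnS; apply: h; rewrite mem_cat hx.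
Qed.

(** Induction on f; the term evaluations of [push] reduce atomic formulas to the
    equality of the two top values. *)
Lemma P_code vs f l y e :
  {in fv f, forall x, (index x vs < size l)%N /\ e x = nth s0 l (index x vs)} ->
  (P (code vs f) (stack l y) <-> sat (fun=> False) e f).
Proof.
have Q x g vs' l' e' a : {in [seq z <- fv g | z != x],
      forall z, (index z vs' < size l')%N /\ e' z = nth s0 l' (index z vs')} ->
    {in fv g, forall z, (index z (x :: vs') < size (a :: l'))%N /\
      upd e' x a z = nth s0 (a :: l') (index z (x :: vs'))}.
  move=> h z hz /=; rewrite /upd (eq_sym x); case: eqP => //= /eqP ne.
  by rewrite ltnS; apply: h; rewrite mem_filter ne.
elim: f vs l e => /= [s t|t|f IH|f IHf g IHg|f IHf g IHg|x f IH|x f IH] vs l e h.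
- rewrite (@P_push _ _ _ _ _ _ e); last by move=> x hx; apply: h; rewrite mem_cat hx orbT.
  rewrite -[stk _ _]/(stack (eval e t :: l) y) (@P_push _ _ _ _ _ _ e).
    by rewrite P_var.
  by move=> x hx /=; rewrite ltnS; apply: h; rewrite mem_cat hx.
- by rewrite P_and P_neg; split=> [[]|].
- by rewrite P_neg (IH _ _ e).
- rewrite P_and (IHf _ _ e) ?(IHg _ _ e) // => x hx; apply: h; rewrite mem_cat hx ?orbT //.
- rewrite P_or (IHf _ _ e) ?(IHg _ _ e) // => x hx; apply: h; rewrite mem_cat hx ?orbT //.
- have E a := IH (x :: vs) (a :: l) (upd e x a) (Q x f vs l e a h).
  by rewrite P_ex; split=> [[a [/E]]|[a /E]]; exists a.
- have E a := IH (x :: vs) (a :: l) (upd e x a) (Q x f vs l e a h).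
  rewrite (ss_ex H); split=> [h' a|h' [a []]]; last by rewrite P_neg; case; apply/E.
  by apply/E; apply: NNPP => hn; apply: h'; exists a; rewrite !P_neg.
Qed.

End Code.

(** * Henkin diagrams *)

(** In a diagram, fm stands for formulas and the other abbreviations for names: of
    pairs, sums, products, numbers, and the Henkin witness for the formula x of the
    element named y. [eqn_ E a b] says that E takes the names a and b to be equal:
    the formula with move 3 is true of a stack iff its two top values differ. *)
Notation fm i m m' := (pr (nm i) (pr m m')).
Notation st a b := (pr (nm 1) (pr a b)).
Notation ad a b := (pr (nm 2) (pr a b)).
Notation ml a b := (pr (nm 3) (pr a b)).
Notation nn k := (pr (nm 4) k).
Notation hk x y := (pr (nm 5) (pr x y)).
Notation suc a := (ad a (nn (nm 1))).
Notation zr := (nn s0).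
Notation eqn_ E a b := (~ E (pr (fm 3 s0 s0) (st a (st b s0)))).

(** The conditions on a set E, with elements <x, c> meaning that the formula x is true
    of the element named c. No condition has a quantifier, so they are preserved by
    limits; [dg_henkin] serves instead, which names a witness for every existential
    formula. The hypothesis of [dg_ind] is a formula that expresses the induction
    step, so a failure of the step would be witnessed by a name. *)
Record diagram (M : structure) (E : M -> Prop) (v m m' a b c : M) : Prop := Diagram {
  dg_nand : E (pr (fm 1 m m') a) <-> ~ (E (pr m a) /\ E (pr m' a));
  dg_ex : E (pr m (st b a)) /\ E (pr m' (st b a)) -> ~ E (pr (fm 2 m m') a);
  dg_henkin : ~ E (pr (fm 2 m m') a) ->
    E (pr m (st (hk (fm 2 m m') a) a)) /\ E (pr m' (st (hk (fm 2 m m') a) a));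
  dg_eq : E (pr (fm 3 s0 s0) (st a (st b c))) <-> ~ eqn_ E a b;
  dg_drop : E (pr (fm 4 m m) (st a (st b c))) <-> ~ E (pr m (st a c));
  dg_zero : E (pr (fm 5 m m) a) <-> ~ E (pr m (st zr a));
  dg_succ : E (pr (fm 6 m m) (st a c)) <-> ~ E (pr m (st (suc a) c));
  dg_add : E (pr (fm 7 m m) (st a (st b c))) <-> ~ E (pr m (st (ad a b) c));
  dg_mul : E (pr (fm 8 m m) (st a (st b c))) <-> ~ E (pr m (st (ml a b) c));
  dg_refl : eqn_ E a a;
  dg_sym : eqn_ E a b -> eqn_ E b a;
  dg_trans : eqn_ E a b -> eqn_ E b c -> eqn_ E a c;
  dg_st1 : eqn_ E a b -> eqn_ E (st a c) (st b c);
  dg_st2 : eqn_ E a b -> eqn_ E (st c a) (st c b);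
  dg_ad1 : eqn_ E a b -> eqn_ E (ad a c) (ad b c);
  dg_ad2 : eqn_ E a b -> eqn_ E (ad c a) (ad c b);
  dg_ml1 : eqn_ E a b -> eqn_ E (ml a c) (ml b c);
  dg_ml2 : eqn_ E a b -> eqn_ E (ml c a) (ml c b);
  dg_subst : eqn_ E a b -> E (pr m a) -> E (pr m b);
  dg_S0 : ~ eqn_ E (suc a) zr;
  dg_SI : eqn_ E (suc a) (suc b) -> eqn_ E a b;
  dg_A0 : eqn_ E (ad a zr) a;
  dg_AS : eqn_ E (ad a (suc b)) (suc (ad a b));
  dg_M0 : eqn_ E (ml a zr) zr;
  dg_MS : eqn_ E (ml a (suc b)) (ad (ml a b) a);
  dg_num : eqn_ E (nn (sS b)) (suc (nn b));
  dg_ind : E (pr (fm 2 m (fm 6 m m)) a) -> E (pr m (st zr a)) -> E (pr m (st b a));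
  dg_false : ~ E (pr v (st (nn v) s0)) }.

Lemma rp_equiv (M : structure) (T : M -> Prop) k e f (P Q : Prop) :
  (P <-> Q) -> rp T k e f Q -> rp T k e f P.
Proof. by move=> E h k' e' h'; rewrite E; apply: h h'. Qed.

(** Finite sets satisfy the conditions for all parameters up to any bound. This is
    the formula to be diagonalized, with v as its only free variable. *)
Definition approximable (M : structure) (v : M) : Prop :=
  forall N, exists b c d, forall x1 x2 x3 x4 x5,
    x1 <= N -> x2 <= N -> x3 <= N -> x4 <= N -> x5 <= N ->
    diagram (coded b c d) v x1 x2 x3 x4 x5.

(** Turns a diagram into a conjunction, for which a formula can be found. *)
Ltac diagram_conj :=
  split; [ intros [h1 h2 h3 h4 h5 h6 h7 h8 h9 h10 h11 h12 h13 h14 h15 h16 h17 h18 h19 h20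
                   h21 h22 h23 h24 h25 h26 h27 h28];
           exact (conj h1 (conj h2 (conj h3 (conj h4 (conj h5 (conj h6 (conj h7 (conj h8
             (conj h9 (conj h10 (conj h11 (conj h12 (conj h13 (conj h14 (conj h15 (conj h16
             (conj h17 (conj h18 (conj h19 (conj h20 (conj h21 (conj h22 (conj h23 (conj h24
             (conj h25 (conj h26 (conj h27 h28)))))))))))))))))))))))))))
         | intros; repeat match goal with H : _ /\ _ |- _ => destruct H end;
           constructor; assumption ].
#[local] Hint Extern 0 (rp _ _ _ _ (diagram _ _ _ _ _ _ _)) =>
  (eapply rp_equiv; [diagram_conj | rp_solve]) : rp_db.

Fixpoint quantifier_free (f : form) : bool :=
  match f with
  | Eq _ _ | Tr _ => true
  | Neg g => quantifier_free g
  | And g h | Or g h => quantifier_free g && quantifier_free h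
  | Ex _ _ | All _ _ => false
  end.

Lemma diagram_form : exists2 f, quantifier_free f &
  forall (M : structure) (E : M -> Prop) v m m' a b c,
    sat E (nth s0 [:: v; m; m'; a; b; c]) f <-> diagram E v m m' a b c.
Proof.
eexists; last first.
  by move=> M E v m m' a b c; apply: (rp_sat (k := 6)); rp_solve.
by vm_compute.
Qed.

Lemma approximable_form : exists f,
  [/\ arithmetical f, [seq y <- fv f | y != 0] = [::] &
      forall (M : structure) (T : M -> Prop) e, sat T e f <-> approximable (e 0)].
Proof.
eexists; split; last first.
  by move=> M T e; apply: (rp_sat (k := 1)); rewrite /approximable; rp_solve.
all: by vm_compute.
Qed.

(** * Naming elements *)

Section Names.
Context {M : structure} {HM : pa_model M} {S : M -> Prop}.
Hypothesis HI : full_induction S.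
Implicit Types (a b c d n u w x y z : M) (F G : M -> Prop).

(** a witnesses that y, a negated existential formula, is false of r. *)
Definition witness y r a : Prop :=
  exists m m', y = fm 2 m m' /\ S (pr m (pr a r)) /\ S (pr m' (pr a r)).

(** a may be the element with name x, if F gives the elements with smaller names. *)
Definition naming F x a : Prop :=
  (forall u w, x = st u w -> exists u' w', F (pr u u') /\ F (pr w w') /\ a = pr u' w')
  /\ (forall u w, x = ad u w -> exists u' w', F (pr u u') /\ F (pr w w') /\ a = u' + w')
  /\ (forall u w, x = ml u w -> exists u' w', F (pr u u') /\ F (pr w w') /\ a = u' * w')
  /\ (forall k, x = nn k -> a = k)
  /\ (forall y u, x = hk y u -> exists u', F (pr u u') /\
        ((exists a', witness y u' a') -> witness y u' a)).

Definition names n F : Prop :=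
  (forall x, x < n -> exists a, F (pr x a))
  /\ (forall x a a', F (pr x a) -> F (pr x a') -> a = a')
  /\ (forall x a, F (pr x a) -> x < n /\ naming F x a).

Lemma naming_mono F G x a : (forall z, F z -> G z) -> naming F x a -> naming G x a.
Proof.
move=> h [h1 [h2 [h3 [h4 h5]]]]; split; [|split; [|split; [|split]]] => //.
- by move=> u w /h1[u' [w' [/h f1 [/h f2 E]]]]; exists u', w'.
- by move=> u w /h2[u' [w' [/h f1 [/h f2 E]]]]; exists u', w'.
- by move=> u w /h3[u' [w' [/h f1 [/h f2 E]]]]; exists u', w'.
- by move=> y u /h5[u' [/h f1 E]]; exists u'.
Qed.

Lemma naming_exists n F : (forall x, x < n -> exists a, F (pr x a)) ->
  exists a, naming F n a.
Proof.
move=> tot.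
have two i u w : n = pr (nm i.+1) (pr u w) -> exists u' w', F (pr u u') /\ F (pr w w').
  move=> E; have [u' hu'] : exists a, F (pr u a) by apply: tot; rewrite E; apply: pr_sub1.
  have [w' hw'] : exists a, F (pr w a) by apply: tot; rewrite E; apply: pr_sub2.
  by exists u', w'.
case: (classic (exists u w, n = st u w)) => [[u [w E]]|n1].
  have [u' [w' [hu hw]]] := two _ _ _ E; exists (pr u' w').
  by split; [|split; [|split; [|split]]] => *; subst n; code_inv; exists u', w'.
case: (classic (exists u w, n = ad u w)) => [[u [w E]]|n2].
  have [u' [w' [hu hw]]] := two _ _ _ E; exists (u' + w').
  by split; [|split; [|split; [|split]]] => *; subst n; code_inv; exists u', w'.
case: (classic (exists u w, n = ml u w)) => [[u [w E]]|n3].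
  have [u' [w' [hu hw]]] := two _ _ _ E; exists (u' * w').
  by split; [|split; [|split; [|split]]] => *; subst n; code_inv; exists u', w'.
case: (classic (exists k, n = nn k)) => [[k E]|n4].
  by exists k; split; [|split; [|split; [|split]]] => *; subst n; code_inv.
case: (classic (exists y u, n = hk y u)) => [[y [u E]]|n5].
  have [_ [u' [_ hu]]] := two _ _ _ E.
  have [a ha] : exists a, (exists a', witness y u' a') -> witness y u' a.
    by case: (classic (exists a', witness y u' a')) => [[a ha]|h]; [exists a|exists s0].
  by exists a; split; [|split; [|split; [|split]]] => *; subst n; code_inv; exists u'.
exists s0; split; [|split; [|split; [|split]]] => *.
- by case: n1; eauto.
- by case: n2; eauto.
- by case: n3; eauto.
- by case: n4; eauto.
- by case: n5; eauto.
Qed.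

(** Recursion in the model: the finite table of names is extended by one value at a
    time. The induction formula mentions S, the satisfaction predicate. *)
Lemma names_exist n : exists b c d, names n (coded b c d).
Proof.
move: n; apply: (full_ind HI).
- by rewrite /names /naming /witness; definable_with (@nil M).
- have [c [d h]] : exists c d, forall y, coded s0 c d y <-> (y <= s0 /\ ~ y = y).
    by apply: arith_comprehension => T d; definable_with ([:: d] : seq M).
  exists s0, c, d; split; first by move=> x /not_lt0.
  by split=> [x a a' /h[_]|x a /h[_]].
move=> n [b [c [d [tot [fn nam]]]]]; have [a ha] := naming_exists tot.
pose P z := coded b c d z \/ z = pr n a.
have [c' [d' cd]] : exists c' d', forall y, coded (b + pr n a) c' d' y <-> (y <= b + pr n a /\ P y).
  by apply: arith_comprehension => T d'; rewrite /P;
     definable_with ([:: b; c; d; n; a; d'] : seq M).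
have {}cd y : coded (b + pr n a) c' d' y <-> P y.
  rewrite cd; split=> [[]//|hy]; split=> //; case: hy => [[hy _]|->]; last exact: le_addl.
  by apply: le_trans hy _; apply: le_addr.
exists (b + pr n a), c', d'; split; [|split].
- move=> x /lt_S_le /le_eq_or_lt [->|/tot[a' ha']]; first by exists a; apply/cd; right.
  by exists a'; apply/cd; left.
- move=> x a1 a2 /cd[h1|/pr_inj[-> ->]] /cd[h2|/pr_inj[E ->]] //.
  + exact: fn h1 h2.
  + by rewrite E in h1; case: (nam _ _ h1) => /lt_irrefl.
  + by case: (nam _ _ h2) => /lt_irrefl.
- move=> x a1 /cd[/nam[h1 h2]|/pr_inj[-> ->]].
    split; first by apply: lt_le_trans h1 _; apply/lt_le/lt_S.
    by apply: naming_mono h2 => z hz; apply/cd; left.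
  by split; [apply: lt_S|apply: naming_mono ha => z hz; apply/cd; left].
Qed.

Record diagram_to (B : M) (nu : M -> M) (E : M -> Prop) : Prop := {
  nu_st : forall u w, st u w <= B -> nu (st u w) = pr (nu u) (nu w);
  nu_ad : forall u w, ad u w <= B -> nu (ad u w) = nu u + nu w;
  nu_ml : forall u w, ml u w <= B -> nu (ml u w) = nu u * nu w;
  nu_nn : forall k, nn k <= B -> nu (nn k) = k;
  nu_hk : forall y u, hk y u <= B -> (exists a, witness y (nu u) a) ->
    witness y (nu u) (nu (hk y u));
  nu_E : forall x u, pr x u <= B -> (E (pr x u) <-> S (pr x (nu u))) }.

(** As full induction for S yields comprehension for S, the diagram up to B is coded by
    an element of the model. *)
Lemma diagram_to_exists B : exists nu b c d, diagram_to B nu (coded b c d).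
Proof.
have [b [c [d [tot [fn nam]]]]] := names_exist (sS B).
pose F := coded b c d.
pose nu x := epsilon (inhabits x) (fun a => F (pr x a)).
have nuP x : x <= B -> F (pr x (nu x)).
  move=> /le_lt_S /tot h; exact: (epsilon_spec (inhabits x) (fun a => F (pr x a)) h).
have nuE x a : F (pr x a) -> nu x = a.
  by move=> h; apply: fn (h); apply: nuP; have [/lt_S_le] := nam _ _ h.
pose P z := exists x u a, z = pr x u /\ F (pr u a) /\ S (pr x a).
have [c' [d' cd]] : exists c' d', forall y, coded B c' d' y <-> (y <= B /\ P y).
  by apply: (comprehension HI) => d'; rewrite /P /F;
     definable_with ([:: B; b; c; d; d'] : seq M).
have nuN x : x <= B -> naming F x (nu x) by move=> /nuP /nam[].
exists nu, B, c', d'; split.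
- by move=> u w /nuN[h _]; have [u' [w' [/nuE-> [/nuE-> ->]]]] := h u w erefl.
- by move=> u w /nuN[_ [h _]]; have [u' [w' [/nuE-> [/nuE-> ->]]]] := h u w erefl.
- by move=> u w /nuN[_ [_ [h _]]]; have [u' [w' [/nuE-> [/nuE-> ->]]]] := h u w erefl.
- by move=> k /nuN[_ [_ [_ [h _]]]]; apply: h.
- by move=> y u /nuN[_ [_ [_ [_ h]]]]; have [u' [/nuE-> ]] := h y u erefl.
- move=> x u hx; rewrite cd; split=> [[_ [x' [u' [a [/pr_inj[-> ->] [/nuE-> //]]]]]]|h].
  split=> //; exists x, u, (nu u); split=> //; split=> //; apply: nuP.
  by apply: le_trans hx; apply: le_pr2.
Qed.

End Names.

(** * Diagrams inside a model with a satisfaction class *)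

Section Approximation.
Context {M : structure} {HM : pa_model M}.
Variable S : M -> Prop.
Hypothesis HS : forall x y, S (pr x y) <-> ~ refuted S x y.
Implicit Types (a b c d m n u w x y z : M).

Lemma S_true z : S (pr s0 z).
Proof.
apply/HS => -[i [m [m' [w [E _]]]]].
by apply: (@not_lt0 M HM (pr m m')); rewrite E; apply: lt_pr2.
Qed.

Lemma S_op k m m' y : S (pr (fm k.+1 m m') y) <->
  ~ exists z, move_ (nm k.+1) y z /\ S (pr m z) /\ S (pr m' z).
Proof.
rewrite HS; split=> h [].
  by move=> z [h1 [h2 h3]]; apply: h; exists (nm k), m, m', z.
by move=> i [m1 [m1' [z [/pr_inj[E /pr_inj[<- <-]] [h1 [h2 h3]]]]]]; apply: h; exists z; rewrite E.
Qed.

(** A formula built by a functional move is evaluated at the only successor. *)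
Lemma S_det k y z0 m m' : (forall z, move_ (nm k.+1) y z <-> z = z0) ->
  (S (pr (fm k.+1 m m') y) <-> ~ (S (pr m z0) /\ S (pr m' z0))).
Proof.
move=> hz; rewrite S_op; split=> h; first by move=> h'; apply: h; exists z0; rewrite hz.
by move=> [z []]; rewrite hz => ->.
Qed.

Ltac move_inv := split; [let h := fresh in intro h; unfold move_ in h; code_inv; done
  |intros ->; unfold move_].

Lemma S_nand m m' y : S (pr (fm 1 m m') y) <-> ~ (S (pr m y) /\ S (pr m' y)).
Proof. by apply: S_det => z; move_inv; left. Qed.

Lemma S_ex m m' y : S (pr (fm 2 m m') y) <->
  ~ exists a, S (pr m (pr a y)) /\ S (pr m' (pr a y)).
Proof.
rewrite S_op; split=> h [].
  move=> a ha; apply: h; exists (pr a y); split=> //.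
  by rewrite /move_; right; left; split=> //; exists a.
move=> z [hm hz]; apply: h; rewrite /move_ in hm; code_inv; eauto.
Qed.

Lemma S_eq a b y : S (pr (fm 3 s0 s0) (pr a (pr b y))) <-> ~ a = b.
Proof.
rewrite S_op; split=> h.
  move=> E; apply: h; exists (pr a (pr b y)); split; last by split; apply: S_true.
  by rewrite /move_; do 2 right; left; do 2 split=> //; exists a, y; rewrite E.
by move=> [z [hm _]]; apply: h; rewrite /move_ in hm; code_inv.
Qed.

Lemma S_unary k y z0 m : (forall z, move_ (nm k.+1) y z <-> z = z0) ->
  (S (pr (fm k.+1 m m) y) <-> ~ S (pr m z0)).
Proof. by move=> /S_det->; split=> h h'; apply: h; [|case: h']. Qed.

Lemma S_drop m a b y : S (pr (fm 4 m m) (pr a (pr b y))) <-> ~ S (pr m (pr a y)).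
Proof. by apply: S_unary => z; move_inv; do 3 right; left; split=> //; exists a, b, y. Qed.

Lemma S_zero m y : S (pr (fm 5 m m) y) <-> ~ S (pr m (pr s0 y)).
Proof. by apply: S_unary => z; move_inv; do 4 right; left. Qed.

Lemma S_succ m a y : S (pr (fm 6 m m) (pr a y)) <-> ~ S (pr m (pr (sS a) y)).
Proof. by apply: S_unary => z; move_inv; do 5 right; left; split=> //; exists a, y. Qed.

Lemma S_add m a b y : S (pr (fm 7 m m) (pr a (pr b y))) <-> ~ S (pr m (pr (a + b) y)).
Proof. by apply: S_unary => z; move_inv; do 6 right; left; split=> //; exists a, b, y. Qed.

Lemma S_mul m a b y : S (pr (fm 8 m m) (pr a (pr b y))) <-> ~ S (pr m (pr (a * b) y)).
Proof. by apply: S_unary => z; move_inv; do 7 right; split=> //; exists a, b, y. Qed.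

(** Standard codes are mapped to codes in the model, since pairing is a polynomial. *)
Lemma nm_add (i j : nat) : nm (i + j)%N = nm i + nm j :> M.
Proof. by elim: j => [|j IH]; rewrite ?addn0 ?q_A0 // addnS nmS IH -q_AS. Qed.

Lemma nm_mul i j : nm (i * j)%N = nm i * nm j :> M.
Proof. by elim: j => [|j IH]; rewrite ?muln0 ?q_M0 // mulnS addnC nm_add IH -q_MS. Qed.

Lemma nm_pr i j : nm (@pr nat_str i j) = pr (nm i) (nm j) :> M.
Proof. by rewrite /pr -!nm_add -!nm_mul -nm_add. Qed.

Lemma nm_op2 i j k : nm (op2 i j k) = fm i (nm j) (nm k) :> M.
Proof. by rewrite /op2 !nm_pr. Qed.

Lemma model_semantics : stack_semantics (@pr M) (fun (k : nat) y => S (pr (nm k) y)).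
Proof.
split=> *; rewrite nm_op2.
- exact: S_nand.
- exact: S_ex.
- exact: S_eq.
- exact: S_drop.
- exact: S_zero.
- exact: S_succ.
- exact: S_add.
- exact: S_mul.
Qed.

Lemma class_code (f : form) (e : nat -> M) y : [seq z <- fv f | z != 0] = [::] ->
  (S (pr (nm (code [:: 0] f)) (pr (e 0) y)) <-> sat (fun=> False) e f).
Proof.
move=> hf; apply: (P_code model_semantics (l := [:: e 0])) => z hz.
have [->//|ne] := eqVneq z 0.
have : z \in [seq z <- fv f | z != 0] by rewrite mem_filter ne.
by rewrite hf.
Qed.

Section Bounds.
Variable N : M.

(* pr x x bounds every pair with entries at most x *)
(** The bounds up to which names and formulas have to be interpreted are handled by
    counting nested pairs. *)
Definition tower (k : nat) : car M := iter k (fun x => pr x x) N.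

Lemma tower_up k x : x <= tower k -> x <= tower k.+1.
Proof. by move=> h; apply: le_trans h (le_pr1 _ _). Qed.

Lemma tower_0 k x : x <= N -> x <= tower k.
Proof. by move=> h; elim: k => //= k; apply: tower_up. Qed.

Lemma tower_pr k x y : x <= tower k -> y <= tower k -> pr x y <= tower k.+1.
Proof. by move=> h1 h2; apply: le_pr. Qed.

End Bounds.

Hypothesis HI : forall N, exists S' : M -> Prop, full_induction S' /\
  forall x y, x < N -> (S' (pr x y) <-> S (pr x y)).

(** Every condition on a diagram follows from the corresponding clause of
    satisfaction and the interpretation of the names. *)
Lemma class_approximable v : (forall y, ~ S (pr v (pr v y))) -> approximable v.
Proof.
move=> hv N; pose N0 := N + v + nm 8.
have leN x : x <= N -> x <= N0.
  by move=> h; apply: le_trans h _; apply: le_trans (le_addr _ _) (le_addr _ _).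
have lev : v <= N0 by apply: le_trans (le_addl _ N) (le_addr _ _).
have len k : (k <= 8)%N -> nm k <= N0.
  by move=> hk; apply: le_trans (le_addl _ _); exists (nm (8 - k)%N); rewrite -nm_add subnK.
(* no formula or name in a condition nests more than 12 pairs *)
pose B := tower N0 12.
have [S' [HS' SS]] := HI (sS B).
have [nu [b [c [d D]]]] := @diagram_to_exists M HM S' HS' B.
set E := coded b c d in D.
have E1 x u : pr x u <= B -> (E (pr x u) <-> S (pr x (nu u))).
  by move=> h; rewrite (nu_E D) // SS //; apply/le_lt_S; apply: le_trans h; apply: le_pr1.
have leS x : x <= N -> sS x <= N0.
  move=> h; rewrite S_one; apply: le_add; first by apply: le_trans h (le_addr _ _).
  by exists (nm 7); rewrite -nm_add.
exists b, c, d => x1 x2 x3 x4 x5 /leN h1 /leN h2 /leN h3 h4' /leN h5.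
have h4 := leN _ h4'; have {}h4' := leS _ h4'.
have len0 : s0 <= N0 by apply: le_0.
have t0 := @tower_0 N0; have tp := @tower_pr N0.
have ln1 := len 1 isT; have ln2 := len 2 isT; have ln3 := len 3 isT; have ln4 := len 4 isT.
have ln5 := len 5 isT; have ln6 := len 6 isT; have ln7 := len 7 isT; have ln8 := len 8 isT.
Ltac bound := solve [assumption | apply: tower_0; assumption | apply: tower_pr; bound].
have Est u w : st u w <= B -> nu (st u w) = pr (nu u) (nu w) := @nu_st _ _ _ _ _ D u w.
have Ead u w : ad u w <= B -> nu (ad u w) = nu u + nu w := @nu_ad _ _ _ _ _ D u w.
have Eml u w : ml u w <= B -> nu (ml u w) = nu u * nu w := @nu_ml _ _ _ _ _ D u w.
have Enn k : nn k <= B -> nu (nn k) = k := @nu_nn _ _ _ _ _ D k.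
have Esuc u : suc u <= B -> nu (suc u) = sS (nu u).
  by move=> h; rewrite Ead // Enn ?q_AS ?q_A0 //; apply: le_trans h;
     apply: le_trans (le_pr2 _ _) (le_pr2 _ _).
have EQ u w : pr (fm 3 s0 s0) (st u (st w s0)) <= B -> (eqn_ E u w <-> nu u = nu w).
  move=> h; have h1' : st u (st w s0) <= B by apply: le_trans h; apply: le_pr2.
  have h2' : st w s0 <= B.
    by apply: le_trans h1'; apply: le_trans (le_pr2 _ _) (le_pr2 _ _).
  by rewrite E1 // !Est // S_eq; split=> [/NNPP|E' h']; [|apply: h'].
rewrite -/E; split.
- rewrite !E1; [exact: S_nand|bound..].
- rewrite !E1; try bound; rewrite !Est; try bound.
  by move=> hh; rewrite S_ex; apply; exists (nu x4).
- rewrite !E1; try bound; rewrite !Est; try bound.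
  rewrite S_ex => /NNPP hex.
  have [||m [m' [/pr_inj[_ /pr_inj[<- <-]]]]] := @nu_hk _ _ _ _ _ D (fm 2 x1 x2) x3.
  + bound.
  + have [a [ha1 ha2]] := hex; exists a, x1, x2; rewrite !SS //; apply: le_lt_S; bound.
  + by rewrite !SS //; apply: le_lt_S; bound.
- rewrite EQ; try bound; rewrite E1; try bound; rewrite !Est; try bound; exact: S_eq.
- rewrite !E1; try bound; rewrite !Est; try bound; exact: S_drop.
- rewrite !E1; try bound; rewrite !Est; try bound; rewrite Enn; try bound; exact: S_zero.
- rewrite !E1; try bound; rewrite !Est; try bound; rewrite Esuc; try bound; exact: S_succ.
- rewrite !E1; try bound; rewrite !Est; try bound; rewrite Ead; try bound; exact: S_add.
- rewrite !E1; try bound; rewrite !Est; try bound; rewrite Eml; try bound; exact: S_mul.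
- by rewrite EQ; [|bound].
- by rewrite !EQ; [|bound..].
- by rewrite !EQ; [move=> -> ->|bound..].
- by rewrite !EQ; try bound; rewrite !Est; try bound; move=> ->.
- by rewrite !EQ; try bound; rewrite !Est; try bound; move=> ->.
- by rewrite !EQ; try bound; rewrite !Ead; try bound; move=> ->.
- by rewrite !EQ; try bound; rewrite !Ead; try bound; move=> ->.
- by rewrite !EQ; try bound; rewrite !Eml; try bound; move=> ->.
- by rewrite !EQ; try bound; rewrite !Eml; try bound; move=> ->.
- by rewrite EQ; try bound; rewrite !E1; try bound; move=> ->.
- rewrite EQ; try bound; rewrite Esuc; try bound; rewrite Enn; try bound; exact: q_S0.
- rewrite !EQ; try bound; rewrite !Esuc; try bound; exact: q_SI.
- rewrite EQ; try bound; rewrite Ead; try bound; rewrite Enn; try bound; exact: q_A0.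
- rewrite EQ; try bound; rewrite Ead; try bound; rewrite !Esuc; try bound.
  rewrite Ead; try bound; exact: q_AS.
- rewrite EQ; try bound; rewrite Eml; try bound; rewrite Enn; try bound; exact: q_M0.
- rewrite EQ; try bound; rewrite Eml; try bound; rewrite Esuc; try bound.
  rewrite Ead; try bound; rewrite Eml; try bound; exact: q_MS.
- by rewrite EQ; try bound; rewrite Esuc; try bound; rewrite !Enn; try bound.
- rewrite !E1; try bound; rewrite !Est; try bound; rewrite Enn; try bound.
  rewrite S_ex => hn hz.
  rewrite -SS; last by apply: le_lt_S; bound.
  have {}hz : S' (pr x1 (pr s0 (nu x3))) by rewrite SS //; apply: le_lt_S; bound.
  apply: (full_ind (P := fun a => S' (pr x1 (pr a (nu x3)))) HS') => // [|a].
    by definable_with ([:: x1; nu x3] : seq M).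
  rewrite !SS; try (apply: le_lt_S; bound).
  by move=> ha; apply: NNPP => hSa; apply: hn; exists a; rewrite S_succ.
- by rewrite E1; try bound; rewrite Est; try bound; rewrite Enn; try bound.
Qed.

End Approximation.

(** * The model of a diagram *)

Lemma nat_model : pa_model nat_str.
Proof.
split=> //=; try exact: addn0; try exact: addnS; try exact: muln0.
- by move=> a b [].
- by move=> a b; rewrite mulnS addnC.
exists (fun=> False) => f x e h0 hS; elim=> [|a IH]; [exact: h0|exact: hS].
Qed.

(** Koenig's lemma for the binary tree: an initial segment that agrees with
    arbitrarily late sets can be prolonged. *)
Lemma limit_set (E : nat -> nat -> Prop) : exists E0 : nat -> Prop, forall L N,
  exists2 n, (N <= n)%N & forall z, (z < L)%N -> (E n z <-> E0 z).
Proof.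
pose ok (l : seq bool) := forall N, exists2 n, (N <= n)%N &
  forall z, (z < size l)%N -> (E n z <-> nth false l z).
have split_ok l : ok l -> ok (rcons l true) \/ ok (rcons l false).
  move=> h; apply: NNPP => /not_or_and[/not_all_ex_not[N1 h1] /not_all_ex_not[N2 h2]].
  have [n hn hl] := h (maxn N1 N2); move: hn; rewrite geq_max => /andP[n1 n2].
  have ext (b : bool) : (E n (size l) <-> b) -> forall z, (z < size (rcons l b))%N ->
      (E n z <-> nth false (rcons l b) z).
    move=> hb z; rewrite size_rcons ltnS leq_eqVlt nth_rcons => /orP[/eqP->|hz].
      by rewrite ltnn eqxx.
    by rewrite hz; apply: hl.
  case: (classic (E n (size l))) => hE.
    by apply: h1; exists n => //; apply: ext.
  by apply: h2; exists n => //; apply: ext.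
pose next l := rcons l (if excluded_middle_informative (ok (rcons l true)) then true else false).
pose stage n := iter n next [::].
have size_stage n : size (stage n) = n by elim: n => //= n IH; rewrite size_rcons IH.
have ok_stage n : ok (stage n).
  elim: n => [|n IH] /=; first by move=> N; exists N.
  by rewrite /next; case: excluded_middle_informative => //; case: (split_ok _ IH).
have stageE z n : (z < n)%N -> nth false (stage n) z = nth false (stage z.+1) z.
  elim: n => // n IH; rewrite ltnS leq_eqVlt => /orP[/eqP->//|hz].
  by rewrite -IH //= nth_rcons size_stage hz.
exists (fun z => nth false (stage z.+1) z) => L N.
have [n hn h] := ok_stage L N; exists n => // z hz.
by rewrite -(stageE z L) // h ?size_stage.
Qed.

(** A quantifier-free condition only looks at finitely many elements of a set. *)
Lemma local_qf (f : form) (e : nat -> nat_str) : quantifier_free f ->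
  exists L, forall E E' : nat_str -> Prop, (forall z : nat, (z < L)%N -> (E z <-> E' z)) ->
    (sat E e f <-> sat E' e f).
Proof.
elim: f => //= [s t _|t _|f IH|f IHf g IHg|f IHf g IHg].
- by exists 0.
- by exists (eval e t : nat).+1 => E E'; apply.
- by move=> /IH[L h]; exists L => E E' /h->.
- move=> /andP[/IHf[L h] /IHg[L' h']]; exists (maxn L L') => E E' hE.
  by rewrite (h E E') 1?(h' E E') // => z hz; apply: hE; rewrite leq_max hz ?orbT.
- move=> /andP[/IHf[L h] /IHg[L' h']]; exists (maxn L L') => E E' hE.
  by rewrite (h E E') 1?(h' E E') // => z hz; apply: hE; rewrite leq_max hz ?orbT.
Qed.

Lemma full_diagram (v : nat_str) : approximable v ->
  exists E : nat_str -> Prop, forall m m' a b c, diagram E v m m' a b c.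
Proof.
move=> h.
have [E hE] : exists E : nat -> nat_str -> Prop, forall N : nat_str, forall m m' a b c,
    m <= N -> m' <= N -> a <= N -> b <= N -> c <= N -> diagram (E N) v m m' a b c.
  pose Q (N : nat_str) (E : nat_str -> Prop) := forall m m' a b c,
    m <= N -> m' <= N -> a <= N -> b <= N -> c <= N -> diagram E v m m' a b c.
  exists (fun N => epsilon (inhabits (fun=> True)) (Q N)) => N.
  apply: (epsilon_spec (inhabits (fun=> True)) (Q N)).
  by have [b [c [d hN]]] := h N; exists (coded b c d).
have [E0 h0] := limit_set E; exists E0 => m m' a b c.
have [f qf D] := diagram_form; have [L hL] := local_qf (nth s0 [:: v; m; m'; a; b; c]) qf.
have [n hn hz] := h0 L (m + m' + a + b + c)%N.
have le_n (x : nat_str) : (x <= m + m' + a + b + c)%N -> x <= n.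
  by move=> hx; exists (n - x)%N; apply: subnK; apply: leq_trans hn.
apply/D; apply/(hL _ _ hz); apply/D; apply: hE; apply: le_n.
- by rewrite -!addnA leq_addr.
- by rewrite -!addnA addnCA leq_addr.
- by rewrite -!addnA addnA addnCA leq_addr.
- by rewrite -addnA addnCA leq_addr.
- by rewrite leq_addl.
Qed.

Section Henkin.
Variables (v : nat_str) (E : nat_str -> Prop).
Hypothesis D : forall m m' a b c, diagram E v m m' a b c.
Implicit Types (a b c : nat_str).

(** The structure of names; the model is its quotient by the equality of the diagram. *)
Definition name_str : structure :=
  @Structure nat (zr : nat_str) (fun a => suc a : nat_str)
     (fun a b => ad a b : nat_str) (fun a b => ml a b : nat_str).

Lemma name_congruence : @congruence name_str (fun a b : nat_str => eqn_ E a b).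
Proof.
have tr a b c := dg_trans (D 0 0 a b c).
split=> /=.
- by move=> a; apply: (dg_refl (D 0 0 a 0 0)).
- by move=> a b; apply: (dg_sym (D 0 0 a b 0)).
- exact: tr.
- by move=> a b; apply: (dg_ad1 (D 0 0 a b _)).
- move=> a a' b b' h h'; apply: tr (dg_ad1 (D 0 0 a a' b) h) _.
  exact: dg_ad2 (D 0 0 b b' a') h'.
- move=> a a' b b' h h'; apply: tr (dg_ml1 (D 0 0 a a' b) h) _.
  exact: dg_ml2 (D 0 0 b b' a') h'.
Qed.

(** Satisfaction in the model is read off from the diagram by [P_code], which yields
    induction for all formulas as well as the failure of the formula v. *)
Lemma diagram_model : exists K : structure, pa_model K /\
  forall f, [seq y <- fv f | y != 0] = [::] -> code [:: 0] f = v ->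
    forall e : nat -> K, e 0 = nm v -> ~ sat (fun=> False) e f.
Proof.
have [K [pi [piE surj [pi0 piS] piA piM]]] := quotient_str name_congruence.
pose rep q := epsilon (inhabits (0 : name_str)) (fun a => pi a = q).
have repK q : pi (rep q) = q.
  exact: (epsilon_spec (inhabits (0 : name_str)) (fun a => pi a = q) (surj q)).
pose stk q q' := pi (st (rep q : nat_str) (rep q')).
have stkE a b : stk (pi a) (pi b) = pi (st a b).
  apply/piE; apply: (cg_trans name_congruence).
    by apply: (dg_st1 (D 0 0 _ a _)); apply/piE; rewrite repK.
  by apply: (dg_st2 (D 0 0 _ b _)); apply/piE; rewrite repK.
pose P (m : nat) q := E (pr (m : nat_str) (rep q)).
have PE m a : P m (pi a) <-> E (pr (m : nat_str) a).
  split; apply: (dg_subst (D m 0 _ _ 0)); apply/piE; rewrite repK //.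
have ss : stack_semantics stk P.
  split.
  - by move=> m m' y; exact: dg_nand (D m m' (rep y) 0 0).
  - move=> m m' y; split=> [h [a []]|h].
      rewrite /stk !PE => h1 h2; exact: (dg_ex (D m m' (rep y) (rep a) 0) (conj h1 h2)).
    apply: NNPP => h'; apply: h; have [h1 h2] := dg_henkin (D m m' (rep y) 0 0) h'.
    exists (pi (hk (fm 2 (m : nat_str) m') (rep y))); rewrite -(repK y) stkE !PE.
    by rewrite repK.
  - move=> a b y; rewrite -(repK a) -(repK b) -(repK y) !stkE PE piE.
    exact: dg_eq (D 0 0 (rep a) (rep b) (rep y)).
  - move=> m a b y; rewrite -(repK a) -(repK b) -(repK y) !stkE !PE.
    exact: dg_drop (D m 0 (rep a) (rep b) (rep y)).
  - move=> m y; rewrite -pi0 -(repK y) !stkE !PE.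
    exact: dg_zero (D m 0 (rep y) 0 0).
  - move=> m a y; rewrite -(repK a) -(repK y) -piS !stkE !PE.
    exact: dg_succ (D m 0 (rep a) 0 (rep y)).
  - move=> m a b y; rewrite -(repK a) -(repK b) -(repK y) -piA !stkE !PE.
    exact: dg_add (D m 0 (rep a) (rep b) (rep y)).
  - move=> m a b y; rewrite -(repK a) -(repK b) -(repK y) -piM !stkE !PE.
    exact: dg_mul (D m 0 (rep a) (rep b) (rep y)).
have num k : pi (nn (k : nat_str)) = nm k.
  elim: k => [|k IH]; first exact: pi0.
  by rewrite (@nmS K) -IH -piS; apply/piE; apply: (dg_num (D 0 0 0 k 0)).
have ind m y : P m (stk s0 y) -> (forall q, P m (stk q y) -> P m (stk (sS q) y)) ->
    forall q, P m (stk q y).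
  move=> h0 hS q; move: h0; rewrite -(repK q) -(repK y) -pi0 !stkE !PE.
  apply: (dg_ind (D m 0 (rep y) (rep q) 0)); apply/PE; rewrite repK.
  apply/(ss_ex ss) => -[a [ha]]; rewrite (ss_succ ss); apply; exact: hS.
exists K; split.
  split.
  - by move=> q; rewrite -(repK q) -pi0 -piS; move/piE; apply: (dg_S0 (D 0 0 _ 0 0)).
  - move=> q q'; rewrite -(repK q) -(repK q') -!piS => /piE h.
    by apply/piE; apply: (dg_SI (D 0 0 _ _ 0)).
  - by move=> q; rewrite -(repK q) -pi0 -piA; apply/piE; apply: (dg_A0 (D 0 0 _ 0 0)).
  - move=> q q'; rewrite -(repK q) -(repK q') -!(piS, piA).
    by apply/piE; apply: (dg_AS (D 0 0 _ _ 0)).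
  - by move=> q; rewrite -(repK q) -pi0 -piM; apply/piE; apply: (dg_M0 (D 0 0 _ 0 0)).
  - move=> q q'; rewrite -(repK q) -(repK q') -!(piS, piM, piA).
    by apply/piE; apply: (dg_MS (D 0 0 _ _ 0)).
  exists (fun=> False) => f x e h0 hS.
  pose m := code (x :: fv f) f; pose y := stack stk [seq e z | z <- fv f] s0.
  have C q : P m (stk q y) <-> sat (fun=> False) (upd e x q) f.
    apply: (P_code ss (l := q :: [seq e z | z <- fv f])) => z hz /=.
    rewrite /upd (eq_sym x); case: eqP => //= _.
    by rewrite ltnS size_map index_mem hz (nth_map 0) ?index_mem // nth_index.
  by move=> q; apply/C; apply: ind => [|q']; [exact/C|rewrite !C; apply: hS].
move=> f hf cf e e0 hs; apply: (dg_false (D 0 0 0 0 0)).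
have : P (code [:: 0] f) (stack stk [:: e 0] (pi 0)).
  apply/(@P_code _ _ _ ss [:: 0] f [:: e 0] (pi 0) e) => // z hz; have [->//|ne] := eqVneq z 0.
  have : z \in [seq y <- fv f | y != 0] by rewrite mem_filter ne.
  by rewrite hf.
by rewrite cf /= e0 -num stkE PE.
Qed.

End Henkin.

(** * The diagonal sentence *)

Section Diagonal.
Variables (f : form) (d : nat).
Hypotheses (f_closed : [seq y <- fv f | y != 0] = [::])
  (f_sat : forall (M : structure) (T : M -> Prop) e, sat T e f <-> approximable (e 0))
  (dE : d = code [:: 0] f).

(** If f has the code d, this is f applied to its own code. *)
Definition diagonal : form := Ex 0 (Var 0 =' num d /\' f).

Lemma sat_diagonal (M : structure) (T : M -> Prop) (e : nat -> M) :
  sat T e diagonal <-> approximable (nm d : M).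
Proof.
split=> [[a [E /f_sat h]]|h].
  by move: E h => /=; rewrite eval_num !upd_same => ->.
exists (nm d); split; first by rewrite /= eval_num upd_same.
by apply/f_sat; rewrite upd_same.
Qed.

Lemma diagonal_sentence : sentence diagonal.
Proof.
have E : tvars (num d) = [::] by elim: d.
by rewrite /sentence /nilp /= filter_cat f_closed E.
Qed.

(** Where the sentence fails, the satisfaction class of the model refutes the formula d
    of d, so the model can approximate its own diagram. *)
Lemma diagonal_provable : proves CT_Delta0_regular diagonal.
Proof.
apply: completeness => M T hT e; have [HM HT] := truth_model_valid hT.
have HD : valid T Delta0_induction by move=> q hq; apply: hT; apply: Or32.
apply/sat_diagonal; apply: NNPP => h; apply: (h).
have HS := @sat_classE M HM T HT HD.
apply: (class_approximable HS) => [N|y].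
  have [t [s hs]] := sig_total N; exists (says T s); split; first exact: says_induction hs.
  by move=> x y hx; apply: says_sat_class hs hx.
rewrite dE => hy; apply: h; pose e0 : nat -> M := fun=> nm d.
apply/(@f_sat M (fun=> False) e0); apply/(class_code HS e0 y f_closed).
by rewrite /e0 dE.
Qed.

(** If provable, the sentence is true, which yields a diagram and from it a model of
    PA in which the sentence fails. *)
Lemma diagonal_unprovable : ~ proves PA diagonal.
Proof.
move=> hP.
have sound (M : structure) : pa_model M -> approximable (nm d : M).
  move=> HM; apply/(@sat_diagonal M (fun=> False) (fun=> s0)).
  by apply: (soundness _ hP) => // q hq; apply: (proj2 (pa_model_valid (fun=> False))).
have [E hE] := full_diagram (sound nat_str nat_model).
have [K [HK hK]] := diagram_model hE.
have nmd k : nm k = k :> nat_str by elim: k => // k IH; rewrite nmS IH.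
pose e0 : nat -> K := fun=> nm d.
by apply: (hK f f_closed _ e0); rewrite ?nmd -?dE //; apply/f_sat; apply: sound.
Qed.

End Diagonal.

Theorem corollary31 :
  exists p : form,
    [/\ sentence p, arithmetical p, proves CT_Delta0_regular p & ~ proves PA p].
Proof.
have [f [f_arith f_closed f_sat]] := approximable_form.
have [d dE] : exists d, d = code [:: 0] f by exists (code [:: 0] f).
exists (diagonal f d); split.
- exact: diagonal_sentence.
- exact: f_arith.
- exact: diagonal_provable.
- exact: diagonal_unprovable.
Qed.
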